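(* Let $b>0$, $h\ge0$, $r\in(0,1]$, $c\in[2\sqrt{1-r},c_\#)$, where $c_\#=c_\#(r,b,h)$, and assume that $$f(c^2,r,b,h):=c^2\Big(\frac{\omega_*}{8r}+\frac h2\Big)+\ln\frac{c^2}{4br}-\frac{\omega_*}{2}\,\frac{1-r}{r}>0,$$ where $\omega_*=8.21093\dots$ denotes the greatest positive root of the equation $\omega=4+2\ln\omega$. Then the system $$u_t(t,x)=\Delta u(t,x)+u(t,x)(1-u(t,x)-rv(t-h,x)),\qquad v_t(t,x)=\Delta v(t,x)-bu(t,x)v(t,x)$$ has a positive monotone wavefront $(u,v)(t,x)=(\phi,\theta)(\nu\cdot x+ct)$, $|\nu|=1$, connecting $(0,1)$ with $(1,0)$. Moreover, this wavefront satisfies the following as $t\to-\infty$. If $r\in(0,1)$ and $c>2\sqrt{1-r}$, then for some $\varepsilon>0$ and with $\lambda:=\frac12\big(c-\sqrt{c^2-4(1-r)}\big)$, $$\phi(t)=e^{\lambda t}+O(e^{(\lambda+\varepsilon)t}),\qquad \theta(t)=1-\frac{b\,e^{\lambda(t-ch)}}{1-r}+O(e^{(\lambda+\varepsilon)t}).$$ If $r=1$, then $$\phi(t)=\frac{2c^2/b}{t^2}-\frac{8c}{3b}\Big(c^2\big(1+h+\tfrac1b\big)-4\Big)\frac{\ln(-t)}{t^3}+O\Big(\frac1{t^3}\Big),$$ $$\theta(t)=1+\frac{2c}{t}-\frac43\Big(c^2\big(1+h+\tfrac1b\big)-4\Big)\frac{\ln(-t)}{t^2}+O\Big(\frac1{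t^2}\Big).$$
   Context: A wavefront with speed $c$ connecting $(0,1)$ with $(1,0)$ is a solution of the form $(u,v)(t,x)=(\phi,\theta)(\nu\cdot x+ct)$, $|\nu|=1$, with $(\phi,\theta)(-\infty)=(0,1)$ and $(\phi,\theta)(+\infty)=(1,0)$. It is a positive monotone wavefront if $\phi>0$, $\theta>0$ and both $\phi,\theta$ are monotone. The number $c_\#=c_\#(r,b,h)$ is the unique positive root $c$ of the equation $$c=2\max\Big\{\sqrt{1-r},\ \frac{\sqrt{b'}}{\sqrt{1+b'}}\Big\},\qquad b':=b\,e^{-c^2h/2}.$$
   Formalization: For r<1 the expansion 1 − b e^{λ(t−ch)}/(1−r) + O(e^{(λ+ε)t}) is stated for θ(t−ch) instead of θ(t); the printed version fails for h>0, since θ''−cθ'=bφθ forces θ(t)=1−b e^{λt}/(1−r)+…; for h=0 they agree. *)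

(* Defs.v *)
From HB Require Import structures.
From mathcomp Require Import all_boot all_order all_algebra.
From mathcomp Require Import all_classical all_reals all_analysis.
From mathcomp Require Import ring lra.

Set Implicit Arguments.
Unset Strict Implicit.
Unset Printing Implicit Defensive.

Import Order.TTheory GRing.Theory Num.Theory.
Import numFieldNormedType.Exports.

Local Open Scope classical_set_scope.
Local Open Scope ring_scope.

Definition omega_star {R : realType} : R :=
  xget 0 [set w : R | [/\ 0 < w, w = 4 + 2 * ln w
    & forall w' : R, 0 < w' -> w' = 4 + 2 * ln w' -> w' <= w]].

Definition c_sharp_root {R : realType} (r b h c : R) : Prop :=
  let b' := b * expR (- (c ^+ 2 * h / 2)) in
  0 < c /\ c = 2 * Num.max (Num.sqrt (1 - r)) (Num.sqrt b' / Num.sqrt (1 + b')).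

Definition c_sharp {R : realType} (r b h : R) : R :=
  xget 0 [set c | c_sharp_root r b h c].

(* The first argument z stands for the squared speed.  At z = 0, where the
   formula is meaningless, [ln 0 = 0] makes the value nonpositive for
   0 < r <= 1, so the junk value never satisfies a positivity assumption. *)
Definition fcrit {R : realType} (z r b h : R) : R :=
  z * (omega_star / (8 * r) + h / 2) + ln (z / (4 * b * r))
  - omega_star / 2 * ((1 - r) / r).

(* A function of (t, x) with x in R^d, d = n.+1 >= 1.  The library norm on
   row vectors is the sup norm, hence the explicit Euclidean norm. *)
Definition txfun (R : realType) (n : nat) := R -> 'rV[R]_n.+1 -> R.

Definition dott {R : realType} {n : nat} (x y : 'rV[R]_n.+1) : R :=
  \sum_(i < n.+1) x 0 i * y 0 i.

Definition enorm {R : realType} {n : nat} (x : 'rV[R]_n.+1) : R :=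
  Num.sqrt (dott x x).

Definition dt {R : realType} {n : nat} (u : txfun R n) : txfun R n :=
  fun t x => derive1 (fun s : R => u s x) t.

Definition dx {R : realType} {n : nat} (i : 'I_n.+1) (u : txfun R n) :
  txfun R n := fun t x => 'D_(delta_mx 0 i) (u t) x.

Definition laplacian {R : realType} {n : nat} (u : txfun R n) : txfun R n :=
  fun t x => \sum_(i < n.+1) dx i (dx i u) t x.

Definition jointly_continuous {R : realType} {n : nat} (u : txfun R n) : Prop :=
  continuous (fun p : R * 'rV[R]_n.+1 => u p.1 p.2).

Definition dt_exists {R : realType} {n : nat} (u : txfun R n) : Prop :=
  forall t x, derivable (fun s : R => u s x) t 1.

Definition dx_exists {R : realType} {n : nat} (i : 'I_n.+1) (u : txfun R n) :
  Prop := forall t x, derivable (u t) x (delta_mx 0 i).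

Definition C12 {R : realType} {n : nat} (u : txfun R n) : Prop :=
  [/\ jointly_continuous u,
      dt_exists u /\ jointly_continuous (dt u),
      forall i, dx_exists i u /\ jointly_continuous (dx i u)
    & forall i j, dx_exists j (dx i u) /\ jointly_continuous (dx j (dx i u))].

(* Classical solutions defined for all times t in R. *)
Definition BZ_solution {R : realType} {n : nat} (r b h : R) (u v : txfun R n) :
  Prop :=
  [/\ C12 u, C12 v,
      forall t x, dt u t x =
        laplacian u t x + u t x * (1 - u t x - r * v (t - h) x)
    & forall t x, dt v t x = laplacian v t x - b * u t x * v t x].

Definition plane_wave {R : realType} {n : nat} (nu : 'rV[R]_n.+1) (c : R)
  (phi : R -> R) : txfun R n := fun t x => phi (dott nu x + c * t).

(* The same profile must give a solution for every direction nu. *)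
Definition wavefront {R : realType} (n : nat) (r b h c : R)
  (phi theta : R -> R) : Prop :=
  [/\ forall nu : 'rV[R]_n.+1, enorm nu = 1 ->
        BZ_solution r b h (plane_wave nu c phi) (plane_wave nu c theta),
      phi x @[x --> -oo] --> (0 : R) /\ theta x @[x --> -oo] --> (1 : R)
    & phi x @[x --> +oo] --> (1 : R) /\ theta x @[x --> +oo] --> (0 : R)].

Definition monotone_fun {R : realType} (f : R -> R) : Prop :=
  {homo f : x y / x <= y} \/ {homo f : x y /~ x <= y}.

Definition positive_monotone_wavefront {R : realType} (n : nat) (r b h c : R)
  (phi theta : R -> R) : Prop :=
  [/\ wavefront n r b h c phi theta,
      forall s, 0 < phi s, forall s, 0 < theta s,
      monotone_fun phi & monotone_fun theta].

(* The filter at -oo, packed so that it can index the Landau notation. *)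
Definition at_ninfty (R : realType) : filter_on R :=
  FilterType (ninfty_nbhs R) _.

Lemma omega_star_spec (R : realType) :
  [/\ 0 < omega_star :> R, omega_star = 4 + 2 * ln omega_star :> R
    & forall w : R, 0 < w -> w = 4 + 2 * ln w -> w <= omega_star].
Proof.
pose g (w : R) : R := w - (4 + 2 * ln w).
have ln2_gt0 : 0 < ln (2 : R) by rewrite ln_gt0 // ltr1n.
have ln2_le1 : ln (2 : R) <= 1.
  have := @le_ln1Dx R 1; rewrite (_ : 1 + 1 = 2 :> R) //; apply; lra.
have ln16 : ln (16 : R) = ln 2 *+ 4.
  by rewrite -lnXn // -natrX.
have gcont : {within `[2, 16], continuous g}.
  apply: continuous_in_subspaceT => x; rewrite inE /= in_itv /= => /andP[x2 _].
  apply: cvgB; first exact: cvg_id.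
  apply: cvgD; first exact: cvg_cst.
  apply: cvgM; first exact: cvg_cst.
  by apply: continuous_ln; lra.
have g2 : g 2 < 0 by rewrite /g; lra.
have g16 : 0 < g 16 by rewrite /g ln16 -mulr_natr; lra.
have [||w0] := @IVT R g 2 16 0 _ gcont.
- by rewrite ler_nat.
- by rewrite ge_min le_max (ltW g2) (ltW g16) orbT.
rewrite in_itv /= => /andP[w02 _] gw0.
have w0gt2 : 2 < w0.
  rewrite lt_neqAle w02 andbT; apply/eqP => w0E.
  by move: g2; rewrite w0E gw0 ltxx.
have w0P : w0 = 4 + 2 * ln w0 by apply/eqP; rewrite -subr_eq0; apply/eqP.
rewrite /omega_star; case: xgetP => [w _ [? ? ?] //|none].
exfalso; apply: (none w0); split => //; first by lra.
move=> w w_gt0 wP; rewrite leNgt; apply/negP => w0w.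
have w0_gt0 : 0 < w0 by lra.
have : ln (w / w0) <= w / w0 - 1.
  have := @le_ln1Dx R (w / w0 - 1); rewrite subrKC; apply.
  have : 0 < w / w0 by apply: divr_gt0.
  lra.
rewrite ln_div ?posrE // => lnle.
have : w - w0 <= 2 * (w / w0 - 1) by lra.
rewrite leNgt => /negP; apply.
have -> : w / w0 - 1 = (w - w0) / w0 by field; rewrite gt_eqF.
rewrite mulrA ltr_pdivrMr // mulrC ltr_pM2l ?subr_gt0 //.
Qed.

Lemma c_sharp_spec (R : realType) (r b h : R) :
  0 < r -> r <= 1 -> 0 < b -> 0 <= h ->
  c_sharp_root r b h (c_sharp r b h) /\
  forall c, c_sharp_root r b h c -> c = c_sharp r b h.
Proof.
move=> r0 r1 b0 h0.
pose B (c : R) : R := b * expR (- (c ^+ 2 * h / 2)).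
pose q (x : R) : R := Num.sqrt x / Num.sqrt (1 + x).
pose m (c : R) : R := Num.max (Num.sqrt (1 - r)) (q (B c)).
have B0 c : 0 < B c by rewrite mulr_gt0 // expR_gt0.
have q_gt0 x : 0 < x -> 0 < q x.
  by move=> x0; rewrite divr_gt0 // sqrtr_gt0; lra.
have q_lt1 x : 0 < x -> q x < 1.
  move=> x0; rewrite ltr_pdivrMr ?mul1r ?ltr_sqrt ?sqrtr_gt0; lra.
have q_homo x y : 0 < x -> x <= y -> q x <= q y.
  move=> x0 xy; have y0 : 0 < y by lra.
  rewrite /q ler_pdivrMr ?sqrtr_gt0; last by lra.
  rewrite mulrAC ler_pdivlMr ?sqrtr_gt0; last by lra.
  rewrite -!sqrtrM ?ler_wsqrtr //; lra.
have m_homo x y : 0 < x -> x <= y -> m y <= m x.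
  move=> x0 xy; rewrite /m ge_max !le_max lexx /=.
  apply/orP; right; apply: q_homo => //.
  rewrite /B ler_pM2l // ler_expR lerN2 !ler_wpM2r //.
  by rewrite ler_pXn2r // nnegrE; lra.
have uniq c1 c2 : c_sharp_root r b h c1 -> c_sharp_root r b h c2 -> c1 <= c2.
  move=> [c10 E1] [c20 E2]; rewrite leNgt; apply/negP => lt21.
  have := m_homo _ _ c20 (ltW lt21).
  move: E1 E2; rewrite -/(B _) -/(B _) -/(q _) -/(q _) -/(m _) -/(m _); lra.
have mcont : continuous m.
  move=> c.
  apply: (@continuous_max R R (fun=> Num.sqrt (1 - r)) (q \o B)).
    exact: cvg_cst.
  have Bcont : {for c, continuous B}.
    apply: cvgM; first exact: cvg_cst.
    apply: (@continuous_comp _ _ _ (fun c : R => - (c ^+ 2 * h / 2)) expR).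
      apply: cvgN; apply: cvgM; last exact: cvg_cst.
      by apply: cvgM; [exact: exprn_continuous|exact: cvg_cst].
    exact: continuous_expR.
  apply: cvgM.
    by apply: (@continuous_comp _ _ _ B Num.sqrt) => //; exact: sqrt_continuous.
  apply: cvgV; first by rewrite gt_eqF // sqrtr_gt0 addr_gt0.
  apply: (@continuous_comp _ _ _ (fun c => 1 + B c) Num.sqrt).
    by apply: cvgD; [exact: cvg_cst|exact: Bcont].
  exact: sqrt_continuous.
pose g (c : R) : R := c - 2 * m c.
have gcont : {within `[0, 2], continuous g}.
  apply: continuous_subspaceT => x; apply: cvgB; first exact: cvg_id.
  by apply: cvgM; [exact: cvg_cst|exact: mcont].
have m_gt0 c : 0 < m c by rewrite /m lt_max q_gt0 ?orbT.
have m_le1 c : m c <= 1.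
  rewrite /m ge_max (ltW (q_lt1 _ (B0 c))) andbT.
  by rewrite -[leRHS]sqrtr1 ler_wsqrtr //; lra.
have [||c] := @IVT R g 0 2 0 _ gcont.
- by rewrite ler0n.
- rewrite ge_min le_max /g; apply/andP; split; apply/orP.
    by left; have := m_gt0 0; lra.
  by right; have := m_le1 2; lra.
move=> _ gc.
have cE : c = 2 * m c by apply/eqP; rewrite -subr_eq0; apply/eqP.
have root_c : c_sharp_root r b h c.
  by split; [rewrite cE mulr_gt0 // m_gt0|exact: cE].
have root : c_sharp_root r b h (c_sharp r b h) by exact: (xgetPex _ (ex_intro _ c root_c)).
by split=> // c' root'; apply/eqP; rewrite eq_le !uniq.
Qed.

(* Main.v *)
Require Import Defs.
From HB Require Import structures.
From mathcomp Require Import all_boot all_order all_algebra.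
From mathcomp Require Import all_classical all_reals all_analysis.
From mathcomp Require Import ring lra.

(* With psi = 1 - theta the profile equations
     phi'' - c phi' + phi (1 - r - phi + r psi(. - c h)) = 0,
     psi'' - c psi' + b phi (1 - psi) = 0
   form a cooperative system on the unit square, so a wavefront is obtained by monotone iteration
   between ordered super- and subsolutions; squeezing them at -oo gives the asymptotics.

   The supersolution is the cap at 1 of a sum "base + tail".  In the base, phi = K e^(c t / 2), and
   psi is the exponential b phi / (c^2 / 4) continued tangentially by a function linear in t.
   Writing Q = omega_star / 2, the equation Q - 2 = ln (2 Q) is what makes the linear branch
   admissible, and fcrit > 0 says that r psi(t - c h) - phi < c^2 / 4 - (1 - r) uniformly in t,
   i.e. that the phi-inequality is strict.  The base decays too fast at -oo; the strictness leaves
   room for adding a tail with the right decay, provided that it is small, and this is achieved by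
   taking K large, so that the cap is reached far to the left.

   Tails are truncated asymptotic expansions at -oo plus a perturbation of intermediate order,
   whose sign makes them super- or subsolutions; a large negative perturbation makes the subsolution
   vanish away from -oo. *)

Import Order.TTheory GRing.Theory Num.Theory.
Import numFieldNormedType.Exports.
Local Open Scope classical_set_scope.
Local Open Scope ring_scope.

Set Implicit Arguments.
Unset Strict Implicit.
Unset Printing Implicit Defensive.

(** * Calculus on the line *)

(** The exponent c / 2 maximises c x - x^2, so among exponentials e^(c t / 2) tolerates the largest
    reaction rate, c^2 / 4. The response of psi to it is a multiple of the same exponential; with k
    the ratio of r psi(t - c h) to phi for this response, r psi(t - c h) - phi would be (k - 1) phi,
    unbounded for k > 1. Bending psi into its tangent line cures this: for k >= 1, which is what c <
    c_sharp provides, the difference has the finite maximum r ln k / Q, and this is to be compared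
    with c^2 / 4 - (1 - r). Translating the base only changes K and keeps its inequalities, so K is
    free. Capping at 1 and truncating at 0 create corners, but only of the kind that one-sided test
    functions see with the right sign. The delay looks backwards, so a tail has to satisfy its
    inequalities on a half-line only, where its expansion makes sense. *)

(* A plain definition, unlike the class [is_derive], keeps instance search out of the goals. *)
Definition deriv_at (R : realType) (f : R -> R) (t d : R) : Prop :=
  is_derive t 1 f d.

Lemma deriv_at_eq (R : realType) (f : R -> R) (t a b : R) :
  deriv_at f t a -> a = b -> deriv_at f t b.
Proof. by move=> fa <-. Qed.

Lemma deriv_at_cst (R : realType) (a t : R) : deriv_at (fun=> a) t 0.
Proof. exact: is_derive_cst. Qed.

Lemma deriv_at_id (R : realType) (t : R) : deriv_at (fun s : R => s) t 1.
Proof. exact: is_derive_id. Qed.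

Lemma deriv_atD (R : realType) (f g : R -> R) (t a b : R) :
  deriv_at f t a -> deriv_at g t b -> deriv_at (fun s => f s + g s) t (a + b).
Proof. by move=> fa gb; exact: (@is_deriveD _ _ _ _ _ _ _ _ _ fa gb). Qed.

Lemma deriv_atN (R : realType) (f : R -> R) (t a : R) :
  deriv_at f t a -> deriv_at (fun s => - f s) t (- a).
Proof. by move=> fa; exact: (@is_deriveN _ _ _ _ _ _ _ fa). Qed.

Lemma deriv_atB (R : realType) (f g : R -> R) (t a b : R) :
  deriv_at f t a -> deriv_at g t b -> deriv_at (fun s => f s - g s) t (a - b).
Proof. by move=> fa gb; exact: (@is_deriveB _ _ _ _ _ _ _ _ _ fa gb). Qed.

Lemma deriv_atM (R : realType) (f g : R -> R) (t a b : R) :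
  deriv_at f t a -> deriv_at g t b ->
  deriv_at (fun s => f s * g s) t (a * g t + f t * b).
Proof.
move=> fa gb; apply: deriv_at_eq (@is_deriveM _ _ _ _ _ _ _ _ fa gb) _.
by rewrite /GRing.scale /=; ring.
Qed.

Lemma deriv_atZ (R : realType) (k : R) (f : R -> R) (t a : R) :
  deriv_at f t a -> deriv_at (fun s => k * f s) t (k * a).
Proof.
by move=> fa; apply: deriv_at_eq (deriv_atM (deriv_at_cst k t) fa) _; ring.
Qed.

Lemma deriv_at_comp (R : realType) (f g : R -> R) (t a b : R) :
  deriv_at f (g t) a -> deriv_at g t b -> deriv_at (fun s => f (g s)) t (a * b).
Proof.
move=> fa gb; apply: deriv_at_eq (is_derive1_comp fa gb) _.
by rewrite /GRing.scale /=; ring.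
Qed.

Lemma deriv_at_expR (R : realType) (f : R -> R) (t a : R) :
  deriv_at f t a -> deriv_at (fun s => expR (f s)) t (expR (f t) * a).
Proof. by move=> fa; exact: (deriv_at_comp (is_derive_expR _) fa). Qed.

Lemma deriv_at_ln (R : realType) (f : R -> R) (t a : R) : 0 < f t ->
  deriv_at f t a -> deriv_at (fun s => ln (f s)) t (a / f t).
Proof.
move=> f0 fa; apply: deriv_at_eq (deriv_at_comp (is_derive1_ln f0) fa) _.
by rewrite mulrC.
Qed.

Lemma deriv_at_shift (R : realType) (f : R -> R) (t a k : R) :
  deriv_at f (t + k) a -> deriv_at (fun s => f (s + k)) t a.
Proof.
move=> fa; apply: deriv_at_eq
  (deriv_at_comp (g := fun s => s + k) fa (deriv_atD (deriv_at_id t) (deriv_at_cst k t))) _.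
by ring.
Qed.

Lemma deriv_at_refl (R : realType) (f : R -> R) (t a : R) :
  deriv_at f (- t) a -> deriv_at (fun s => f (- s)) t (- a).
Proof.
move=> fa; apply: deriv_at_eq
  (deriv_at_comp (g := fun s => - s) fa (deriv_atN (deriv_at_id t))) _.
by ring.
Qed.

Lemma deriv_at_near (R : realType) (f g : R -> R) (t a : R) :
  (\forall s \near t, g s = f s) -> deriv_at f t a -> deriv_at g t a.
Proof.
move=> gf; apply: near_eq_is_derive.
by near=> s; apply/esym; near: s.
Unshelve. all: by end_near. Qed.

Lemma deriv_at_cont (R : realType) (f : R -> R) (t a : R) :
  deriv_at f t a -> {for t, continuous f}.
Proof.
move=> fa; apply: differentiable_continuous.
by apply/derivable1_diffP; case: fa.
Qed.

Lemma deriv_MVT (R : realType) (f f1 : R -> R) (a b : R) : a <= b ->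
  (forall t : R, a <= t <= b -> deriv_at f t (f1 t)) ->
  exists2 x, a <= x <= b & f b - f a = f1 x * (b - a).
Proof.
move=> ab ff.
have [||x] := @MVT_segment R f f1 a b ab.
- by move=> x; rewrite in_itv /= => /andP[ax xb]; apply: ff; rewrite !ltW.
- apply: continuous_in_subspaceT => x; rewrite inE /= in_itv /= => xab.
  exact: deriv_at_cont (ff _ xab).
by rewrite in_itv /=; exists x.
Qed.

Lemma deriv_ge0_le (R : realType) (f f1 : R -> R) (a b : R) : a <= b ->
  (forall t : R, a <= t <= b -> deriv_at f t (f1 t)) ->
  (forall t, a <= t <= b -> 0 <= f1 t) -> f a <= f b.
Proof.
move=> ab ff f10; have [x xab E] := deriv_MVT ab ff.
by rewrite -subr_ge0 E mulr_ge0 ?f10 ?subr_ge0.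
Qed.

Lemma deriv_le0_ge (R : realType) (f f1 : R -> R) (a b : R) : a <= b ->
  (forall t : R, a <= t <= b -> deriv_at f t (f1 t)) ->
  (forall t, a <= t <= b -> f1 t <= 0) -> f b <= f a.
Proof.
move=> ab ff f10; rewrite -lerN2.
apply: (@deriv_ge0_le _ (fun s => - f s) (fun s => - f1 s)) => // t tab.
  exact/deriv_atN/ff.
by rewrite oppr_ge0 f10.
Qed.

Lemma deriv_bound_lip (R : realType) (f f1 : R -> R) (M : R) :
  (forall t : R, deriv_at f t (f1 t)) -> (forall t, `|f1 t| <= M) ->
  forall s t, `|f s - f t| <= M * `|s - t|.
Proof.
move=> ff fM.
suff H s t : s <= t -> `|f t - f s| <= M * `|t - s|.
  move=> s t; have [st|/ltW ts] := leP s t; last exact: H.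
  by rewrite distrC (distrC s); exact: H.
by move=> st; have [x _ ->] := deriv_MVT st (fun t _ => ff t); rewrite normrM ler_wpM2r.
Qed.

Lemma near_dist (R : realType) (t e : R) : 0 < e ->
  \forall s \near t, `|s - t| < e.
Proof.
move=> e0; near=> s; rewrite distrC.
by near: s; exact: (@nbhsx_ballx R R t e e0).
Unshelve. all: by end_near. Qed.

(** The integral from [- k] is a primitive only to the right of [- k]. Normalised to vanish at 0,
    these primitives agree wherever two of them are defined, and so they glue. *)
Lemma antiderivative (R : realType) (g : R -> R) : continuous g ->
  exists G : R -> R, forall t : R, deriv_at G t (g t).
Proof.
move=> cg.
pose F (k : nat) (x : R) : R := (\int[lebesgue_measure]_(t in `[(- k%:R)%R, x]) g t)%R.
have dF k (x : R) : - k%:R < x -> deriv_at (F k) x (g x).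
  move=> kx.
  case: (@continuous_FTC1_closed R g (- k%:R) x (x + 1)).
  - by rewrite ltrDl.
  - apply: continuous_compact_integrable; first exact: segment_compact.
    exact: continuous_subspaceT.
  - exact: kx.
  - exact: cg.
  by move=> dF dFE; split; [exact: dF|rewrite -derive1E].
pose H k x := F k x - F k 0.
have dH k (x : R) : - k%:R < x -> deriv_at (H k) x (g x).
  move=> kx; apply: deriv_at_eq (deriv_atB (dF _ _ kx) (deriv_at_cst (F k 0) x)) _.
  by rewrite subr0.
have H0 k : H k 0 = 0 by rewrite /H subrr.
(* The indices start at 1 so that 0, where the primitives are matched, lies inside every domain. *)
have HE k l (x : R) : - k.+1%:R < x -> - l.+1%:R < x -> H k.+1 x = H l.+1 x.
  move=> kx lx.
  have k0 i : - i.+1%:R < 0 :> R by rewrite oppr_lt0 ltr0n.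
  have dd (t : R) : - k.+1%:R < t -> - l.+1%:R < t ->
      deriv_at (fun s => H k.+1 s - H l.+1 s) t 0.
    by move=> ? ?; apply: deriv_at_eq (deriv_atB (dH _ _ _) (dH _ _ _)) _; rewrite ?subrr.
  have [x0|x0] := leP 0 x.
    have [||y _] := @deriv_MVT R (fun s => H k.+1 s - H l.+1 s) (fun=> 0) 0 x.
    - exact: x0.
    - by move=> t /andP[t0 _]; apply: dd; exact: lt_le_trans t0.
    by rewrite mul0r !H0 subrr subr0; exact: subr0_eq.
  have [||y _] := @deriv_MVT R (fun s => H k.+1 s - H l.+1 s) (fun=> 0) x 0.
  - exact: ltW.
  - by move=> t /andP[t0 _]; apply: dd; exact: lt_le_trans t0.
  by rewrite mul0r !H0 subrr sub0r => /eqP; rewrite oppr_eq0 subr_eq0 => /eqP.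
pose K (x : R) := (Num.truncn `|x|).+1.
have Kx x : - (K x)%:R < x.
  have := truncnS_gt `|x|; have := ler_norm (- x); rewrite normrN /K; lra.
exists (fun x => H (K x) x) => t.
(* The index [K x] jumps with x; near [t] the glued function is compared with one fixed primitive,
   based further to the left. *)
apply: (@deriv_at_near _ (H (K t).+1)); last first.
  by apply: dH; apply: le_lt_trans (Kx t); rewrite lerN2 ler_nat.
have := near_dist t (ltr01 : 0 < 1 :> R); apply: filterS => s st.
apply: HE; first exact: Kx.
have := truncnS_gt `|t|; have := ler_norm (- t); rewrite normrN.
have := ler_norm (t - s); rewrite distrC /K -addn2 natrD.
by rewrite -(natr1 (Num.truncn _)); lra.
Qed.

Lemma deriv_atP (R : realType) (f : R -> R) (t a : R) :
  deriv_at f t a <-> forall e, 0 < e ->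
    \forall s \near t, `|f s - f t - a * (s - t)| <= e * `|s - t|.
Proof.
split=> [/is_derive1_caratheodory[g [fE gc gt]] e e0|H].
  move/cvgrPdist_le : gc => /(_ e e0); apply: filterS => s gs.
  rewrite fE -gt -mulrBl normrM ler_wpM2r //.
  by rewrite distrC.
apply/is_derive1_caratheodory.
exists (fun z => if z == t then a else (f z - f t) / (z - t)); split.
- move=> z; case: eqP => [->|/eqP]; first by rewrite !subrr mulr0.
  by rewrite -subr_eq0 => /divfK->.
- apply/cvgrPdist_le => e e0; have := H e e0; rewrite eqxx.
  apply: filterS => s Hs; case: eqP => [_|/eqP st]; first by rewrite subrr normr0 ltW.
  have st0 : s - t != 0 by rewrite subr_eq0.
  rewrite distrC -(@ler_pM2r _ `|s - t|) ?normr_gt0 // -normrM.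
  by rewrite mulrBl divfK.
- by rewrite eqxx.
Qed.

Lemma deriv_at_uniq (R : realType) (f : R -> R) (t a b : R) :
  deriv_at f t a -> deriv_at f t b -> a = b.
Proof. by move=> [_ <-] [_ <-]. Qed.

Lemma near_interval (R : realType) (t : R) (P : R -> Prop) :
  (\forall s \near t, P s) <->
  exists2 e : R, 0 < e & forall s, `|s - t| < e -> P s.
Proof.
split=> [/nbhs_ballP[e /= e0 He]|[e e0 He]].
  by exists e => // s st; apply: He; rewrite /ball /= distrC.
by have := near_dist t e0; apply: filterS.
Qed.

Lemma local_min_deriv2 (R : realType) (P P1 : R -> R) (t p2 : R) :
  (\forall s \near t, deriv_at P s (P1 s)) -> deriv_at P1 t p2 ->
  (\forall s \near t, P t <= P s) -> P1 t = 0 /\ 0 <= p2.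
Proof.
move=> dP dP1 minP.
have [e e0 He] := (near_interval _ _).1 (filterI dP minP).
have inte s : s \in `]t - e, t + e[ -> `|s - t| < e.
  by rewrite in_itv /= ltr_distl.
have P10 : P1 t = 0.
  have Hs : `|t - t| < e by rewrite subrr normr0.
  apply: (deriv_at_uniq (He t Hs).1).
  apply: (@derive1_at_min R P (t - e) (t + e)).
  - by lra.
  - by move=> s /inte /He[[]].
  - by rewrite in_itv /=; lra.
  - by move=> s /inte /He[].
split=> //; rewrite leNgt; apply/negP => p20.
have p20' : 0 < - p2 / 2 by lra.
have [d d0 Hd] := (near_interval _ _).1 ((deriv_atP _ _ _).1 dP1 _ p20').
pose k := Num.min d e / 2.
have [k0 kd ke] : [/\ 0 < k, k < d & k < e].
  by rewrite /k; have [] := leP d e => ?; split; lra.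
have neg s : t < s -> s <= t + k -> P1 s < 0.
  move=> ts sk.
  have st : 0 < s - t by lra.
  have := Hd s; rewrite P10 subr0 gtr0_norm // => /(_ ltac:(lra)) /ler_normlP[_ H].
  have H2 : p2 * (s - t) < 0 by rewrite nmulr_rlt0.
  lra.
(* A mean value point of [t, t + k] could be [t] itself, where [P1] vanishes. Splitting at the
   midpoint keeps the decrease strict on the right half. *)
have [||x /andP[x1 x2] E] := @deriv_MVT R P P1 (t + k / 2) (t + k).
- by lra.
- by move=> s /andP[s1 s2]; apply: (He _ _).1; rewrite gtr0_norm; lra.
have [||y /andP[y1 y2] E'] := @deriv_MVT R P P1 t (t + k / 2).
- by lra.
- by move=> s /andP[s1 s2]; apply: (He _ _).1; rewrite ger0_norm; lra.
have : P t <= P (t + k) by apply: (He _ _).2; rewrite gtr0_norm; lra.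
have Px : P1 x * (k / 2) < 0 by rewrite nmulr_rlt0 ?neg //; lra.
have Py : P1 y * (k / 2) <= 0.
  have [->|yt] := eqVneq y t; first by rewrite P10 mul0r.
  by rewrite nmulr_rle0; [lra | apply: neg; rewrite ?lt_neqAle 1?eq_sym ?yt //; lra].
rewrite (_ : t + k - (t + k / 2) = k / 2) in E; last by lra.
rewrite (_ : t + k / 2 - t = k / 2) in E'; last by lra.
lra.
Qed.

(** * Comparison and monotone iteration *)

(* Differential inequalities for functions with corners are tested, as for viscosity solutions, on
   smooth functions touching [f] from above; [p1] and [p2] are their first two derivatives. *)
Definition touches_above (R : realType) (f : R -> R) (t p1 p2 : R) : Prop :=
  exists P P1 : R -> R,
    [/\ P t = f t, \forall s \near t, f s <= P s,
       \forall s \near t, deriv_at P s (P1 s), P1 t = p1 & deriv_at P1 t p2].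

(** Maximum principle on the whole line: the penalty [e * rho], growing at both ends, forces [f - w]
    plus penalty to attain its minimum, and there the function touching [f] can replace [f] in the
    second derivative test. *)
Lemma comparison (R : realType) (c B M : R) (f g w w1 w2 : R -> R) :
  0 <= c -> 0 < B -> continuous f ->
  (forall t, `|f t| <= M) -> (forall t, `|w t| <= M) ->
  (forall t : R, deriv_at w t (w1 t)) -> (forall t : R, deriv_at w1 t (w2 t)) ->
  (forall t, - g t <= w2 t - c * w1 t - B * w t) ->
  (forall t, exists p1 p2, touches_above f t p1 p2 /\ p2 - c * p1 - B * f t <= - g t) ->
  forall t, w t <= f t.
Proof.
move=> c0 B0 fc fM wM dw dw1 wg fg t1; rewrite leNgt; apply/negP => fw.
have M0 : 0 <= M by apply: le_trans (fM 0).
(* So slow a growth gives nu^2 + c nu <= B / 2, whence rho'' - c rho' - B rho <= 0 and the penalty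
   does not spoil the inequality. *)
pose nu := Num.min 1 (B / 2 / (1 + c)).
have [nu0 nu1 nuB] : [/\ 0 < nu, nu <= 1 & nu * (1 + c) <= B / 2].
  have q0 : 0 < B / 2 / (1 + c) by rewrite !divr_gt0 //; lra.
  have qE : B / 2 / (1 + c) * (1 + c) = B / 2 by field; lra.
  rewrite /nu; have [h|h] := leP 1 (B / 2 / (1 + c)); split=> //; try lra.
  by rewrite -qE ler_wpM2r //; lra.
have nuq : nu ^+ 2 + c * nu <= B / 2.
  have : nu ^+ 2 <= nu by rewrite expr2 ger_pMr.
  by lra.
pose ep t := expR (nu * t); pose em t := expR (- nu * t).
have dep (t : R) : deriv_at ep t (nu * ep t).
  apply: deriv_at_eq (deriv_at_expR (deriv_atZ nu (deriv_at_id t))) _.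
  by rewrite /ep; ring.
have dem (t : R) : deriv_at em t (- nu * em t).
  apply: deriv_at_eq (deriv_at_expR (deriv_atZ (- nu) (deriv_at_id t))) _.
  by rewrite /em; ring.
have ep0 t : 0 < ep t by exact: expR_gt0.
have em0 t : 0 < em t by exact: expR_gt0.
pose rho t := ep t + em t.
have drho (t : R) : deriv_at rho t (nu * ep t + - nu * em t) by exact: deriv_atD.
have rho0 t : 0 < rho t by rewrite addr_gt0.
(* At [t1] the penalty uses up only half of the gap, so the penalised difference is still negative
   there. *)
pose e := (w t1 - f t1) / 2 / rho t1.
have e0 : 0 < e by rewrite !divr_gt0 //; lra.
have erho : e * rho t1 = (w t1 - f t1) / 2 by rewrite /e divfK // gt_eqF.
pose H t := f t - w t + e * rho t.
have Ht1 : H t1 < 0 by rewrite /H; lra.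
pose T := Num.max `|t1| (2 * M / e / nu).
have rhobig t : T <= `|t| -> 2 * M <= e * rho t.
  rewrite /T ge_max => /andP[_].
  rewrite ler_pdivrMr // ler_pdivrMr // => /le_trans; apply.
  rewrite [leRHS]mulrC ler_pM2r //.
  have := @expR_ge1Dx R (nu * t); have := @expR_ge1Dx R (- nu * t).
  rewrite -/(ep t) -/(em t) /rho mulrC.
  by have [t0|t0] := ger0P t; have := ep0 t; have := em0 t; lra.
have Hbig t : T <= `|t| -> 0 <= H t.
  move=> /rhobig; rewrite /H.
  by have /ler_normlP[_ ?] := fM t; have /ler_normlP[? _] := fM t;
    have /ler_normlP[? _] := wM t; have /ler_normlP[? ?] := wM t; lra.
have T0 : 0 <= T by rewrite le_max normr_ge0.
have cH : continuous H.
  move=> t; apply: cvgD; first apply: cvgB.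
  - exact: fc.
  - exact: deriv_at_cont (dw t).
  - by have /deriv_at_cont := deriv_atZ e (drho t).
have [||t0] := @EVT_min R H (- T) T.
- by lra.
- exact: continuous_subspaceT.
rewrite in_itv /= => /andP[Tt0 t0T] minH.
have Ht0 : H t0 < 0.
  apply: le_lt_trans Ht1; apply: minH; rewrite in_itv /= -ler_norml.
  by rewrite /T le_max lexx.
have minH' t : H t0 <= H t.
  have [h|h] := leP `|t| T; first by apply: minH; rewrite in_itv /= -ler_norml.
  by have := Hbig t (ltW h); lra.
have [p1 [p2 [[P [P1 [Pt fP dP P1t dP1]]] pg]]] := fg t0.
pose K t := P t - w t + e * rho t.
pose K1 t := P1 t - w1 t + e * (nu * ep t + - nu * em t).
have [K10 K20] : K1 t0 = 0 /\
    0 <= p2 - w2 t0 + e * (nu * (nu * ep t0) + - nu * (- nu * em t0)).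
apply: (@local_min_deriv2 R K K1 t0).
- move: dP; apply: filterS => s dPs.
  exact: (deriv_atD (deriv_atB dPs (dw s)) (deriv_atZ e (drho s))).
- exact: (deriv_atD (deriv_atB dP1 (dw1 t0))
    (deriv_atZ e (deriv_atD (deriv_atZ nu (dep t0)) (deriv_atZ (- nu) (dem t0))))).
- move: fP; apply: filterS => s fPs.
  by rewrite /K Pt; have := minH' s; rewrite /H; lra.
have HE : H t0 = f t0 - w t0 + e * (ep t0 + em t0) by [].
move: K10; rewrite /K1 P1t => K10.
have cnu : 0 <= c * nu by apply: mulr_ge0 => //; exact: ltW.
have Ep : e * ep t0 * (nu ^+ 2 - c * nu - B) <= 0.
  by apply: mulr_ge0_le0; [apply: mulr_ge0; exact: ltW|lra].
have Em : e * em t0 * (nu ^+ 2 + c * nu - B) <= 0.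
  by apply: mulr_ge0_le0; [apply: mulr_ge0; exact: ltW|lra].
have BH : B * H t0 < 0 by rewrite pmulr_rlt0.
have cK : c * (p1 - w1 t0 + e * (nu * ep t0 + - nu * em t0)) = 0 by rewrite K10 mulr0.
have := wg t0; move: pg BH cK Ep Em K20; rewrite HE.
clear; lra.
Qed.

Lemma taylor1 (R : realType) (f f1 : R -> R) (K : R) :
  (forall t : R, deriv_at f t (f1 t)) ->
  (forall s t, `|f1 s - f1 t| <= K * `|s - t|) ->
  forall s t, `|f s - f t - f1 t * (s - t)| <= K * `|s - t| ^+ 2.
Proof.
move=> df Kf s t.
have K0 : 0 <= K.
  by have := le_trans (normr_ge0 _) (Kf 1 0); rewrite subr0 normr1 mulr1.
have [x xst ->] : exists2 x, `|x - t| <= `|s - t| & f s - f t = f1 x * (s - t).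
  have [st|/ltW st] := leP t s.
    have [x /andP[x1 x2] E] := deriv_MVT st (fun t _ => df t).
    by exists x => //; rewrite !ger0_norm; lra.
  have [x /andP[x1 x2] E] := deriv_MVT st (fun t _ => df t).
  by exists x; [rewrite !ler0_norm; lra|lra].
rewrite -mulrBl normrM expr2 mulrA ler_wpM2r //.
by apply: le_trans (Kf _ _) _; rewrite ler_wpM2l.
Qed.

Lemma cvg_le_cst (R : realType) (u : nat -> R) (l M : R) :
  u n @[n --> \oo] --> l -> (forall n, u n <= M) -> l <= M.
Proof. by move=> ul uM; apply: (cvgr_to_le ul); near=> n. Unshelve. all: by end_near. Qed.

(** A quadratic Taylor remainder uniform in n is an inequality between point values, so it survives
    pointwise limits; no locally uniform convergence is required. *)
Lemma deriv_cvg (R : realType) (f f1 : nat -> R -> R) (g g1 : R -> R) (K : R) :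
  (forall t, f n t @[n --> \oo] --> g t) ->
  (forall t, f1 n t @[n --> \oo] --> g1 t) ->
  (forall n s t, `|f n s - f n t - f1 n t * (s - t)| <= K * `|s - t| ^+ 2) ->
  forall t : R, deriv_at g t (g1 t).
Proof.
move=> fg fg1 fK t.
have gK s : `|g s - g t - g1 t * (s - t)| <= K * `|s - t| ^+ 2.
  apply: (@cvg_le_cst R (fun n => `|f n s - f n t - f1 n t * (s - t)|)) => //.
  apply: cvg_norm; apply: cvgB; first exact: cvgB.
  by apply: cvgM => //; exact: cvg_cst.
have K0 : 0 <= K.
  by have := le_trans (normr_ge0 _) (fK 0%N 1 0); rewrite subr0 normr1 expr1n mulr1.
apply/deriv_atP => e e0; apply/near_interval.
exists (e / (K + 1)); first by rewrite divr_gt0 //; lra.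
move=> s; rewrite ltr_pdivlMr; last by lra.
move=> sK; apply: le_trans (gK s) _; rewrite expr2 mulrA ler_wpM2r //.
have := normr_ge0 (s - t); lra.
Qed.

(** A difference quotient of step d is within K d of the derivative for every n, and it converges;
    hence the derivatives form a Cauchy sequence. This takes the place of an Arzela-Ascoli
    argument. *)
Lemma deriv_is_cvg (R : realType) (f f1 : nat -> R -> R) (K : R) (g : R -> R) :
  (forall t, f n t @[n --> \oo] --> g t) ->
  (forall n s t, `|f n s - f n t - f1 n t * (s - t)| <= K * `|s - t| ^+ 2) ->
  forall t, exists l : R, f1 n t @[n --> \oo] --> l.
Proof.
move=> fg fK t; suff : cvgn (fun n => f1 n t) by move=> h; exists (limn (fun n => f1 n t)).
apply/cauchy_cvgP/cauchy_exP => e e0.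
have K0 : 0 <= K.
  by have := le_trans (normr_ge0 _) (fK 0%N 1 0); rewrite subr0 normr1 expr1n mulr1.
have [d d0 dK] : exists2 d, 0 < d & d * (K + 1) = e / 2.
  exists (e / 2 / (K + 1)); first by rewrite !divr_gt0 //; lra.
  by rewrite divfK //; lra.
exists ((g (t + d) - g t) / d).
have H : (f n (t + d) - f n t) / d @[n --> \oo] --> (g (t + d) - g t) / d.
  by apply: cvgM; [exact: cvgB|exact: cvg_cst].
move/cvgrPdist_lt : H => /(_ (e / 2) ltac:(lra)); apply: filterS => n Hn.
rewrite /ball /=.
have := fK n (t + d) t; rewrite (_ : t + d - t = d); last by lra.
rewrite (gtr0_norm d0).
rewrite (_ : _ - _ = ((f n (t + d) - f n t) / d - f1 n t) * d); last first.
  by field; rewrite gt_eqF.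
rewrite normrM (gtr0_norm d0) expr2 mulrA ler_pM2r // => h.
have := ler_normD ((g (t + d) - g t) / d - (f n (t + d) - f n t) / d)
  ((f n (t + d) - f n t) / d - f1 n t).
rewrite subrKA; lra.
Qed.

(** Variation of constants from -oo: A(t) = e^(- nu t) times the integral of e^(nu s) g(s) over s <=
    t. *)
Lemma first_order_solution (R : realType) (nu M : R) (g : R -> R) :
  0 < nu -> continuous g -> (forall t, 0 <= g t <= M) ->
  exists A : R -> R, (forall t : R, deriv_at A t (- nu * A t + g t)) /\
    forall t, 0 <= nu * A t <= M.
Proof.
move=> nu0 cg gM.
have dE k (t : R) : deriv_at (fun s => expR (k * s)) t (k * expR (k * t)).
  by apply: deriv_at_eq (deriv_at_expR (deriv_atZ k (deriv_at_id t))) _; ring.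
have [G dG] : exists G : R -> R, forall t : R, deriv_at G t (expR (nu * t) * g t).
  apply: (@antiderivative R (fun t => expR (nu * t) * g t)) => t.
  by apply: cvgM; [exact: deriv_at_cont (dE nu t)|exact: cg].
have E0 t : 0 < expR (nu * t) by exact: expR_gt0.
have M0 : 0 <= M by have /andP[h1 h2] := gM 0; exact: le_trans h1 h2.
have Gup s t : s <= t -> G s <= G t.
  move=> st; apply: (deriv_ge0_le st (fun t _ => dG t)) => x _.
  by apply: mulr_ge0; [exact: expR_ge0|have /andP[] := gM x].
have Gdn s t : s <= t -> G t - M / nu * expR (nu * t) <= G s.
  move=> st.
  have : G t - M / nu * expR (nu * t) <= G s - M / nu * expR (nu * s).
    apply: (@deriv_le0_ge R (fun t => G t - M / nu * expR (nu * t))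
       (fun x => expR (nu * x) * g x - M / nu * (nu * expR (nu * x)))) => //.
      by move=> x _; exact: (deriv_atB (dG x) (deriv_atZ _ (dE nu x))).
    move=> x _; rewrite mulrA divfK ?gt_eqF // [M * _]mulrC -mulrBr.
    by rewrite pmulr_rle0 // subr_le0; have /andP[] := gM x.
  have : 0 <= M / nu * expR (nu * s) by apply: mulr_ge0; [rewrite divr_ge0 // ltW|exact: expR_ge0].
  lra.
have lbG t : lbound (range G) (G t - M / nu * expR (nu * t)).
  move=> _ [s _ <-]; have [st|/ltW ts] := leP s t; first exact: Gdn.
  apply: le_trans (Gup _ _ ts).
  by rewrite gerBl; apply: mulr_ge0; [rewrite divr_ge0 // ltW|exact: expR_ge0].
(* [G] is nondecreasing, so its infimum is its limit at -oo and [G t - i] is the improper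
   integral. *)
pose i := inf (range G).
have iG t : i <= G t.
  by apply: ge_inf; [exists (G 0 - M / nu * expR (nu * 0)); exact: lbG|exists t].
have Gi t : G t - M / nu * expR (nu * t) <= i.
  by apply: lb_le_inf; [exists (G 0), 0|exact: lbG].
have EE t : expR (- nu * t) * expR (nu * t) = 1.
  by rewrite -expRD (_ : _ + _ = 0) ?expR0 //; ring.
have F0 t : 0 < expR (- nu * t) by exact: expR_gt0.
exists (fun t => expR (- nu * t) * (G t - i)); split=> t.
  apply: deriv_at_eq (deriv_atM (dE (- nu) t) (deriv_atB (dG t) (deriv_at_cst i t))) _.
  by rewrite subr0 [X in _ + X]mulrA EE; ring.
apply/andP; split.
  apply: mulr_ge0; first exact: ltW.
  by apply: mulr_ge0; [exact: expR_ge0|rewrite subr_ge0].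
have ME : M = expR (- nu * t) * (M * expR (nu * t)) by rewrite mulrCA EE mulr1.
rewrite mulrCA [leRHS]ME ler_pM2l //.
have := Gi t; rewrite lerBlDr -lerBlDl mulrAC ler_pdivlMr //.
by rewrite mulrC.
Qed.

(* With [mu2 > 0 > - nu] the roots of X^2 - c X - B, the solution is (A + C) / (mu2 + nu), where
   A' = - nu A + g and C' = mu2 C - g are the bounded solutions. *)
Lemma second_order_solution (R : realType) (c B M : R) : 0 <= c -> 0 < B ->
  exists K : R, forall g : R -> R, continuous g -> (forall t, 0 <= g t <= M) ->
  exists w w1 w2 : R -> R,
    [/\ forall t : R, deriv_at w t (w1 t), forall t : R, deriv_at w1 t (w2 t),
       forall t, w2 t = c * w1 t + B * w t - g t &
       forall t, `|w t| <= K /\ `|w1 t| <= K].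
Proof.
move=> c0 B0.
pose s := Num.sqrt (c ^+ 2 + 4 * B).
have s2 : s ^+ 2 = c ^+ 2 + 4 * B by rewrite sqr_sqrtr // addr_ge0 ?sqr_ge0 //; lra.
have sc : c < s.
  rewrite -(@ltr_pXn2r R 2) ?nnegrE ?sqrtr_ge0 // s2; lra.
pose nu := (s - c) / 2; pose mu := (s + c) / 2.
have nu0 : 0 < nu by rewrite /nu; lra.
have mu0 : 0 < mu by rewrite /mu; lra.
have s0 : 0 < s by lra.
exists (`|M| * (nu^-1 + mu^-1 + 1) / s) => g cg gM.
have M0 : 0 <= M by have /andP[h1 h2] := gM 0; exact: le_trans h1 h2.
rewrite (ger0_norm M0).
have [A [dA AM]] := first_order_solution nu0 cg gM.
(* Reflecting time turns the unstable equation C' = mu C - g into a damped one, whose bounded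
   solution is already available. *)
have cgN : continuous (fun t => g (- t)).
  by move=> t; apply: continuous_comp; [exact: opp_continuous|exact: cg].
have [C [dC CM]] := first_order_solution (M := M) mu0 cgN (fun t => gM (- t)).
have dC' (t : R) : deriv_at (fun t => C (- t)) t (mu * C (- t) - g t).
  by apply: deriv_at_eq (deriv_at_refl (dC (- t))) _; rewrite opprK; ring.
pose k := s^-1.
exists (fun t => k * (A t + C (- t))), (fun t => k * (- nu * A t + mu * C (- t))),
  (fun t => k * (- nu * (- nu * A t + g t) + mu * (mu * C (- t) - g t))); split=> t.
- apply: deriv_at_eq (deriv_atZ k (deriv_atD (dA t) (dC' t))) _.
  by congr (_ * _); ring.
- exact: (deriv_atZ _ (deriv_atD (deriv_atZ _ (dA t)) (deriv_atZ _ (dC' t)))).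
- have nuE : nu ^+ 2 = - c * nu + B by rewrite /nu; lra.
  have muE : mu ^+ 2 = c * mu + B by rewrite /mu; lra.
  have nm : k * (mu + nu) = 1 by rewrite /k /mu /nu; field; rewrite gt_eqF.
  have -> : k * (- nu * (- nu * A t + g t) + mu * (mu * C (- t) - g t)) =
    k * (nu ^+ 2 * A t + mu ^+ 2 * C (- t)) - k * (mu + nu) * g t by ring.
  by rewrite nuE muE nm; ring.
- have k0 : 0 < k by rewrite invr_gt0.
  have /andP[A0 A1] := AM t; have /andP[C0 C1] := CM (- t).
  have nuV : nu * nu^-1 = 1 by rewrite divff // gt_eqF.
  have muV : mu * mu^-1 = 1 by rewrite divff // gt_eqF.
  have A0' : 0 <= A t by rewrite -(pmulr_rge0 _ nu0).
  have C0' : 0 <= C (- t) by rewrite -(pmulr_rge0 _ mu0).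
  have A1' : A t <= M / nu by rewrite ler_pdivlMr // mulrC.
  have C1' : C (- t) <= M / mu by rewrite ler_pdivlMr // mulrC.
  have Mnu : 0 <= M / nu by rewrite divr_ge0 // ltW.
  have Mmu : 0 <= M / mu by rewrite divr_ge0 // ltW.
  rewrite -/k [leRHS in _ /\ `|_| <= leRHS]mulrC [leRHS in `|_| <= leRHS /\ _]mulrC.
  split; rewrite normrM (gtr0_norm k0) ler_pM2l // !mulrDr mulr1 ler_norml; lra.
Qed.

(** The equation converts the bounds on [w], [w1], [G] into a bound on [w2], and then the Lipschitz
    bound on [G] into one for [w2]. So [w n] and [w1 n] both have uniform quadratic remainders, and
    [deriv_cvg] applies twice. *)
Lemma limit_solution (R : realType) (c B K M L : R) (w w1 w2 G : nat -> R -> R)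
    (v g : R -> R) : 0 <= c -> 0 <= B ->
  (forall n (t : R), deriv_at (w n) t (w1 n t)) ->
  (forall n (t : R), deriv_at (w1 n) t (w2 n t)) ->
  (forall n t, w2 n t = c * w1 n t + B * w n t - G n t) ->
  (forall n t, `|w n t| <= K /\ `|w1 n t| <= K) ->
  (forall n t, `|G n t| <= M) ->
  (forall n s t, `|G n s - G n t| <= L * `|s - t|) ->
  (forall t, w n t @[n --> \oo] --> v t) ->
  (forall t, G n t @[n --> \oo] --> g t) ->
  exists v1 : R -> R, [/\ forall t : R, deriv_at v t (v1 t),
    forall t : R, deriv_at v1 t (c * v1 t + B * v t - g t) &
    forall t, `|v1 t| <= K].
Proof.
move=> c0 B0 dw dw1 eq wK GM GL wv Gg.
have w2M n t : `|w2 n t| <= c * K + B * K + M.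
  have [w0 w10] := wK n t.
  rewrite eq; apply: le_trans (ler_normB _ _) _; apply: lerD => //.
  apply: le_trans (ler_normD _ _) _; rewrite !normrM (ger0_norm c0) (ger0_norm B0).
  by apply: lerD; rewrite ler_wpM2l.
have tw n := taylor1 (dw n) (deriv_bound_lip (dw1 n) (w2M n)).
have [v1 w1v1] := choice (deriv_is_cvg wv tw).
have w2L n s t : `|w2 n s - w2 n t| <= (c * (c * K + B * K + M) + B * K + L) * `|s - t|.
  rewrite !eq (_ : _ - _ = c * (w1 n s - w1 n t) + B * (w n s - w n t) - (G n s - G n t)); last by ring.
  apply: le_trans (ler_normB _ _) _; rewrite mulrDl; apply: lerD => //.
  apply: le_trans (ler_normD _ _) _; rewrite mulrDl !normrM (ger0_norm c0) (ger0_norm B0).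
  rewrite -!mulrA; apply: lerD; rewrite ler_wpM2l //.
    exact: (deriv_bound_lip (dw1 n) (w2M n)).
  by apply: (deriv_bound_lip (dw n)) => x; have [] := wK n x.
have w2v t : w2 n t @[n --> \oo] --> c * v1 t + B * v t - g t.
  under eq_cvg do rewrite eq.
  apply: cvgB => //; apply: cvgD; apply: cvgM => //; exact: cvg_cst.
exists v1; split.
- exact: deriv_cvg wv w1v1 tw.
- exact: deriv_cvg w1v1 w2v (fun n => taylor1 (dw1 n) (w2L n)).
- move=> t; apply: (@cvg_le_cst R (fun n => `|w1 n t|)); first exact: cvg_norm.
  by move=> n; have [] := wK n t.
Qed.

Lemma touches_above_deriv (R : realType) (f f1 : R -> R) (t p2 : R) :
  (forall s, deriv_at f s (f1 s)) -> deriv_at f1 t p2 -> touches_above f t (f1 t) p2.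
Proof. by move=> df df1; exists f, f1; split=> //; near=> s. Unshelve. all: by end_near. Qed.

Lemma comparison_deriv (R : realType) (c B M : R) (g h w w1 w2 v v1 v2 : R -> R) :
  0 <= c -> 0 < B -> (forall t, `|w t| <= M) -> (forall t, `|v t| <= M) ->
  (forall t, deriv_at w t (w1 t)) -> (forall t, deriv_at w1 t (w2 t)) ->
  (forall t, deriv_at v t (v1 t)) -> (forall t, deriv_at v1 t (v2 t)) ->
  (forall t, w2 t = c * w1 t + B * w t - g t) ->
  (forall t, v2 t = c * v1 t + B * v t - h t) ->
  (forall t, g t <= h t) -> forall t, w t <= v t.
Proof.
move=> c0 B0 wM vM dw dw1 dv dv1 wg vh gh.
apply: (comparison c0 B0 _ vM wM dw dw1 (g := g)) => t.
- exact: deriv_at_cont (dv t).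
- by rewrite wg; lra.
- exists (v1 t), (v2 t); split; first exact: touches_above_deriv.
  by have := gh t; rewrite vh; lra.
Qed.

(* The reaction terms plus [B] times the unknown; [B] is there to make them monotone in (u, v). *)
Definition phi_source (R : realType) (r B u v : R) := u * (B + 1 - r - u + r * v).
Definition psi_source (R : realType) (b B u v : R) := B * v + b * u * (1 - v).

Lemma phi_source_homo (R : realType) (r B u v u' v' : R) : 0 <= r <= 1 -> 2 <= B ->
  0 <= u -> u <= u' -> u' <= 1 -> 0 <= v -> v <= v' -> v' <= 1 ->
  phi_source r B u v <= phi_source r B u' v'.
Proof.
move=> /andP[r0 r1] B2 u0 uu' u1 v0 vv' v1; rewrite /phi_source.
have h1 : 0 <= (u' - u) * (B + 1 - r - u - u' + r * v').
  apply: mulr_ge0; first by rewrite subr_ge0.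
  have : 0 <= r * v' by rewrite mulr_ge0 //; lra.
  lra.
have h2 : 0 <= u * (r * (v' - v)) by rewrite !mulr_ge0 // subr_ge0.
lra.
Qed.

Lemma psi_source_homo (R : realType) (b B u v u' v' : R) : 0 <= b -> b <= B ->
  0 <= u -> u <= u' -> u' <= 1 -> 0 <= v -> v <= v' -> v' <= 1 ->
  psi_source b B u v <= psi_source b B u' v'.
Proof.
move=> b0 bB u0 uu' u1 v0 vv' v1; rewrite /psi_source.
have h1 : 0 <= (v' - v) * (B - b * u).
  have bu : b * u <= b by rewrite ler_piMr // (le_trans uu').
  by rewrite mulr_ge0 ?subr_ge0 //; lra.
have h2 : 0 <= b * (u' - u) * (1 - v') by rewrite !mulr_ge0 // subr_ge0.
lra.
Qed.

Lemma phi_source_bound (R : realType) (r B u v : R) : 0 <= r <= 1 -> 2 <= B ->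
  0 <= u <= 1 -> 0 <= v <= 1 -> 0 <= phi_source r B u v <= B.
Proof.
move=> hr B2 /andP[u0 u1] /andP[v0 v1].
have l := @phi_source_homo R r B 0 0 u v hr B2.
have h := @phi_source_homo R r B u v 1 1 hr B2.
have E0 : phi_source r B 0 0 = 0 by rewrite /phi_source mul0r.
have E1 : phi_source r B 1 1 = B by rewrite /phi_source; ring.
by apply/andP; split; [rewrite -E0; apply: l|rewrite -[leRHS]E1; apply: h].
Qed.

Lemma psi_source_bound (R : realType) (b B u v : R) : 0 <= b -> b <= B ->
  0 <= u <= 1 -> 0 <= v <= 1 -> 0 <= psi_source b B u v <= B.
Proof.
move=> b0 bB /andP[u0 u1] /andP[v0 v1].
have l := @psi_source_homo R b B 0 0 u v b0 bB.
have h := @psi_source_homo R b B u v 1 1 b0 bB.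
have E0 : psi_source b B 0 0 = 0 by rewrite /psi_source; ring.
have E1 : psi_source b B 1 1 = B by rewrite /psi_source; ring.
by apply/andP; split; [rewrite -E0; apply: l|rewrite -[leRHS]E1; apply: h].
Qed.

Lemma phi_source_lip (R : realType) (r B K d u v u' v' : R) : 0 <= r <= 1 -> 2 <= B ->
  0 <= u <= 1 -> 0 <= u' <= 1 -> 0 <= v <= 1 -> 0 <= v' <= 1 ->
  `|u - u'| <= K * d -> `|v - v'| <= K * d ->
  `|phi_source r B u v - phi_source r B u' v'| <= (B + 3) * K * d.
Proof.
move=> /andP[r0 r1] B2 /andP[u0 u1] /andP[u'0 u'1] /andP[v0 v1] /andP[v'0 v'1] hu hv.
rewrite /phi_source (_ : _ - _ = (u - u') * (B + 1 - r - u - u' + r * v) + u' * r * (v - v')); last by ring.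
have rv : 0 <= r * v <= 1 by rewrite mulr_ge0 //= mulr_ile1.
have ur : 0 <= u' * r <= 1 by rewrite mulr_ge0 //= mulr_ile1.
apply: le_trans (ler_normD _ _) _; rewrite !normrM.
have h1 : `|u - u'| * `|B + 1 - r - u - u' + r * v| <= K * d * (B + 2).
  by apply: ler_pM => //; rewrite ler_norml; lra.
have h2 : `|u'| * `|r| * `|v - v'| <= 1 * (K * d).
  by rewrite -normrM; apply: ler_pM => //; rewrite ler_norml; lra.
lra.
Qed.

Lemma psi_source_lip (R : realType) (b B K d u v u' v' : R) : 0 <= b -> b <= B ->
  0 <= u <= 1 -> 0 <= u' <= 1 -> 0 <= v <= 1 -> 0 <= v' <= 1 ->
  `|u - u'| <= K * d -> `|v - v'| <= K * d ->
  `|psi_source b B u v - psi_source b B u' v'| <= (B + b) * K * d.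
Proof.
move=> b0 bB /andP[u0 u1] /andP[u'0 u'1] /andP[v0 v1] /andP[v'0 v'1] hu hv.
rewrite /psi_source (_ : _ - _ = (v - v') * (B - b * u) + b * (1 - v') * (u - u')); last by ring.
have bu : 0 <= b * u <= b by rewrite mulr_ge0 //= ler_piMr.
have bv : 0 <= b * (1 - v') <= b by rewrite mulr_ge0 ?subr_ge0 //= ler_piMr //; lra.
apply: le_trans (ler_normD _ _) _; rewrite !normrM.
have h1 : `|v - v'| * `|B - b * u| <= K * d * B.
  by apply: ler_pM => //; rewrite ler_norml; lra.
have h2 : `|b| * `|1 - v'| * `|u - u'| <= b * (K * d).
  by rewrite -normrM; apply: ler_pM => //; rewrite ler_norml; lra.
lra.
Qed.

Lemma cvg_phi_source (R : realType) (T : Type) (F : set_system T) (FF : Filter F)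
    (r B : R) (f g : T -> R) (u v : R) :
  f x @[x --> F] --> u -> g x @[x --> F] --> v ->
  phi_source r B (f x) (g x) @[x --> F] --> phi_source r B u v.
Proof.
move=> fu gv; apply: cvgM => //; apply: cvgD.
  by apply: cvgB => //; exact: cvg_cst.
by apply: cvgM => //; exact: cvg_cst.
Qed.

Lemma cvg_psi_source (R : realType) (T : Type) (F : set_system T) (FF : Filter F)
    (b B : R) (f g : T -> R) (u v : R) :
  f x @[x --> F] --> u -> g x @[x --> F] --> v ->
  psi_source b B (f x) (g x) @[x --> F] --> psi_source b B u v.
Proof.
move=> fu gv; apply: cvgD; first by apply: cvgM => //; exact: cvg_cst.
apply: cvgM; first by apply: cvgM => //; exact: cvg_cst.
by apply: cvgB => //; exact: cvg_cst.
Qed.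

Definition supersolution_phi (R : realType) (c r H : R) (f g : R -> R) : Prop :=
  forall t, exists p1 p2, touches_above f t p1 p2 /\
    p2 - c * p1 + f t * (1 - r - f t + r * g (t - H)) <= 0.

Definition supersolution_psi (R : realType) (c b : R) (f g : R -> R) : Prop :=
  forall t, exists p1 p2, touches_above g t p1 p2 /\
    p2 - c * p1 + b * f t * (1 - g t) <= 0.

(** A subsolution is to be touched from below; this is phrased as touching [- f] from above, so
    [p1], [p2] belong to [- f] and the reaction term changes sign. *)
Definition subsolution_phi (R : realType) (c r H : R) (f g : R -> R) : Prop :=
  forall t, exists p1 p2, touches_above (fun s => - f s) t p1 p2 /\
    p2 - c * p1 - f t * (1 - r - f t + r * g (t - H)) <= 0.

Definition subsolution_psi (R : realType) (c b : R) (f g : R -> R) : Prop :=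
  forall t, exists p1 p2, touches_above (fun s => - g s) t p1 p2 /\
    p2 - c * p1 - b * f t * (1 - g t) <= 0.

(** Solving w'' - c w' - B w = - source preserves order, so iterates starting at the supersolution
    decrease and stay above the subsolution. The derivative bound [K], common to all iterates, lets
    the pointwise limit satisfy the equations. *)
Lemma monotone_iteration (R : realType) (c b r H : R) (fp gp fm gm : R -> R) :
  0 <= c -> 0 <= b -> 0 <= r <= 1 -> 0 <= H ->
  continuous fp -> continuous gp -> continuous fm -> continuous gm ->
  (forall t, 0 <= fm t) -> (forall t, fm t <= fp t) -> (forall t, fp t <= 1) ->
  (forall t, 0 <= gm t) -> (forall t, gm t <= gp t) -> (forall t, gp t <= 1) ->
  {homo fp : s t / s <= t} -> {homo gp : s t / s <= t} ->
  supersolution_phi c r H fp gp -> supersolution_psi c b fp gp ->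
  subsolution_phi c r H fm gm -> subsolution_psi c b fm gm ->
  exists (K : R) (phi phi1 psi psi1 : R -> R),
    [/\ forall t, fm t <= phi t <= fp t, forall t, gm t <= psi t <= gp t,
       {homo phi : s t / s <= t} /\ {homo psi : s t / s <= t},
       forall t, `|phi1 t| <= K /\ `|psi1 t| <= K &
       [/\ forall t, deriv_at phi t (phi1 t),
         forall t, deriv_at phi1 t (c * phi1 t - phi t * (1 - r - phi t + r * psi (t - H))),
         forall t, deriv_at psi t (psi1 t) &
         forall t, deriv_at psi1 t (c * psi1 t - b * phi t * (1 - psi t))]].
Proof.
move=> c0 b0 hr H0 cfp cgp cfm cgm fm0 fmp fp1 gm0 gmp gp1 fph gph supf supg subf subg.
(* Large enough for both source terms to be nondecreasing on the unit square. *)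
pose B := 2 + b.
have B2 : 2 <= B by rewrite /B; lra.
have bB : b <= B by rewrite /B; lra.
have B0 : 0 < B by lra.
have [K HK] := second_order_solution B c0 B0.
pose sol g (w : (R -> R) * (R -> R)) := [/\ forall t, deriv_at w.1 t (w.2 t),
   forall t, deriv_at w.2 t (c * w.2 t + B * w.1 t - g t) &
   forall t, `|w.1 t| <= K /\ `|w.2 t| <= K].
(* The solution operator is chosen as a total function so that it can be iterated; outside the
   admissible sources its value is arbitrary. *)
have [T TP] : exists T : (R -> R) -> (R -> R) * (R -> R), forall g : R -> R,
    continuous g -> (forall t, 0 <= g t <= B) -> sol g (T g).
  suff /choice[T TP] : forall g : R -> R, exists w, continuous g -> (forall t, 0 <= g t <= B) -> sol g w.
    by exists T.
  move=> g; have [cg|ncg] := pselect (continuous g); last by exists (g, g).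
  have [gB|ngB] := pselect (forall t, 0 <= g t <= B); last by exists (g, g).
  have [w [w1 [w2 [dw dw1 E wK]]]] := HK g cg gB.
  exists (w, w1) => _ _; split=> // t.
  by apply: deriv_at_eq (dw1 t) _; rewrite E.
pose F (u : (R -> R) * (R -> R)) t := phi_source r B (u.1 t) (u.2 (t - H)).
pose G (u : (R -> R) * (R -> R)) t := psi_source b B (u.1 t) (u.2 t).
pose good (u : (R -> R) * (R -> R)) := [/\ continuous u.1, continuous u.2,
  forall t, fm t <= u.1 t <= fp t, forall t, gm t <= u.2 t <= gp t &
  {homo u.1 : s t / s <= t} /\ {homo u.2 : s t / s <= t}].
have unit1 u : good u -> forall t, 0 <= u.1 t <= 1.
  move=> [_ _ h _ _] t; have /andP[h1 h2] := h t.
  by rewrite (le_trans (fm0 t) h1) (le_trans h2 (fp1 t)).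
have unit2 u : good u -> forall t, 0 <= u.2 t <= 1.
  move=> [_ _ _ h _] t; have /andP[h1 h2] := h t.
  by rewrite (le_trans (gm0 t) h1) (le_trans h2 (gp1 t)).
have cshift (f : R -> R) k : continuous f -> continuous (fun t => f (t + k)).
  move=> cf t; apply: continuous_comp; last exact: cf.
  by apply: cvgD; [exact: cvg_id|exact: cvg_cst].
have solF u : good u -> sol (F u) (T (F u)).
  move=> gu; have [c1 c2 _ _ _] := gu; apply: TP => t.
    by apply: cvg_phi_source; [exact: c1|exact: cshift].
  by apply: phi_source_bound => //; [exact: unit1|exact: unit2].
have solG u : good u -> sol (G u) (T (G u)).
  move=> gu; have [c1 c2 _ _ _] := gu; apply: TP => t.
    by apply: cvg_psi_source; [exact: c1|exact: c2].
  by apply: psi_source_bound => //; [exact: unit1|exact: unit2].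
have cmp g h w v : sol g w -> sol h v -> (forall t, g t <= h t) ->
    forall t, w.1 t <= v.1 t.
  move=> [dw dw1 wK] [dv dv1 vK] gh.
  by apply: (comparison_deriv c0 B0 (fun t => (wK t).1) (fun t => (vK t).1) dw dw1 dv dv1
    (g := g) (h := h)).
have sol_shift g w k : sol g w -> sol (fun t => g (t + k))
    ((fun t => w.1 (t + k)), (fun t => w.2 (t + k))).
  by move=> [dw dw1 wK]; split=> t /=; [exact/deriv_at_shift|exact/deriv_at_shift|exact: wK].
(* A translate of a solution solves the equation with the translated source, so monotonicity in time
   is an instance of comparison. *)
have homoT g : sol g (T g) -> {homo g : s t / s <= t} -> {homo (T g).1 : s t / s <= t}.
  move=> sg hg s t st; rewrite -(subrKC s t).
  apply: (cmp _ _ _ _ sg (sol_shift _ _ (t - s) sg)) => x /=.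
  by apply: hg; rewrite lerDl subr_ge0.
have K1 (f : R -> R) : (forall t, `|f t| <= 1) -> forall t, `|f t| <= Num.max K 1.
  by move=> h t; rewrite le_max h orbT.
have KK (f : R -> R) : (forall t, `|f t| <= K) -> forall t, `|f t| <= Num.max K 1.
  by move=> h t; rewrite le_max h.
have fp0 t : 0 <= fp t by apply: le_trans (fmp t).
have gp0 t : 0 <= gp t by apply: le_trans (gmp t).
have fm1 t : fm t <= 1 by apply: le_trans (fp1 t).
have gm1 t : gm t <= 1 by apply: le_trans (gp1 t).
have absle1 x : 0 <= x -> x <= 1 -> `|x| <= 1 :> R by move=> ? ?; rewrite ger0_norm.
pose step u := ((T (F u)).1, (T (G u)).1).
have contT g w : sol g w -> continuous w.1 by move=> [dw _ _] t; exact: deriv_at_cont (dw t).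
have Kabs g w : sol g w -> forall t, `|w.1 t| <= Num.max K 1.
  by move=> [_ _ wK]; apply: KK => t; exact: (wK t).1.
have good_step u : good u -> good (step u).
  move=> gu; have sF := solF _ gu; have sG := solG _ gu.
  have [c1 c2 b1 b2 [h1 h2]] := gu.
  have u1 := unit1 _ gu; have u2 := unit2 _ gu.
  have Fm t : phi_source r B (fm t) (gm (t - H)) <= F u t.
    have /andP[] := u1 t; have /andP[] := u2 (t - H); have /andP[] := b1 t; have /andP[] := b2 (t - H).
    by move=> *; exact: phi_source_homo.
  have Fp t : F u t <= phi_source r B (fp t) (gp (t - H)).
    have /andP[] := u1 t; have /andP[] := u2 (t - H); have /andP[] := b1 t; have /andP[] := b2 (t - H).
    by move=> *; exact: phi_source_homo.
  have Gm t : psi_source b B (fm t) (gm t) <= G u t.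
    have /andP[] := u1 t; have /andP[] := u2 t; have /andP[] := b1 t; have /andP[] := b2 t.
    by move=> *; exact: psi_source_homo.
  have Gp t : G u t <= psi_source b B (fp t) (gp t).
    have /andP[] := u1 t; have /andP[] := u2 t; have /andP[] := b1 t; have /andP[] := b2 t.
    by move=> *; exact: psi_source_homo.
  have upper g w f : sol g w -> continuous f -> (forall t, `|f t| <= 1) ->
      (forall t, exists p1 p2, touches_above f t p1 p2 /\ p2 - c * p1 - B * f t <= - g t) ->
      forall t, w.1 t <= f t.
    move=> sw cf f1 hf; have [dw dw1 wK] := sw.
    apply: (comparison c0 B0 cf (K1 _ f1) (Kabs _ _ sw) dw dw1 _ hf) => t.
    by lra.
  have lower g w f : sol g w -> continuous f -> (forall t, `|f t| <= 1) ->
      (forall t, exists p1 p2, touches_above (fun s => - f s) t p1 p2 /\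
         p2 - c * p1 + B * f t <= g t) ->
      forall t, f t <= w.1 t.
    move=> sw cf f1 hf t; have [dw dw1 wK] := sw; rewrite -lerN2.
    move: t; apply: (comparison c0 B0 (M := Num.max K 1) (g := fun t => - g t) _ _ _
      (fun t => deriv_atN (dw t)) (fun t => deriv_atN (dw1 t))) => t.
    - by apply: cvgN; exact: cf.
    - by rewrite normrN; exact: K1.
    - by rewrite normrN; exact: Kabs sw _.
    - by lra.
    - have [p1 [p2 [hp1 hp2]]] := hf t; exists p1, p2; split=> //; lra.
  split=> /=.
  - exact: contT sF.
  - exact: contT sG.
  - move=> t; apply/andP; split; move: t.
    + apply: lower sF cfm _ _ => t; first exact: absle1.
      have [p1 [p2 [hp1 hp2]]] := subf t; exists p1, p2; split=> //.
      by apply: le_trans (Fm t); rewrite /phi_source; lra.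
    + apply: upper sF cfp _ _ => t; first exact: absle1.
      have [p1 [p2 [hp1 hp2]]] := supf t; exists p1, p2; split=> //.
      by have := Fp t; rewrite /phi_source; lra.
  - move=> t; apply/andP; split; move: t.
    + apply: lower sG cgm _ _ => t; first exact: absle1.
      have [p1 [p2 [hp1 hp2]]] := subg t; exists p1, p2; split=> //.
      by apply: le_trans (Gm t); rewrite /psi_source; lra.
    + apply: upper sG cgp _ _ => t; first exact: absle1.
      have [p1 [p2 [hp1 hp2]]] := supg t; exists p1, p2; split=> //.
      by have := Gp t; rewrite /psi_source; lra.
  - split; apply: homoT => // s t st.
    + have /andP[] := u1 s; have /andP[] := u1 t; have /andP[] := u2 (s - H); have /andP[] := u2 (t - H).
      move=> *; apply: phi_source_homo => //; first exact: h1.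
      by apply: h2; rewrite lerB.
    + have /andP[] := u1 s; have /andP[] := u1 t; have /andP[] := u2 s; have /andP[] := u2 t.
      by move=> *; apply: psi_source_homo => //; [exact: h1|exact: h2].
pose U n := iter n step (fp, gp).
have goodU n : good (U n).
  elim: n => [|n IH]; last exact: good_step.
  by split=> //= t; rewrite ?fmp ?gmp lexx.
have decU n : (forall t, (U n.+1).1 t <= (U n).1 t) /\ (forall t, (U n.+1).2 t <= (U n).2 t).
  elim: n => [|n [IH1 IH2]].
    by have [_ _ h1 h2 _] := goodU 1%N; split=> t; [have /andP[] := h1 t|have /andP[] := h2 t].
  have sF m := solF _ (goodU m); have sG m := solG _ (goodU m).
  have u1 m := unit1 _ (goodU m); have u2 m := unit2 _ (goodU m).
  split; [apply: cmp (sF n.+1) (sF n) _ | apply: cmp (sG n.+1) (sG n) _] => t.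
    have /andP[] := u1 n t; have /andP[] := u1 n.+1 t.
    have /andP[] := u2 n (t - H); have /andP[] := u2 n.+1 (t - H).
    by move=> *; exact: phi_source_homo.
  have /andP[] := u1 n t; have /andP[] := u1 n.+1 t.
  have /andP[] := u2 n t; have /andP[] := u2 n.+1 t.
  by move=> *; exact: psi_source_homo.
have cvgU (a : nat -> R) : (forall n, a n.+1 <= a n) -> (forall n, 0 <= a n) ->
    a n @[n --> \oo] --> limn a.
  move=> da a0; apply: nonincreasing_is_cvgn.
    by apply/nonincreasing_seqP.
  by exists 0 => _ [n _ <-].
pose phi t := limn (fun n => (U n).1 t); pose psi t := limn (fun n => (U n).2 t).
have Uphi t : (U n).1 t @[n --> \oo] --> phi t.
  apply: cvgU => n; first exact: (decU n).1.
  by have /andP[] := unit1 _ (goodU n) t.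
have Upsi t : (U n).2 t @[n --> \oo] --> psi t.
  apply: cvgU => n; first exact: (decU n).2.
  by have /andP[] := unit2 _ (goodU n) t.
have shift1 (a : nat -> R) (l : R) : a n @[n --> \oo] --> l -> a n.+1 @[n --> \oo] --> l.
  by move=> h; rewrite cvg_shiftS.
have sF m := solF _ (goodU m); have sG m := solG _ (goodU m).
(* The starting pair is only known to be continuous; Lipschitz bounds hold from the first iterate
   on, hence the shifted indices below. *)
have lipU n : (forall s t, `|(U n.+1).1 s - (U n.+1).1 t| <= K * `|s - t|) /\
              (forall s t, `|(U n.+1).2 s - (U n.+1).2 t| <= K * `|s - t|).
  have [dw _ wK] := sF n; have [dv _ vK] := sG n.
  by split; apply: deriv_bound_lip => // x; [exact: (wK x).2|exact: (vK x).2].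
have [phi1 [dphi dphi1 phiK]] : exists v1 : R -> R, [/\ forall t, deriv_at phi t (v1 t),
    forall t, deriv_at v1 t (c * v1 t + B * phi t - F (phi, psi) t) &
    forall t, `|v1 t| <= K].
  apply: (@limit_solution R c B K B ((B + 3) * K) (fun n => (T (F (U n.+1))).1)
    (fun n => (T (F (U n.+1))).2) (fun n t => c * (T (F (U n.+1))).2 t + B * (T (F (U n.+1))).1 t - F (U n.+1) t)
    (fun n => F (U n.+1))) => //.
  - by lra.
  - by move=> n t; case: (sF n.+1).
  - by move=> n t; case: (sF n.+1).
  - by move=> n t; case: (sF n.+1).
  - move=> n t.
    have /andP[h0 h1] := phi_source_bound hr B2 (unit1 _ (goodU n.+1) t) (unit2 _ (goodU n.+1) (t - H)).
    by rewrite ger0_norm.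
  - move=> n s t.
    apply: (phi_source_lip hr B2 (unit1 _ (goodU n.+1) s) (unit1 _ (goodU n.+1) t)
      (unit2 _ (goodU n.+1) _) (unit2 _ (goodU n.+1) _)); first exact: (lipU n).1.
    by rewrite (_ : s - t = s - H - (t - H)); [exact: (lipU n).2|ring].
  - by move=> t; exact: (shift1 _ _ (shift1 _ _ (Uphi t))).
  - move=> t; apply: cvg_phi_source.
      by exact: (shift1 _ _ (Uphi _)).
    by exact: (shift1 _ _ (Upsi _)).
have [psi1 [dpsi dpsi1 psiK]] : exists v1 : R -> R, [/\ forall t, deriv_at psi t (v1 t),
    forall t, deriv_at v1 t (c * v1 t + B * psi t - G (phi, psi) t) &
    forall t, `|v1 t| <= K].
  apply: (@limit_solution R c B K B ((B + b) * K) (fun n => (T (G (U n.+1))).1)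
    (fun n => (T (G (U n.+1))).2) (fun n t => c * (T (G (U n.+1))).2 t + B * (T (G (U n.+1))).1 t - G (U n.+1) t)
    (fun n => G (U n.+1))) => //.
  - by lra.
  - by move=> n t; case: (sG n.+1).
  - by move=> n t; case: (sG n.+1).
  - by move=> n t; case: (sG n.+1).
  - move=> n t.
    have /andP[h0 h1] := psi_source_bound b0 bB (unit1 _ (goodU n.+1) t) (unit2 _ (goodU n.+1) t).
    by rewrite ger0_norm.
  - move=> n s t.
    by apply: (psi_source_lip b0 bB (unit1 _ (goodU n.+1) s) (unit1 _ (goodU n.+1) t)
      (unit2 _ (goodU n.+1) _) (unit2 _ (goodU n.+1) _)); [exact: (lipU n).1|exact: (lipU n).2].
  - by move=> t; exact: (shift1 _ _ (shift1 _ _ (Upsi t))).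
  - move=> t; apply: cvg_psi_source.
      by exact: (shift1 _ _ (Uphi _)).
    by exact: (shift1 _ _ (Upsi _)).
have limle (a d : nat -> R) (l m : R) : a n @[n --> \oo] --> l -> d n @[n --> \oo] --> m ->
    (forall n, a n <= d n) -> l <= m.
  by move=> al dm ad; apply: (ler_cvg_to al dm); near=> n.
have cstle (l : R) : (fun=> l) n @[n --> \oo] --> l by exact: cvg_cst.
exists K, phi, phi1, psi, psi1; split.
- move=> t; apply/andP; split.
    by apply: limle (cstle _) (Uphi t) _ => n; have [_ _ h _ _] := goodU n; have /andP[] := h t.
  by apply: limle (Uphi t) (cstle _) _ => n; have [_ _ h _ _] := goodU n; have /andP[] := h t.
- move=> t; apply/andP; split.
    by apply: limle (cstle _) (Upsi t) _ => n; have [_ _ _ h _] := goodU n; have /andP[] := h t.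
  by apply: limle (Upsi t) (cstle _) _ => n; have [_ _ _ h _] := goodU n; have /andP[] := h t.
- split=> s t st.
    by apply: limle (Uphi s) (Uphi t) _ => n; have [_ _ _ _ [h _]] := goodU n; exact: h.
  by apply: limle (Upsi s) (Upsi t) _ => n; have [_ _ _ _ [_ h]] := goodU n; exact: h.
- by move=> t.
- split=> // t.
    by apply: deriv_at_eq (dphi1 t) _; rewrite /F /phi_source /=; ring.
  by apply: deriv_at_eq (dpsi1 t) _; rewrite /G /psi_source /=; ring.
Unshelve. all: by end_near. Qed.

(** * Limits at +oo and strict positivity of theta *)

(** The flux w' - c w is bounded and has derivative - k, so k cannot stay above a positive
    constant. *)
Lemma flux_limit_le0 (R : realType) (c K l : R) (w w1 k : R -> R) : 0 <= c ->
  (forall t, deriv_at w t (w1 t)) -> (forall t, deriv_at w1 t (c * w1 t - k t)) ->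
  (forall t, `|w t| <= 1) -> (forall t, `|w1 t| <= K) ->
  k t @[t --> +oo] --> l -> l <= 0.
Proof.
move=> c0 dw dw1 wM w1K kl; rewrite leNgt; apply/negP => l0.
have [T [_ HT]] : \forall t \near +oo, l / 2 <= k t.
  by apply: (cvgr_ge l kl); lra.
pose f t := w1 t - c * w t.
have fM t : `|f t| <= K + c.
  apply: le_trans (ler_normB _ _) _; apply: lerD; first exact: w1K.
  by rewrite normrM (ger0_norm c0) ler_piMr.
have K0 : 0 <= K by apply: le_trans (w1K 0).
(* Over this length the flux falls by at least d l / 2 = 2 (K + c + 1), more than the room 2 (K + c)
   left by its bound. *)
pose d := 4 * (K + c + 1) / l.
have d0 : 0 < d by rewrite divr_gt0 //; lra.
have : f (T + 1 + d) - - (l / 2) * (T + 1 + d) <= f (T + 1) - - (l / 2) * (T + 1).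
  apply: (@deriv_le0_ge R (fun t => f t - - (l / 2) * t)
    (fun t => c * w1 t - k t - c * w1 t - - (l / 2) * 1)); first by lra.
    by move=> t _; exact: (deriv_atB (deriv_atB (dw1 t) (deriv_atZ c (dw t)))
         (deriv_atZ _ (deriv_at_id t))).
  by move=> t /andP[t1 _]; have := HT t ltac:(lra); lra.
have dl : d * l = 4 * (K + c + 1) by rewrite /d divfK // gt_eqF.
have /ler_normlP[_ h1] := fM (T + 1); have /ler_normlP[h2 _] := fM (T + 1 + d).
by move: dl h1 h2; clear; lra.
Qed.

Lemma flux_limit_eq0 (R : realType) (c K l : R) (w w1 k : R -> R) : 0 <= c ->
  (forall t, deriv_at w t (w1 t)) -> (forall t, deriv_at w1 t (c * w1 t - k t)) ->
  (forall t, `|w t| <= 1) -> (forall t, `|w1 t| <= K) ->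
  k t @[t --> +oo] --> l -> l = 0.
Proof.
move=> c0 dw dw1 wM w1K kl; apply/eqP; rewrite eq_le.
rewrite (flux_limit_le0 c0 dw dw1 wM w1K kl) /= -oppr_le0.
apply: (@flux_limit_le0 R c K (- l) (fun t => - w t) (fun t => - w1 t) (fun t => - k t)) => //.
- by move=> t; exact: deriv_atN (dw t).
- by move=> t; apply: deriv_at_eq (deriv_atN (dw1 t)) _; ring.
- by move=> t; rewrite normrN.
- by move=> t; rewrite normrN.
- exact: cvgN.
Qed.

(** Monotone bounded profiles have limits (p, q), at which both reaction terms must vanish. As p >
    0, the first gives q = 1 and then the second p = 1. *)
Lemma profile_limits (R : realType) (c b r H K t0 : R) (phi phi1 psi psi1 : R -> R) :
  0 <= c -> 0 < b -> 0 < r ->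
  (forall t, 0 <= phi t <= 1) -> (forall t, 0 <= psi t <= 1) ->
  {homo phi : s t / s <= t} -> {homo psi : s t / s <= t} -> 0 < phi t0 ->
  (forall t, `|phi1 t| <= K /\ `|psi1 t| <= K) ->
  (forall t, deriv_at phi t (phi1 t)) ->
  (forall t, deriv_at phi1 t (c * phi1 t - phi t * (1 - r - phi t + r * psi (t - H)))) ->
  (forall t, deriv_at psi t (psi1 t)) ->
  (forall t, deriv_at psi1 t (c * psi1 t - b * phi t * (1 - psi t))) ->
  phi t @[t --> +oo] --> (1 : R) /\ psi t @[t --> +oo] --> (1 : R).
Proof.
move=> c0 b0 r0 phi01 psi01 hphi hpsi phit0 K1 dphi dphi1 dpsi dpsi1.
have mono (f : R -> R) : (forall t, 0 <= f t <= 1) -> {homo f : s t / s <= t} ->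
    f t @[t --> +oo] --> sup (range f).
  move=> f01 hf; apply: nondecreasing_cvgr; first exact: hf.
  by exists 1 => _ [t _ <-]; have /andP[] := f01 t.
have cphi := mono _ phi01 hphi; have cpsi := mono _ psi01 hpsi.
set p := sup (range phi) in cphi; set q := sup (range psi) in cpsi.
have abs (f : R -> R) : (forall t, 0 <= f t <= 1) -> forall t, `|f t| <= 1.
  by move=> f01 t; have /andP[? ?] := f01 t; rewrite ger0_norm.
have p0 : 0 < p.
  apply: lt_le_trans phit0 _; apply: ub_le_sup; last by exists t0.
  by exists 1 => _ [t _ <-]; have /andP[] := phi01 t.
have cpsiH : psi (t - H) @[t --> +oo] --> q by rewrite cvg_centerr.
have e1 : b * p * (1 - q) = 0.
  apply: (flux_limit_eq0 c0 dpsi dpsi1 (abs _ psi01) (fun t => (K1 t).2)).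
  apply: cvgM; first by apply: cvgM => //; exact: cvg_cst.
  by apply: cvgB => //; exact: cvg_cst.
have e2 : p * (1 - r - p + r * q) = 0.
  apply: (flux_limit_eq0 c0 dphi dphi1 (abs _ phi01) (fun t => (K1 t).1)).
  apply: cvgM => //; apply: cvgD; first by apply: cvgB => //; exact: cvg_cst.
  by apply: cvgM => //; exact: cvg_cst.
have q1 : q = 1.
  move/eqP: e1; rewrite !mulf_eq0 (gt_eqF b0) (gt_eqF p0) /= => /eqP; lra.
have p1 : p = 1.
  move/eqP: e2; rewrite mulf_eq0 (gt_eqF p0) /= q1 => /eqP; lra.
by rewrite p1 in cphi; rewrite q1 in cpsi.
Qed.

(* [theta'' - c theta' - b theta <= 0] factors through the roots [- nu < 0 < mu] of X^2 - c X - b. *)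
Lemma psi_lt1 (R : realType) (c b K t0 : R) (phi psi psi1 : R -> R) :
  0 <= c -> 0 < b -> (forall t, 0 <= phi t <= 1) -> (forall t, 0 <= psi t <= 1) ->
  {homo psi : s t / s <= t} -> psi t0 < 1 -> (forall t, `|psi1 t| <= K) ->
  (forall t, deriv_at psi t (psi1 t)) ->
  (forall t, deriv_at psi1 t (c * psi1 t - b * phi t * (1 - psi t))) ->
  forall t, psi t < 1.
Proof.
move=> c0 b0 phi01 psi01 hpsi psit0 K1 dpsi dpsi1 t.
have [/hpsi tt0|/ltW t0t] := leP t t0; first exact: le_lt_trans tt0 psit0.
pose s := Num.sqrt (c ^+ 2 + 4 * b).
have s2 : s ^+ 2 = c ^+ 2 + 4 * b by rewrite sqr_sqrtr // addr_ge0 ?sqr_ge0 //; lra.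
have sc : c < s by rewrite -(@ltr_pXn2r R 2) ?nnegrE ?sqrtr_ge0 // s2; lra.
pose nu := (s - c) / 2; pose mu := (s + c) / 2.
have nu0 : 0 < nu by rewrite /nu; lra.
have mu0 : 0 < mu by rewrite /mu; lra.
have munu : mu * nu = b by rewrite /mu /nu; lra.
have mnc : mu - nu = c by rewrite /mu /nu; lra.
have dE k (x : R) : deriv_at (fun s => expR (k * s)) x (k * expR (k * x)).
  by apply: deriv_at_eq (deriv_at_expR (deriv_atZ k (deriv_at_id x))) _; ring.
(* This is theta' + nu theta, and v' <= mu v. A negative value would run off to -oo exponentially,
   against [vM]; so v >= 0, which makes e^(nu t) theta nondecreasing and carries positivity to the
   right. *)
pose v x := - psi1 x + nu * (1 - psi x).
have K0 : 0 <= K by apply: le_trans (K1 0).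
have vM x : `|v x| <= K + nu.
  apply: le_trans (ler_normD _ _) _; rewrite normrN; apply: lerD => //.
  have /andP[? ?] := psi01 x.
  by rewrite normrM (gtr0_norm nu0) ler_piMr ?ler_norml; lra.
have dv x : deriv_at v x (mu * v x - b * (1 - phi x) * (1 - psi x)).
  apply: deriv_at_eq (deriv_atD (deriv_atN (dpsi1 x))
    (deriv_atZ nu (deriv_atB (deriv_at_cst 1 x) (dpsi x)))) _.
  by rewrite /v -munu -mnc; ring.
have dec x y : x <= y -> expR (- mu * y) * v y <= expR (- mu * x) * v x.
  move=> xy; apply: (@deriv_le0_ge R (fun x => expR (- mu * x) * v x) _ x y xy
    (fun z _ => deriv_atM (dE (- mu) z) (dv z))) => z _.
  rewrite (_ : _ + _ = - (expR (- mu * z) * (b * (1 - phi z) * (1 - psi z)))); last by ring.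
  rewrite oppr_le0; apply: mulr_ge0; first exact: expR_ge0.
  have /andP[? ?] := psi01 z; have /andP[? ?] := phi01 z.
  by rewrite !mulr_ge0 ?subr_ge0 // ltW.
have v0 x : 0 <= v x.
  rewrite leNgt; apply/negP => vx.
  pose d := (K + nu) / (- v x) / mu.
  have d0 : 0 < d by rewrite !divr_gt0 //; lra.
  have dE2 : d * mu * (- v x) = K + nu by rewrite /d divfK ?gt_eqF // divfK // lt0r_neq0 //; lra.
  have := dec x (x + d) ltac:(lra).
  have -> : - mu * x = - mu * (x + d) + mu * d by ring.
  rewrite expRD -mulrA ler_pM2l ?expR_gt0 //.
  have := @expR_ge1Dx R (mu * d) => hE.
  have : expR (mu * d) * v x <= (1 + mu * d) * v x by rewrite ler_wnM2r // ltW.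
  have /ler_normlP[h _] := vM (x + d).
  by move: h dE2 vx; clear; lra.
have : expR (nu * t0) * (1 - psi t0) <= expR (nu * t) * (1 - psi t).
  apply: (@deriv_ge0_le R (fun x => expR (nu * x) * (1 - psi x)) _ t0 t t0t
    (fun z _ => deriv_atM (dE nu z) (deriv_atB (deriv_at_cst 1 z) (dpsi z)))) => z _.
  rewrite (_ : _ + _ = expR (nu * z) * v z); last by rewrite /v; ring.
  by rewrite mulr_ge0 ?expR_ge0.
move=> h; have : 0 < expR (nu * t) * (1 - psi t).
  by apply: lt_le_trans h; rewrite mulr_gt0 ?expR_gt0 // subr_gt0.
by rewrite pmulr_rgt0 ?expR_gt0 // subr_gt0.
Qed.

(** * Plane waves *)

Lemma is_derive_line (R : realType) (n : nat) (g : 'rV[R]_n.+1 -> R)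
    (x v : 'rV[R]_n.+1) (d : R) :
  deriv_at (fun k => g (k *: v + x)) 0 d -> is_derive x v g d.
Proof.
have E : (fun k : R => k^-1 *: (((fun k => g (k *: v + x)) \o shift 0) (k *: (1 : R))
    - g (0 *: v + x))) = (fun k => k^-1 *: ((g \o shift x) (k *: v) - g x)).
  by apply/funext => k /=; rewrite scale0r add0r addr0 /GRing.scale /= mulr1.
by case; rewrite /derivable /derive E => h1 h2; split.
Qed.

Lemma dott_delta (R : realType) (n : nat) (nu x : 'rV[R]_n.+1) (i : 'I_n.+1) (k : R) :
  dott nu (k *: delta_mx 0 i + x) = nu 0 i * k + dott nu x.
Proof.
rewrite /dott (eq_bigr (fun j => nu 0 j * (k * (j == i)%:R) + nu 0 j * x 0 j)); last first.
  by move=> j _; rewrite !mxE eqxx /= mulrDr.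
rewrite big_split /=; congr (_ + _).
rewrite (bigD1 i) //= eqxx mulr1 big1 ?addr0 // => j ji.
by rewrite (negbTE ji) !mulr0.
Qed.

Lemma dott_continuous (R : realType) (n : nat) (nu : 'rV[R]_n.+1) :
  continuous (dott nu).
Proof.
have add_cont : continuous (fun z : R * R => z.1 + z.2) by exact: add_continuous.
have H := @continuous_big R 'I_n.+1 +%R 0 xpredT add_cont 'rV[R]_n.+1 (index_enum _)
  (fun i x => nu 0 i * x 0 i); apply: H => i _ x.
apply: (@continuous_comp _ _ _ (fun x : 'rV[R]_n.+1 => x 0 i) ( *%R (nu 0 i))).
  exact: coord_continuous.
exact: mulrl_continuous.
Qed.

Lemma plane_wave_continuous (R : realType) (n : nat) (nu : 'rV[R]_n.+1) (c : R)
  (f : R -> R) : continuous f -> jointly_continuous (plane_wave nu c f).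
Proof.
move=> cf p; rewrite /plane_wave.
apply: (@continuous_comp _ _ _ (fun p : R * 'rV[R]_n.+1 => dott nu p.2 + c * p.1) f).
  apply: cvgD.
    by apply: (@continuous_comp _ _ _ snd (dott nu)); [exact: cvg_snd|exact: dott_continuous].
  by apply: cvgM; [exact: cvg_cst|exact: cvg_fst].
exact: cf.
Qed.

Lemma plane_wave_dt (R : realType) (n : nat) (nu : 'rV[R]_n.+1) (c : R) (f f1 : R -> R) :
  (forall s, deriv_at f s (f1 s)) ->
  dt_exists (plane_wave nu c f) /\
  dt (plane_wave nu c f) = plane_wave nu c (fun s => c * f1 s).
Proof.
move=> df.
have dl (x : 'rV[R]_n.+1) t : deriv_at (fun s => f (dott nu x + c * s)) t (c * f1 (dott nu x + c * t)).
  apply: deriv_at_eq (deriv_at_comp (g := fun s => dott nu x + c * s) (df _)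
    (deriv_atD (deriv_at_cst _ t) (deriv_atZ c (deriv_at_id t)))) _.
  by ring.
split; first by move=> t x; case: (dl x t).
apply/funext => t; apply/funext => x.
by rewrite /dt derive1E; case: (dl x t).
Qed.

Lemma plane_wave_dx (R : realType) (n : nat) (nu : 'rV[R]_n.+1) (c : R) (f f1 : R -> R)
    (i : 'I_n.+1) :
  (forall s, deriv_at f s (f1 s)) ->
  dx_exists i (plane_wave nu c f) /\
  dx i (plane_wave nu c f) = plane_wave nu c (fun s => nu 0 i * f1 s).
Proof.
move=> df.
have dl (x : 'rV[R]_n.+1) t :
    is_derive x (delta_mx 0 i) (plane_wave nu c f t) (nu 0 i * f1 (dott nu x + c * t)).
  apply: is_derive_line; rewrite /plane_wave.
  rewrite (_ : (fun k => _) = fun k => f (nu 0 i * k + (dott nu x + c * t))); last first.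
    by apply/funext => k; rewrite dott_delta addrA.
  apply: deriv_at_eq (deriv_at_comp (g := fun s => nu 0 i * s + (dott nu x + c * t)) (df _)
    (deriv_atD (deriv_atZ _ (deriv_at_id 0)) (deriv_at_cst _ 0))) _.
  by rewrite mulr0 add0r; ring.
split; first by move=> t x; case: (dl x t).
by apply/funext => t; apply/funext => x; rewrite /dx; case: (dl x t).
Qed.

Lemma plane_wave_C12 (R : realType) (n : nat) (nu : 'rV[R]_n.+1) (c : R) (f f1 f2 : R -> R) :
  (forall s, deriv_at f s (f1 s)) -> (forall s, deriv_at f1 s (f2 s)) -> continuous f2 ->
  C12 (plane_wave nu c f).
Proof.
move=> df df1 cf2.
have cf : continuous f by move=> t; exact: deriv_at_cont (df t).
have cf1 : continuous f1 by move=> t; exact: deriv_at_cont (df1 t).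
have cZ k (g : R -> R) : continuous g -> continuous (fun s => k * g s).
  by move=> cg t; apply: cvgM; [exact: cvg_cst|exact: cg].
have dZ k t := deriv_atZ k (df1 t).
split.
- exact: plane_wave_continuous.
- have [dtf ->] := plane_wave_dt nu c df.
  by split=> //; apply/plane_wave_continuous/cZ.
- move=> i; have [dxf ->] := plane_wave_dx nu c i df.
  by split=> //; apply/plane_wave_continuous/cZ.
- move=> i j; have [_ ->] := plane_wave_dx nu c i df.
  have [dxf ->] := plane_wave_dx nu c j (dZ (nu 0 i)).
  by split=> //; apply/plane_wave_continuous/cZ/cZ.
Qed.

Lemma plane_wave_laplacian (R : realType) (n : nat) (nu : 'rV[R]_n.+1) (c : R)
    (f f1 f2 : R -> R) t x :
  (forall s, deriv_at f s (f1 s)) -> (forall s, deriv_at f1 s (f2 s)) -> enorm nu = 1 ->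
  laplacian (plane_wave nu c f) t x = plane_wave nu c f2 t x.
Proof.
move=> df df1 nu1; rewrite /laplacian.
have dZ k s := deriv_atZ k (df1 s).
have nu2 : \sum_(i < n.+1) nu 0 i * nu 0 i = 1.
  have -> : \sum_(i < n.+1) nu 0 i * nu 0 i = enorm nu ^+ 2.
    by rewrite sqr_sqrtr // sumr_ge0 // => i _; rewrite -expr2 sqr_ge0.
  by rewrite nu1 expr1n.
rewrite (eq_bigr (fun i => nu 0 i * nu 0 i * plane_wave nu c f2 t x)).
  by rewrite -mulr_suml nu2 mul1r.
move=> i _; have [_ ->] := plane_wave_dx nu c i df.
have [_ ->] := plane_wave_dx nu c i (dZ (nu 0 i)).
by rewrite /plane_wave mulrA.
Qed.

Lemma profile_wavefront (R : realType) (n : nat) (r b h c : R) (phi phi1 psi psi1 : R -> R) :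
  (forall t, 0 < phi t) -> (forall t, psi t < 1) ->
  {homo phi : s t / s <= t} -> {homo psi : s t / s <= t} ->
  (forall t, deriv_at phi t (phi1 t)) ->
  (forall t, deriv_at phi1 t (c * phi1 t - phi t * (1 - r - phi t + r * psi (t - c * h)))) ->
  (forall t, deriv_at psi t (psi1 t)) ->
  (forall t, deriv_at psi1 t (c * psi1 t - b * phi t * (1 - psi t))) ->
  phi t @[t --> -oo] --> (0 : R) -> psi t @[t --> -oo] --> (0 : R) ->
  phi t @[t --> +oo] --> (1 : R) -> psi t @[t --> +oo] --> (1 : R) ->
  positive_monotone_wavefront n r b h c phi (fun t => 1 - psi t).
Proof.
move=> phi0 psi1' hphi hpsi dphi dphi1 dpsi dpsi1 phim psim phip psip.
have cphi : continuous phi by move=> t; exact: deriv_at_cont (dphi t).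
have cpsi : continuous psi by move=> t; exact: deriv_at_cont (dpsi t).
have cphi1 : continuous phi1 by move=> t; exact: deriv_at_cont (dphi1 t).
have cpsi1 : continuous psi1 by move=> t; exact: deriv_at_cont (dpsi1 t).
pose theta t := 1 - psi t.
have dtheta t : deriv_at theta t (- psi1 t).
  by apply: deriv_at_eq (deriv_atB (deriv_at_cst 1 t) (dpsi t)) _; rewrite sub0r.
have dtheta1 t : deriv_at (fun s => - psi1 s) t (c * - psi1 t + b * phi t * theta t).
  by apply: deriv_at_eq (deriv_atN (dpsi1 t)) _; rewrite /theta; ring.
split.
- split.
  + move=> nu nu1.
    have [_ dtphi] := plane_wave_dt nu c dphi.
    have [_ dttheta] := plane_wave_dt nu c dtheta.
    split.
    * apply: (plane_wave_C12 nu c dphi dphi1) => t.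
      apply: cvgB; first by apply: cvgM; [exact: cvg_cst|exact: cphi1].
      apply: cvgM; first exact: cphi.
      apply: cvgD.
        by apply: cvgB; [exact: cvg_cst|exact: cphi].
      apply: cvgM; first exact: cvg_cst.
      apply: (@continuous_comp _ _ _ (fun t => t - c * h) psi); last exact: cpsi.
      by apply: cvgB; [exact: cvg_id|exact: cvg_cst].
    * apply: (plane_wave_C12 nu c dtheta dtheta1) => t.
      apply: cvgD; first by apply: cvgM; [exact: cvg_cst|apply: cvgN; exact: cpsi1].
      apply: cvgM; last by apply: cvgB; [exact: cvg_cst|exact: cpsi].
      by apply: cvgM; [exact: cvg_cst|exact: cphi].
    * move=> t x; rewrite dtphi (plane_wave_laplacian _ _ _ dphi dphi1 nu1) /plane_wave.
      rewrite (_ : dott nu x + c * (t - h) = dott nu x + c * t - c * h); last by ring.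
      by ring.
    * move=> t x; rewrite dttheta (plane_wave_laplacian _ _ _ dtheta dtheta1 nu1) /plane_wave /theta.
      by ring.
  + split=> //; rewrite -[X in _ --> X]subr0; apply: cvgB => //; exact: cvg_cst.
  + split=> //; rewrite -[X in _ --> X](subrr 1); apply: cvgB => //; exact: cvg_cst.
- exact: phi0.
- by move=> s; rewrite subr_gt0.
- by left.
- by right=> s t st; rewrite lerB //; exact: hpsi.
Qed.

(** * Super- and subsolutions from their tails *)

Definition C2_before (R : realType) (t0 : R) (f f1 f2 : R -> R) : Prop :=
  forall t, t < t0 -> deriv_at f t (f1 t) /\ deriv_at f1 t (f2 t).

Lemma near_lt (R : realType) (t t0 : R) : t < t0 -> \forall s \near t, s < t0.
Proof.
move=> tt0; apply/near_interval; exists (t0 - t); first by rewrite subr_gt0.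
by move=> s; rewrite ltr_distl => /andP[]; lra.
Qed.

Lemma touches_above_cst (R : realType) (f : R -> R) (t : R) :
  (forall s, f s <= f t) -> touches_above f t 0 0.
Proof.
move=> h; exists (fun=> f t), (fun=> 0); split=> //; try exact: deriv_at_cst.
- by near=> s; exact: h.
- by near=> s; exact: deriv_at_cst.
Unshelve. all: by end_near. Qed.

Lemma touches_above_C2 (R : realType) (t0 t : R) (f P P1 P2 : R -> R) :
  C2_before t0 P P1 P2 -> t < t0 -> P t = f t -> (\forall s \near t, f s <= P s) ->
  touches_above f t (P1 t) (P2 t).
Proof.
move=> dP tt0 Pt fP; exists P, P1; split=> //.
- near=> s; apply: (dP _ _).1; near: s; exact: near_lt.
- exact: (dP _ tt0).2.
Unshelve. all: by end_near. Qed.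

Lemma touches_aboveD (R : realType) (f g P P1 : R -> R) (t p1 p2 q2 : R) :
  (\forall s \near t, deriv_at P s (P1 s)) -> deriv_at P1 t q2 ->
  touches_above f t p1 p2 -> g t = P t + f t -> (\forall s \near t, g s <= P s + f s) ->
  touches_above g t (P1 t + p1) (q2 + p2).
Proof.
move=> dP dP1 [S [S1 [St fS dS <- dS1]]] gt gP.
exists (fun s => P s + S s), (fun s => P1 s + S1 s); split=> //.
- by rewrite St gt.
- near=> s; have h1 : g s <= P s + f s by near: s.
  have h2 : f s <= S s by near: s.
  lra.
- by near=> s; apply: deriv_atD; near: s.
- exact: deriv_atD.
Unshelve. all: by end_near. Qed.

(** The logarithm of Q times the base exponential, normalised to be [L] at [T]; a large [L] at a [T]
    far to the left is the large K of the overview. *)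
Definition log_slope (R : realType) (c T L t : R) : R := c / 2 * (t - T) + L.

Definition base_exp (R : realType) (c Q T L t : R) : R := expR (log_slope c T L t) / Q.

(** With l = [log_slope], this is e^l / Q for l <= 0 and (1 + l) / Q for l >= 0. The inner maximum
    is what selects e^l on the left, since 1 + l never exceeds e^l. *)
Definition base_psi (R : realType) (c Q T L t : R) : R :=
  Num.min (expR (log_slope c T L t)) (1 + Num.max 0 (log_slope c T L t)) / Q.

Lemma deriv_log_slope (R : realType) (c T L t : R) : deriv_at (log_slope c T L) t (c / 2).
Proof.
apply: deriv_at_eq (deriv_atD (deriv_atZ (c / 2) (deriv_atB (deriv_at_id t)
  (deriv_at_cst T t))) (deriv_at_cst L t)) _.
by ring.
Qed.

Lemma deriv_base_exp (R : realType) (c Q T L k t : R) :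
  deriv_at (fun t => k * base_exp c Q T L t) t (k * (c / 2) * base_exp c Q T L t).
Proof.
apply: deriv_at_eq (deriv_atZ k (deriv_atM (deriv_at_expR (deriv_log_slope c T L t))
  (deriv_at_cst Q^-1 t))) _.
by rewrite /base_exp; ring.
Qed.

Lemma log_slope_homo (R : realType) (c T L : R) : 0 <= c -> {homo log_slope c T L : s t / s <= t}.
Proof. by move=> c0 s t st; rewrite /log_slope lerD2r ler_wpM2l // ?lerB //; lra. Qed.

Lemma base_exp_gt0 (R : realType) (c Q T L t : R) : 0 < Q -> 0 < base_exp c Q T L t.
Proof. by move=> Q0; rewrite divr_gt0 // expR_gt0. Qed.

Lemma base_psi_ge0 (R : realType) (c Q T L t : R) : 0 < Q -> 0 <= base_psi c Q T L t.
Proof.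
move=> Q0; apply: divr_ge0; last exact: ltW.
rewrite le_min expR_ge0 /=.
by rewrite addr_ge0 // le_max lexx.
Qed.

Lemma base_psi_le_exp (R : realType) (c Q T L t : R) : 0 < Q ->
  base_psi c Q T L t <= base_exp c Q T L t.
Proof. by move=> Q0; rewrite ler_pM2r ?invr_gt0 // ge_min lexx. Qed.

Lemma base_psi_homo (R : realType) (c Q T L : R) : 0 <= c -> 0 < Q ->
  {homo base_psi c Q T L : s t / s <= t}.
Proof.
move=> c0 Q0 s t st; have h := log_slope_homo T L c0 st.
rewrite ler_pM2r ?invr_gt0 // le_min !ge_min ler_expR h /=.
by rewrite lerD2l ge_max !le_max lexx h /= !orbT.
Qed.

Lemma base_psi_cont (R : realType) (c Q T L : R) : continuous (base_psi c Q T L).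
Proof.
have cl t : {for t, continuous (log_slope c T L)} by exact: deriv_at_cont (deriv_log_slope c T L t).
move=> t; apply: cvgM; last exact: cvg_cst.
apply: (@continuous_min R R (expR \o log_slope c T L) (fun t => 1 + Num.max 0 (log_slope c T L t))).
  by apply: continuous_comp; [exact: cl|exact: continuous_expR].
apply: cvgD; first exact: cvg_cst.
by apply: (@continuous_max R R (fun=> 0) (log_slope c T L)); [exact: cvg_cst|exact: cl].
Qed.

(* For k >= 1 the curve [e^l / (k Q) + ln k / Q] is tangent to the linear branch at l = ln k. *)
Lemma base_psi_envelope (R : realType) (c Q T L k t : R) : 0 < Q -> 1 <= k ->
  base_psi c Q T L t <= base_exp c Q T L t / k + ln k / Q.
Proof.
move=> Q0 k1; have k0 : 0 < k by lra.
rewrite /base_psi /base_exp mulrAC -mulrDl ler_pM2r ?invr_gt0 //.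
set l := log_slope c T L t.
have a0 : 0 <= ln k by rewrite ln_ge0.
have El : expR l / k = expR (l - ln k) by rewrite expRB lnK.
rewrite El; have [l0|l0] := leP 0 l.
  rewrite ge_min; apply/orP; right.
  have := @expR_ge1Dx R (l - ln k); lra.
rewrite ge_min; apply/orP; left.
rewrite -lerBlDl -{1}(subrK (ln k) l) -El.
have : expR (l - ln k) = expR l * expR (- ln k) by rewrite -expRD.
have : expR l <= 1 by rewrite -expR0 ler_expR ltW.
have := @expR_ge1Dx R (- ln k); have := expR_ge0 l.
have : expR (- ln k) <= 1 by rewrite -expR0 ler_expR oppr_le0.
rewrite subrK El => h1 h2 h3 h4 ->.
have : expR l * (1 - expR (- ln k)) <= 1 * (1 - expR (- ln k)).
  by rewrite ler_wpM2r // subr_ge0.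
lra.
Qed.

(* For l <= 0 the exponential branch is an exact supersolution; for l > 0 the claim is
   e^l (Q - 1 - l) <= 2 Q, whose worst case l = Q - 2 is the equation 2 Q = e^(Q - 2). *)
Lemma base_psi_super (R : realType) (c Q T L t : R) : 0 < c -> 0 < Q -> expR (Q - 2) = 2 * Q ->
  exists p1 p2, touches_above (base_psi c Q T L) t p1 p2 /\
    p2 - c * p1 + c ^+ 2 / 4 * base_exp c Q T L t * (1 - base_psi c Q T L t) <= 0.
Proof.
move=> c0 Q0 QE; set l := log_slope c T L.
have [l0|l0] := leP (l t) 0.
  have Et : base_psi c Q T L t = base_exp c Q T L t.
    rewrite /base_psi /base_exp -/l (max_idPl l0) addr0 (min_idPl _) //.
    by rewrite -expR0 ler_expR.
  exists (c / 2 * base_exp c Q T L t), (c / 2 * (c / 2) * base_exp c Q T L t); split.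
    exists (base_exp c Q T L), (fun t => c / 2 * base_exp c Q T L t); split=> //.
    - by near=> s; exact: base_psi_le_exp.
    - near=> s; have := deriv_base_exp c Q T L 1 s; rewrite mul1r.
      by apply: deriv_at_near; near=> z; rewrite mul1r.
    - exact: deriv_base_exp.
  rewrite Et; have := base_exp_gt0 c T L t Q0 => y0.
  have : 0 <= c ^+ 2 / 4 * base_exp c Q T L t ^+ 2 by rewrite mulr_ge0 ?sqr_ge0 // divr_ge0 ?sqr_ge0.
  lra.
have Et : base_psi c Q T L t = (1 + l t) / Q.
  by rewrite /base_psi -/l (max_idPr (ltW l0)) (min_idPr (expR_ge1Dx _)).
exists (c / 2 * Q^-1), 0; split.
  exists (fun s => (1 + l s) / Q), (fun=> c / 2 * Q^-1); split=> //.
  - have : \forall s \near t, 0 < l s.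
      have /cvgr_gt := deriv_at_cont (deriv_log_slope c T L t).
      by apply; exact: l0.
    apply: filterS => s s0.
    by rewrite /base_psi -/l ler_pM2r ?invr_gt0 // ge_min (max_idPr (ltW s0)) lexx orbT.
  - near=> s; apply: deriv_at_eq (deriv_atM (deriv_atD (deriv_at_cst 1 s)
      (deriv_log_slope c T L s)) (deriv_at_cst Q^-1 s)) _; ring.
  - exact: deriv_at_cst.
rewrite Et /base_exp -/l.
have h : expR (l t) * (Q - 1 - l t) <= 2 * Q.
  rewrite -QE (_ : Q - 2 = l t + (Q - 2 - l t)); last by ring.
  rewrite expRD ler_pM2l ?expR_gt0 //.
  have := @expR_ge1Dx R (Q - 2 - l t); lra.
have E : 0 - c * (c / 2 / Q) + c ^+ 2 / 4 * (expR (l t) / Q) * (1 - (1 + l t) / Q) =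
   c ^+ 2 / 4 / Q ^+ 2 * (expR (l t) * (Q - 1 - l t) - 2 * Q).
  by field; rewrite gt_eqF.
rewrite E mulr_ge0_le0 // ?subr_le0 // !divr_ge0 ?sqr_ge0 //.
Unshelve. all: by end_near. Qed.

Lemma C2_before_homo (R : realType) (t0 : R) (f f1 f2 : R -> R) :
  C2_before t0 f f1 f2 -> (forall t, t < t0 -> 0 <= f1 t) ->
  forall s t, s <= t -> t < t0 -> f s <= f t.
Proof.
move=> df f10 s t st tt0; apply: (deriv_ge0_le st) => x /andP[_ xt].
  by apply: (df _ _).1; apply: le_lt_trans tt0.
by apply: f10; apply: le_lt_trans tt0.
Qed.

Lemma continuous_stopped (R : realType) (f : R -> R) (T : R) :
  (forall t, t <= T -> {for t, continuous f}) -> continuous (fun t => f (Num.min t T)).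
Proof.
move=> cf t; apply: (@continuous_comp _ _ _ (fun t => Num.min t T) f).
  by apply: (@continuous_min R R id (fun=> T)); [exact: cvg_id|exact: cvg_cst].
by apply: cf; rewrite ge_min lexx orbT.
Qed.

(** The signs of [Phi1] and [Psi1] make the capped sums monotone; the limits at -oo make the
    interaction with the base small and identify the limit state of the wave. *)
Record tail_supersolution (R : realType) (c b r H t0 : R)
    (Phi Phi1 Phi2 Psi Psi1 Psi2 : R -> R) : Prop := TailSupersolution {
  tsup_dPhi : C2_before t0 Phi Phi1 Phi2;
  tsup_dPsi : C2_before t0 Psi Psi1 Psi2;
  tsup_Phi01 : forall t, t < t0 -> 0 <= Phi t <= 1;
  tsup_Psi01 : forall t, t < t0 -> 0 <= Psi t <= 1;
  tsup_Phi1 : forall t, t < t0 -> 0 <= Phi1 t;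
  tsup_Psi1 : forall t, t < t0 -> 0 <= Psi1 t;
  tsup_phi : forall t, t < t0 ->
    Phi2 t - c * Phi1 t + Phi t * (1 - r - Phi t + r * Psi (t - H)) <= 0;
  tsup_psi : forall t, t < t0 -> Psi2 t - c * Psi1 t + b * Phi t * (1 - Psi t) <= 0;
  tsup_Phi0 : Phi t @[t --> -oo] --> (0 : R);
  tsup_Psi0 : Psi t @[t --> -oo] --> (0 : R) }.

(** The pair is used through its positive part, so the inequalities matter only where [F], resp.
    [G], is nonnegative. A common point where both are nonpositive permits extension by 0 to the
    right, and [tsub_gt0] yields positivity of phi. *)
Record tail_subsolution (R : realType) (c b r H t0 : R)
    (F F1 F2 G G1 G2 : R -> R) : Prop := TailSubsolution {
  tsub_dF : C2_before t0 F F1 F2;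
  tsub_dG : C2_before t0 G G1 G2;
  tsub_end : exists2 t1, t1 < t0 & F t1 <= 0 /\ G t1 <= 0;
  tsub_phi : forall t, t < t0 -> 0 <= F t ->
    0 <= F2 t - c * F1 t + F t * (1 - r - F t + r * G (t - H));
  tsub_psi : forall t, t < t0 -> 0 <= G t ->
    0 <= G2 t - c * G1 t + b * F t * (1 - G t);
  tsub_gt0 : forall T, exists2 t, t < T & 0 < F t }.

(** In the phi-residual of tail plus base (q, psi0), the base alone contributes at most - eta q,
    while the cross terms are at most q (r Psi + k Phi) and are absorbed where r Psi + k Phi < eta.
    In the psi-residual the cross terms are - b (Phi psi0 + q Psi), of the good sign. *)
Lemma supersolution_of_tail (R : realType) (c b r H Q t0 : R)
    (Phi Phi1 Phi2 Psi Psi1 Psi2 : R -> R) :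
  0 < c -> 0 < b -> 0 < r -> 0 <= H -> 0 < Q -> expR (Q - 2) = 2 * Q ->
  let k := r * b * expR (- (c / 2 * H)) / (c ^+ 2 / 4) in
  1 <= k -> r * ln k < Q * (c ^+ 2 / 4 - (1 - r)) ->
  tail_supersolution c b r H t0 Phi Phi1 Phi2 Psi Psi1 Psi2 ->
  exists (fp gp : R -> R) (T1 K : R),
    [/\ continuous fp /\ continuous gp,
      {homo fp : s t / s <= t} /\ {homo gp : s t / s <= t},
      supersolution_phi c r H fp gp /\ supersolution_psi c b fp gp,
      (forall t, 0 <= fp t <= 1) /\ (forall t, 0 <= gp t <= 1) &
      [/\ T1 < t0, forall t, T1 <= t -> fp t = 1 /\ gp t = 1 &
        forall t, t <= T1 -> Phi t <= fp t <= Phi t + K * expR (c / 2 * t) /\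
           Psi t <= gp t <= Psi t + K * expR (c / 2 * t)]].
Proof.
move=> c0 b0 r0 H0 Q0 QE; pose m := c ^+ 2 / 4; rewrite -/m.
move=> k k1 kD [dPhi dPsi Phi01 Psi01 Phi10 Psi10 ePhi ePsi limPhi limPsi].
have mE : m = c ^+ 2 / 4 by [].
have m0 : 0 < m by rewrite divr_gt0 // exprn_gt0.
clearbody m.
have k0 : 0 < k by lra.
pose eta := m - (1 - r) - r * ln k / Q.
have eta0 : 0 < eta.
  by rewrite subr_gt0 ltr_pdivrMr // [ltRHS]mulrC.
have limcross : r * Psi t + k * Phi t @[t --> -oo] --> r * 0 + k * 0.
  by apply: cvgD; apply: cvgM => //; exact: cvg_cst.
have [T2 HT2] : exists T2, forall t, t < T2 -> r * Psi t + k * Phi t < eta.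
  have : \forall t \near -oo, r * Psi t + k * Phi t < eta.
    by apply: (cvgr_lt _ limcross); lra.
  by case=> T2 [_ HT2]; exists T2.
have [T1 [T1t0 T1T2]] : exists T1, T1 < t0 /\ T1 < T2.
  by have [] := leP t0 T2 => ?; [exists (t0 - 1)|exists (T2 - 1)]; split; lra.
(* By e^L >= 1 + L, this makes both base functions at least 1 at [T1]. *)
pose L := Q + Q * b / m.
have Qbm : 0 < Q * b / m by rewrite divr_gt0 // mulr_gt0.
pose y := base_exp c Q T1 L; pose psi0 := base_psi c Q T1 L.
pose q t := m / b * y t.
have y0 t : 0 < y t by exact: base_exp_gt0.
have q0 t : 0 < q t by rewrite mulr_gt0 // divr_gt0.
have bqy t : b * q t = m * y t by rewrite /q; field; rewrite gt_eqF.
have L1 : log_slope c T1 L T1 = L by rewrite /log_slope; ring.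
have qT1 : 1 <= q T1.
  rewrite /q /y /base_exp L1; have := @expR_ge1Dx R L => EL.
  have -> : m / b * (expR L / Q) = expR L / (Q * b / m) by field; rewrite !gt_eqF.
  by rewrite ler_pdivlMr // mul1r; rewrite /L in EL *; lra.
have psi0T1 : 1 <= psi0 T1.
  rewrite /psi0 /base_psi L1 ler_pdivlMr // mul1r le_min.
  have := @expR_ge1Dx R L; have : L <= Num.max 0 L by rewrite le_max lexx orbT.
  by rewrite /L; move=> *; apply/andP; split; lra.
have yhomo : {homo y : s t / s <= t}.
  by move=> s t st; rewrite ler_pM2r ?invr_gt0 // ler_expR log_slope_homo // ltW.
have qhomo : {homo q : s t / s <= t}.
  by move=> s t st; rewrite /q ler_pM2l ?divr_gt0 //; exact: yhomo.
have psi0homo : {homo psi0 : s t / s <= t} by apply: base_psi_homo => //; exact: ltW.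
have psi00 t : 0 <= psi0 t by exact: base_psi_ge0.
(* This identity is the origin of [k]: the delayed exponential branch of psi compared with the base
   of phi. *)
have yshift t : r * y (t - H) = k * q t.
  rewrite /k /q /y /base_exp (_ : log_slope c T1 L (t - H) = log_slope c T1 L t - c / 2 * H); last first.
    by rewrite /log_slope; ring.
  by rewrite expRD; field; rewrite !gt_eqF.
have psi0k t : r * psi0 (t - H) <= k * q t.
  by rewrite -yshift ler_pM2l // base_psi_le_exp.
have psi0eta t : r * psi0 (t - H) <= q t + m - (1 - r) - eta.
  have := base_psi_envelope c T1 L (t - H) Q0 k1; rewrite -/psi0 -/(y (t - H)) => h.
  have : r * psi0 (t - H) <= r * (y (t - H) / k + ln k / Q) by rewrite ler_pM2l.
  rewrite mulrDr mulrA yshift (mulrC k) mulfK ?gt_eqF // /eta; lra.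
have dq t : deriv_at q t (c / 2 * q t).
  by apply: deriv_at_eq (deriv_base_exp c Q T1 L (m / b) t) _; rewrite /q /y; ring.
have dq1 t : deriv_at (fun s => c / 2 * q s) t (m * q t).
  by apply: deriv_at_eq (deriv_atZ (c / 2) (dq t)) _; rewrite mE; field.
pose P t := Phi t + q t; pose S t := Psi t + psi0 t.
(* The sums are frozen at [T1], where they already exceed the cap; so both functions are 1 from
   there on and the tails are never evaluated beyond [t0]. *)
pose fp t := Num.min 1 (P (Num.min t T1)); pose gp t := Num.min 1 (S (Num.min t T1)).
have Phihomo := C2_before_homo dPhi Phi10.
have Psihomo := C2_before_homo dPsi Psi10.
have minT1 t : Num.min t T1 < t0 by rewrite gt_min T1t0 orbT.
have minhomo s t : s <= t -> Num.min s T1 <= Num.min t T1.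
  by move=> st; rewrite le_min !ge_min st lexx orbT.
have PT1 : 1 <= P T1 by have /andP[] := Phi01 _ T1t0; rewrite /P; lra.
have ST1 : 1 <= S T1 by have /andP[] := Psi01 _ T1t0; rewrite /S; lra.
have fpT1 t : T1 <= t -> fp t = 1 by move=> h; rewrite /fp (min_idPr h) (min_idPl PT1).
have gpT1 t : T1 <= t -> gp t = 1 by move=> h; rewrite /gp (min_idPr h) (min_idPl ST1).
have fple t : t <= T1 -> fp t = Num.min 1 (P t) by move=> h; rewrite /fp (min_idPl h).
have gple t : t <= T1 -> gp t = Num.min 1 (S t) by move=> h; rewrite /gp (min_idPl h).
have P0 t : t < t0 -> 0 <= P t.
  by move=> tt0; have /andP[? ?] := Phi01 _ tt0; rewrite addr_ge0 // ltW.
have S0 t : t < t0 -> 0 <= S t.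
  by move=> tt0; have /andP[? ?] := Psi01 _ tt0; rewrite addr_ge0.
have fp1 t : fp t <= 1 by rewrite ge_min lexx.
have gp1 t : gp t <= 1 by rewrite ge_min lexx.
have fp0 t : 0 <= fp t by rewrite le_min ler01 P0.
have gp0 t : 0 <= gp t by rewrite le_min ler01 S0.
have fpP t : t < T1 -> fp t <= P t by move=> /ltW/fple ->; rewrite ge_min lexx orbT.
have gpS t : t < T1 -> gp t <= S t by move=> /ltW/gple ->; rewrite ge_min lexx orbT.
have fpcase t : fp t = 1 \/ t < T1 /\ fp t = P t.
  have [h|h] := leP T1 t; first by left; exact: fpT1.
  rewrite fple ?ltW //; have [] := leP 1 (P t) => h2; first by left.
  by right.
have gpcase t : gp t = 1 \/ t < T1 /\ gp t = S t.
  have [h|h] := leP T1 t; first by left; exact: gpT1.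
  rewrite gple ?ltW //; have [] := leP 1 (S t) => h2; first by left.
  by right.
exists fp, gp, T1, (m / b / Q * expR (L - c / 2 * T1) + expR (L - c / 2 * T1) / Q); split.
- split.
  + move=> t; apply: (@continuous_min R R (fun=> 1) (fun t => P (Num.min t T1))); first exact: cvg_cst.
    apply: continuous_stopped => s sT1; apply: cvgD.
      by apply: deriv_at_cont (dPhi s _).1; apply: le_lt_trans T1t0.
    exact: deriv_at_cont (dq s).
  + move=> t; apply: (@continuous_min R R (fun=> 1) (fun t => S (Num.min t T1))); first exact: cvg_cst.
    apply: continuous_stopped => s sT1; apply: cvgD.
      by apply: deriv_at_cont (dPsi s _).1; apply: le_lt_trans T1t0.
    exact: base_psi_cont.
- split=> s t st.
  + rewrite le_min !ge_min lexx /= lerD ?orbT //.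
      by apply: Phihomo => //; exact: minhomo.
    by apply: qhomo; exact: minhomo.
  + rewrite le_min !ge_min lexx /= lerD ?orbT //.
      by apply: Psihomo => //; exact: minhomo.
    by apply: psi0homo; exact: minhomo.
- split=> t.
  + case: (fpcase t) => [f1|[tT1 fP]].
      exists 0, 0; split; first by apply: touches_above_cst => s; rewrite f1.
      rewrite f1; have := gp1 (t - H); have := mulr_ge0 (ltW r0) (gp0 (t - H)).
      by rewrite -(ler_pM2l r0); lra.
    have tt0 : t < t0 by lra.
    exists (Phi1 t + c / 2 * q t), (Phi2 t + m * q t); split.
      exists P, (fun t => Phi1 t + c / 2 * q t); split=> //.
      - by apply: filterS (near_lt tT1) => s; exact: fpP.
      - by apply: filterS (near_lt tt0) => s st0; apply: deriv_atD => //; exact: (dPhi _ st0).1.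
      - by apply: deriv_atD => //; exact: (dPhi _ tt0).2.
    have gH : gp (t - H) <= Psi (t - H) + psi0 (t - H) by apply: gpS; lra.
    have grH : r * gp (t - H) <= r * Psi (t - H) + r * psi0 (t - H) by rewrite -mulrDr ler_pM2l.
    have PP : P t * (r * gp (t - H)) <= P t * (r * Psi (t - H) + r * psi0 (t - H)).
      by rewrite ler_wpM2l // P0.
    have /andP[Phit0 _] := Phi01 _ tt0.
    have E1 : Phi t * (r * psi0 (t - H)) <= Phi t * (k * q t) by rewrite ler_wpM2l.
    have E2 : q t * (r * psi0 (t - H)) <= q t * (q t + m - (1 - r) - eta) by rewrite ler_pM2l.
    have E3 : q t * (r * Psi (t - H) + k * Phi t) <= q t * eta.
      rewrite ler_pM2l //; apply/ltW/(le_lt_trans _ (HT2 t (lt_trans tT1 T1T2))).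
      by rewrite lerD2r ler_pM2l //; apply: Psihomo => //; rewrite gerBl.
    have E4 : 0 <= Phi t * q t by rewrite mulr_ge0 // ltW.
    have E5 : c * (c / 2 * q t) = 2 * (m * q t) by rewrite mE; field.
    have := ePhi _ tt0; rewrite fP; move: PP E1 E2 E3 E4 E5; rewrite /P.
    clear; lra.
  + case: (gpcase t) => [g1|[tT1 gS]].
      exists 0, 0; split; first by apply: touches_above_cst => s; rewrite g1.
      by rewrite g1; lra.
    have tt0 : t < t0 by lra.
    have [p1 [p2 [hp1 hp2]]] := base_psi_super T1 L t c0 Q0 QE.
    exists (Psi1 t + p1), (Psi2 t + p2); split.
      apply: (touches_aboveD _ _ hp1 gS).
      - by apply: filterS (near_lt tt0) => s st0; exact: (dPsi _ st0).1.
      - exact: (dPsi _ tt0).2.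
      - by apply: filterS (near_lt tT1) => s; exact: gpS.
    have /andP[Phit0 _] := Phi01 _ tt0; have /andP[Psit0 _] := Psi01 _ tt0.
    have E1 : b * fp t * (1 - gp t) <= b * P t * (1 - gp t).
      by rewrite ler_wpM2r ?subr_ge0 // ler_pM2l // fpP.
    have bt0 := ltW b0; have qt0 := ltW (q0 t); 
    have E2 : 0 <= b * Phi t * psi0 t by exact: (mulr_ge0 (mulr_ge0 bt0 Phit0) (psi00 t)).
    have E3 : 0 <= b * q t * Psi t by exact: (mulr_ge0 (mulr_ge0 bt0 qt0) Psit0).
    have := ePsi _ tt0; rewrite -mE -/psi0 -/(y t) -bqy in hp2.
    move: E1 E2 E3 hp2; rewrite gS /P /S.
    clear; lra.
- by split=> t; rewrite ?fp0 ?fp1 ?gp0 ?gp1.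
- split=> //.
    by move=> t h; rewrite fpT1 // gpT1.
  move=> t tT1.
  have tt0 : t < t0 by lra.
  have /andP[? ?] := Phi01 _ tt0; have /andP[? ?] := Psi01 _ tt0.
  have yE : y t = expR (L - c / 2 * T1) / Q * expR (c / 2 * t).
    by rewrite /y /base_exp mulrAC -expRD; congr (expR _ / _); rewrite /log_slope; ring.
  have psi0y : psi0 t <= y t by exact: base_psi_le_exp.
  have qE : q t = m / b / Q * expR (L - c / 2 * T1) * expR (c / 2 * t) by rewrite /q yE; ring.
  rewrite mulrDl -qE -yE fple // gple // !le_min !ge_min.
  have h1 := ltW (q0 t); have h2 := ltW (y0 t); have h3 := psi00 t.
  split; apply/andP; split.
  - by apply/andP; split=> //; rewrite /P lerDl.
  - by apply/orP; right; rewrite /P lerD2l lerDl.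
  - by apply/andP; split=> //; rewrite /S lerDl.
  - by apply/orP; right; rewrite /S lerD2l; apply: le_trans psi0y _; rewrite lerDr.
Qed.

(** The zero function is a subsolution, and by cooperativity replacing one component by its positive
    part only increases the reaction term of the other. *)
Lemma subsolution_of_tail (R : realType) (c b r H t0 : R) (F F1 F2 G G1 G2 : R -> R) :
  0 <= b -> 0 <= r -> 0 <= H -> (forall t, t < t0 -> G t <= 1) ->
  tail_subsolution c b r H t0 F F1 F2 G G1 G2 ->
  exists (fm gm : R -> R) (t1 : R),
    [/\ continuous fm /\ continuous gm,
      subsolution_phi c r H fm gm /\ subsolution_psi c b fm gm,
      t1 < t0,
      forall t, t1 <= t -> fm t = 0 /\ gm t = 0 &
      forall t, t <= t1 -> fm t = Num.max 0 (F t) /\ gm t = Num.max 0 (G t)].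
Proof.
move=> b0 r0 H0 G1' [dF dG [t1 t1t0 [Ft1 Gt1]] eF eG _].
pose fm t := Num.max 0 (F (Num.min t t1)); pose gm t := Num.max 0 (G (Num.min t t1)).
have ge t : t1 <= t -> fm t = 0 /\ gm t = 0.
  by move=> h; rewrite /fm /gm (min_idPr h) !(max_idPl _).
have le t : t <= t1 -> fm t = Num.max 0 (F t) /\ gm t = Num.max 0 (G t).
  by move=> h; rewrite /fm /gm (min_idPl h).
have fm0 t : 0 <= fm t by rewrite le_max lexx.
have gm0 t : 0 <= gm t by rewrite le_max lexx.
have case_ (f f1 : R -> R) t : (forall s, t1 <= s -> f s = 0) ->
    (forall s, s <= t1 -> f s = Num.max 0 (f1 s)) ->
    f t = 0 \/ [/\ t < t1, f t = f1 t & 0 < f1 t].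
  move=> h1 h2; have [h|h] := leP t1 t; first by left; exact: h1.
  rewrite (h2 _ (ltW h)); have [] := leP (f1 t) 0 => h3; first by left.
  by right.
have opp0 (f : R -> R) t : (forall s, 0 <= f s) -> f t = 0 -> touches_above (fun s => - f s) t 0 0.
  by move=> f0 ft; apply: touches_above_cst => s; rewrite ft oppr0 oppr_le0.
have oppN (f S S1 S2 : R -> R) t : C2_before t0 S S1 S2 -> t < t1 ->
    (forall s, s <= t1 -> f s = Num.max 0 (S s)) -> f t = S t ->
    touches_above (fun s => - f s) t (- S1 t) (- S2 t).
  move=> dF' tt1 h ft.
  have dN : C2_before t0 (fun s => - S s) (fun s => - S1 s) (fun s => - S2 s).
    by move=> s /dF'[d1 d2]; split; exact: deriv_atN.
  apply: (touches_above_C2 dN); first by lra.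
    by rewrite ft.
  apply: filterS (near_lt tt1) => s st1.
  by rewrite lerN2 (h _ (ltW st1)) le_max lexx orbT.
exists fm, gm, t1; split=> //.
- split=> t.
    apply: (@continuous_max R R (fun=> 0) (fun t => F (Num.min t t1))); first exact: cvg_cst.
    by apply: continuous_stopped => s st1; apply: deriv_at_cont (dF s _).1; lra.
  apply: (@continuous_max R R (fun=> 0) (fun t => G (Num.min t t1))); first exact: cvg_cst.
  by apply: continuous_stopped => s st1; apply: deriv_at_cont (dG s _).1; lra.
- split=> t.
    have [f0|[tt1 fF F0]] := case_ fm F t (fun s h => (ge s h).1) (fun s h => (le s h).1).
      by exists 0, 0; split; [exact: opp0|rewrite f0; lra].
    exists (- F1 t), (- F2 t); split; first exact: (oppN _ _ _ _ _ dF tt1 (fun s h => (le s h).1)).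
    have tt0 : t < t0 by lra.
    have := eF t tt0 (ltW F0); rewrite fF.
    have GH : G (t - H) <= gm (t - H) by rewrite (le _ _).2 ?le_max ?lexx ?orbT //; lra.
    have : F t * (r * G (t - H)) <= F t * (r * gm (t - H)) by rewrite ler_pM2l // ler_wpM2l.
    lra.
  have [g0|[tt1 gG G0]] := case_ gm G t (fun s h => (ge s h).2) (fun s h => (le s h).2).
    exists 0, 0; split; first exact: opp0.
    by rewrite g0; have := mulr_ge0 b0 (fm0 t); lra.
  exists (- G1 t), (- G2 t); split; first exact: (oppN _ _ _ _ _ dG tt1 (fun s h => (le s h).2)).
  have tt0 : t < t0 by lra.
  have := eG t tt0 (ltW G0); rewrite gG.
  have Ff : F t <= fm t by rewrite (le _ _).1 ?le_max ?lexx ?orbT //; lra.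
  have : b * F t * (1 - G t) <= b * fm t * (1 - G t).
    by rewrite ler_wpM2r ?subr_ge0 ?G1' // ler_wpM2l.
  lra.
Qed.

Lemma squeeze_ninfty (R : realType) (f g : R -> R) (T : R) :
  (forall t, t <= T -> 0 <= f t <= g t) -> g t @[t --> -oo] --> (0 : R) ->
  f t @[t --> -oo] --> (0 : R).
Proof.
move=> fg g0; apply: (squeeze_cvgr (f := fun=> 0) (h := g)) => //; last exact: cvg_cst.
by exists T; split; [exact: num_real|move=> t /ltW /fg].
Qed.

Lemma cvg_expR_ninfty (R : realType) (k : R) : 0 < k ->
  expR (k * t) @[t --> -oo] --> (0 : R).
Proof.
move=> k0; apply/cvgrPdist_le => e e0.
exists (ln e / k); split; first exact: num_real.
move=> t; rewrite ltr_pdivlMr // => h.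
by rewrite sub0r normrN ger0_norm ?expR_ge0 // -[leRHS]lnK // ler_expR mulrC ltW.
Qed.

(** The base survives in the final bounds only as an error of order e^(c t / 2), so asymptotics
    shared by the two tails pass to the wave up to that order. *)
Lemma wavefront_of_tails (R : realType) (n : nat) (c b r h Q t0 : R)
    (Phi Phi1 Phi2 Psi Psi1 Psi2 F F1 F2 G G1 G2 : R -> R) :
  0 < c -> 0 < b -> 0 < r <= 1 -> 0 <= h -> 0 < Q -> expR (Q - 2) = 2 * Q ->
  let k := r * b * expR (- (c / 2 * (c * h))) / (c ^+ 2 / 4) in
  1 <= k -> r * ln k < Q * (c ^+ 2 / 4 - (1 - r)) ->
  tail_supersolution c b r (c * h) t0 Phi Phi1 Phi2 Psi Psi1 Psi2 ->
  tail_subsolution c b r (c * h) t0 F F1 F2 G G1 G2 ->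
  (forall t, t < t0 -> F t <= Phi t /\ G t <= Psi t) ->
  exists phi psi : R -> R, exists T K : R,
    positive_monotone_wavefront n r b h c phi (fun t => 1 - psi t) /\
    forall t, t <= T -> F t <= phi t <= Phi t + K * expR (c / 2 * t) /\
      G t <= psi t <= Psi t + K * expR (c / 2 * t).
Proof.
move=> c0 b0 /andP[r0 r1] h0 Q0 QE k k1 kD sup sub FPhi.
have H0 : 0 <= c * h by rewrite mulr_ge0 // ltW.
have [fp [gp [T1 [K [[cfp cgp] [hfp hgp] [efp egp] [fp01 gp01] [T1t0 ge1 le1]]]]]] :=
  supersolution_of_tail c0 b0 r0 H0 Q0 QE k1 kD sup.
have [_ _ Phi01 Psi01 _ _ _ _ limPhi limPsi] := sup.
have G1' t : t < t0 -> G t <= 1.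
  by move=> tt0; have /andP[_] := Psi01 _ tt0; apply: le_trans (FPhi _ tt0).2.
have F1' t : t < t0 -> F t <= 1.
  by move=> tt0; have /andP[_] := Phi01 _ tt0; apply: le_trans (FPhi _ tt0).1.
have [fm [gm [t1 [[cfm cgm] [efm egm] t1t0 ge0 le0]]]] :=
  subsolution_of_tail (ltW b0) (ltW r0) H0 G1' sub.
have fm0 t : 0 <= fm t.
  by have [/le0[-> _]|/ltW/ge0[-> _]//] := leP t t1; rewrite le_max lexx.
have gm0 t : 0 <= gm t.
  by have [/le0[_ ->]|/ltW/ge0[_ ->]//] := leP t t1; rewrite le_max lexx.
have fmp t : fm t <= fp t.
  have /andP[f0 f1] := fp01 t.
  have [tt1|/ltW/ge0[-> _]//] := leP t t1.
  have tt0 : t < t0 by lra.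
  have [-> _] := le0 _ tt1; rewrite ge_max f0 /=.
  have [/le1[/andP[h1 _] _]|/ltW/ge1[-> _]] := leP t T1; last exact: F1'.
  exact: le_trans (FPhi _ tt0).1 h1.
have gmp t : gm t <= gp t.
  have /andP[f0 f1] := gp01 t.
  have [tt1|/ltW/ge0[_ ->]//] := leP t t1.
  have tt0 : t < t0 by lra.
  have [_ ->] := le0 _ tt1; rewrite ge_max f0 /=.
  have [/le1[_ /andP[h1 _]]|/ltW/ge1[_ ->]] := leP t T1; last exact: G1'.
  exact: le_trans (FPhi _ tt0).2 h1.
have fp1 t : fp t <= 1 by have /andP[] := fp01 t.
have gp1 t : gp t <= 1 by have /andP[] := gp01 t.
have r01 : 0 <= r <= 1 by rewrite (ltW r0).
have [M [phi [phi1 [psi [psi1 [bphi bpsi [hphi hpsi] M1 [dphi dphi1 dpsi dpsi1]]]]]]] :=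
  monotone_iteration (ltW c0) (ltW b0) r01 H0 cfp cgp cfm cgm fm0 fmp fp1 gm0 gmp gp1 hfp hgp
    efp egp efm egm.
have phi01 t : 0 <= phi t <= 1.
  have /andP[h1 h2] := bphi t.
  by rewrite (le_trans (fm0 t) h1) (le_trans h2).
have psi01 t : 0 <= psi t <= 1.
  have /andP[h1 h2] := bpsi t.
  by rewrite (le_trans (gm0 t) h1) (le_trans h2).
have bnd t : t <= Num.min T1 t1 -> F t <= phi t <= Phi t + K * expR (c / 2 * t) /\
      G t <= psi t <= Psi t + K * expR (c / 2 * t).
  rewrite le_min => /andP[/le1[/andP[_ h1] /andP[_ h2]] /le0[h3 h4]].
  have /andP[h5 h6] := bphi t; have /andP[h7 h8] := bpsi t.
  rewrite (le_trans h6 h1) (le_trans h8 h2) !andbT.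
  by split; [apply: le_trans h5; rewrite h3|apply: le_trans h7; rewrite h4]; rewrite le_max lexx orbT.
have lim0 (f g : R -> R) : g t @[t --> -oo] --> (0 : R) -> (forall t, 0 <= f t) ->
    (forall t, t <= Num.min T1 t1 -> f t <= g t + K * expR (c / 2 * t)) ->
    f t @[t --> -oo] --> (0 : R).
  move=> g0 f0 fg.
  apply: (@squeeze_ninfty R f (fun t => g t + K * expR (c / 2 * t)) (Num.min T1 t1)).
    by move=> t tT; rewrite f0 fg.
  rewrite -[X in _ --> X](_ : 0 + K * 0 = 0); last by rewrite mulr0 addr0.
  apply: cvgD => //; apply: cvgM; first exact: cvg_cst.
  by apply: cvg_expR_ninfty; lra.
have phi0 : phi t @[t --> -oo] --> (0 : R).
  apply: lim0 limPhi _ _ => t; first by have /andP[] := phi01 t.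
  by move=> /bnd[/andP[]].
have psi0 : psi t @[t --> -oo] --> (0 : R).
  apply: lim0 limPsi _ _ => t; first by have /andP[] := psi01 t.
  by move=> /bnd[_ /andP[]].
have phipos t : 0 < phi t.
  have [s] := tsub_gt0 sub (Num.min t (Num.min T1 t1)).
  rewrite lt_min => /andP[st /ltW/bnd[/andP[Fs _] _]] F0.
  by apply: lt_le_trans F0 (le_trans Fs _); apply: hphi; exact: ltW.
(* [psi_lt1] propagates strictness to the right from one point, which the limit at -oo supplies. *)
have [s psis] : exists s, psi s < 1.
  have : \forall t \near -oo, psi t < 1 by apply: (cvgr_lt _ psi0); exact: ltr01.
  by case=> M' [_ h1]; exists (M' - 1); apply: h1; lra.
have psilt1 := psi_lt1 (ltW c0) b0 phi01 psi01 hpsi psis (fun t => (M1 t).2) dpsi dpsi1.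
have [phip psip] := profile_limits (ltW c0) b0 r0 phi01 psi01 hphi hpsi (phipos 0) M1
  dphi dphi1 dpsi dpsi1.
exists phi, psi, (Num.min T1 t1), K; split; last exact: bnd.
exact: profile_wavefront dphi dphi1 dpsi dpsi1 _ _ _ _.
Qed.

(** * What the conditions on the speed say about the base *)

(** Exponentiating the equation of [omega_star] = 2 Q gives e^(Q - 2) = 2 Q, and r times [fcrit]
    equals Q (c^2 / 4 - (1 - r)) - r ln k. For k >= 1, put m = c^2 / 4 and let B be the value of b'
    at [c_sharp]: c < c_sharp gives m (1 + B) < B, and 1 - r <= m turns this into m < r B; lowering
    the speed from c_sharp to c only increases b'. *)
Lemma speed_conditions (R : realType) (r b h c : R) :
  0 < b -> 0 <= h -> 0 < r -> r <= 1 -> 2 * Num.sqrt (1 - r) <= c ->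
  c < c_sharp r b h -> 0 < fcrit (c ^+ 2) r b h ->
  let Q := omega_star / 2 in
  let k := r * b * expR (- (c / 2 * (c * h))) / (c ^+ 2 / 4) in
  [/\ 0 < c, 0 < Q, expR (Q - 2) = 2 * Q, 1 <= k & r * ln k < Q * (c ^+ 2 / 4 - (1 - r))].
Proof.
move=> b0 h0 r0 r1 hc hcs hf Q k.
have [w0 wE _] := omega_star_spec R.
have Q0 : 0 < Q by rewrite divr_gt0.
have c0 : 0 < c.
  rewrite lt_neqAle (le_trans _ hc) ?mulr_ge0 ?sqrtr_ge0 // andbT eq_sym.
  (* For c = 0 the convention ln 0 = 0 makes [fcrit] nonpositive. *)
  apply/eqP => cE; move: hf; rewrite /fcrit cE expr0n /= !mul0r ln0 // addr0 sub0r oppr_gt0.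
  by rewrite ltNge mulr_ge0 ?(ltW Q0) // divr_ge0 ?(ltW r0) // subr_ge0.
have QE : expR (Q - 2) = 2 * Q.
  have -> : 2 * Q = omega_star by rewrite /Q; field.
  rewrite -[RHS]lnK ?posrE //; congr expR; rewrite /Q; lra.
have c20 : 0 < c ^+ 2 by rewrite exprn_gt0.
have k0 : 0 < k by rewrite !(divr_gt0, mulr_gt0) ?expR_gt0.
have lnk : ln k = - (c ^+ 2 * h / 2) - ln (c ^+ 2 / (4 * b * r)).
  have -> : k = expR (- (c ^+ 2 * h / 2)) / (c ^+ 2 / (4 * b * r)).
    rewrite /k (_ : c / 2 * (c * h) = c ^+ 2 * h / 2); last by ring.
    by field; rewrite !gt_eqF.
  by rewrite ln_div ?posrE ?expR_gt0 ?expRK // divr_gt0 // !mulr_gt0.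
have mr : 1 - r <= c ^+ 2 / 4.
  have := sqr_sqrtr (_ : 0 <= 1 - r); rewrite subr_ge0 => /(_ r1) sE.
  have : (2 * Num.sqrt (1 - r)) ^+ 2 <= c ^+ 2.
    by rewrite lerXn2r // ?nnegrE ?mulr_ge0 ?sqrtr_ge0 // ltW.
  rewrite exprMn sE; lra.
split=> //.
- have [[cs0 csE] _] := c_sharp_spec r0 r1 b0 h0.
  move: csE; set cs := c_sharp r b h in hcs cs0 *; set B := b * expR _ => csE.
  have B0 : 0 < B by rewrite mulr_gt0 // expR_gt0.
  (* Were the maximum attained by the first entry, c_sharp would equal 2 sqrt(1 - r) <= c. *)
  have csE2 : cs = 2 * (Num.sqrt B / Num.sqrt (1 + B)).
    move: csE; case: (leP (Num.sqrt (1 - r)) (Num.sqrt B / Num.sqrt (1 + B))) => // _ csE.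
    by move: hc; rewrite -csE leNgt hcs.
  have cs2 : cs ^+ 2 / 4 * (1 + B) = B.
    rewrite csE2 exprMn expr_div_n !sqr_sqrtr; [|lra|lra].
    by field; lra.
  have c2 : c ^+ 2 < cs ^+ 2 by rewrite ltr_pXn2r // ?nnegrE ltW.
  have Bc : B <= b * expR (- (c / 2 * (c * h))).
    rewrite /B ler_pM2l // ler_expR lerN2 (_ : c / 2 * (c * h) = c ^+ 2 * h / 2); last by ring.
    by rewrite !ler_wpM2r // ltW.
  have mB : c ^+ 2 / 4 * (1 + B) < B.
    by rewrite -[ltRHS]cs2 ltr_pM2r; lra.
  rewrite /k ler_pdivlMr ?divr_gt0 // mul1r -mulrA.
  have h1 : r * B <= r * (b * expR (- (c / 2 * (c * h)))) by rewrite ler_pM2l.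
  have h2 : (1 - c ^+ 2 / 4) * B <= r * B by rewrite ler_pM2r //; lra.
  by move: h1 h2 mB; clear; lra.
- rewrite lnk; move: hf; rewrite /fcrit -(pmulr_rgt0 _ r0).
  have -> : r * (c ^+ 2 * (omega_star / (8 * r) + h / 2) + ln (c ^+ 2 / (4 * b * r)) -
      omega_star / 2 * ((1 - r) / r)) =
    c ^+ 2 * omega_star / 8 + r * (c ^+ 2 * h / 2) + r * ln (c ^+ 2 / (4 * b * r))
      - omega_star / 2 * (1 - r) by field; rewrite gt_eqF.
  rewrite /Q; lra.
Qed.

Lemma eqaddO_ninfty (R : realType) (f g e : R -> R) (C T : R) :
  (forall t, t <= T -> `|f t - g t| <= C * `|e t|) -> f = g +O_ (at_ninfty R) e.
Proof.
move=> H; apply/eqaddOP; near=> k; exists T; split; first exact: num_real.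
move=> t /ltW tT; apply: le_trans (H t tT) _; apply: ler_wpM2r => //.
Unshelve. all: by end_near. Qed.

Lemma deriv_exp_lin (R : realType) (k t : R) : deriv_at (fun s => expR (k * s)) t (k * expR (k * t)).
Proof. by apply: deriv_at_eq (deriv_at_expR (deriv_atZ k (deriv_at_id t))) _; ring. Qed.

Lemma expR_lin_le (R : realType) (k e : R) : 0 < k -> 0 < e ->
  exists T, forall t, t <= T -> expR (k * t) <= e.
Proof.
move=> k0 e0; exists (ln e / k) => t; rewrite ler_pdivlMr // => h.
by rewrite -[leRHS]lnK // ler_expR mulrC.
Qed.

Lemma deriv_exp_pair (R : realType) (t0 l s A B : R) :
  C2_before t0 (fun t => A * expR (l * t) + B * expR (s * t))
    (fun t => A * (l * expR (l * t)) + B * (s * expR (s * t)))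
    (fun t => A * (l * (l * expR (l * t))) + B * (s * (s * expR (s * t)))).
Proof.
move=> t _; split; apply: deriv_atD; do ?apply: deriv_atZ; exact: deriv_exp_lin.
Qed.

(** * The case r < 1 *)

Lemma wavefront_noncritical (R : realType) (n : nat) (c b r h Q : R) :
  0 < c -> 0 < b -> 0 < r -> r < 1 -> 0 <= h -> 0 < Q -> expR (Q - 2) = 2 * Q ->
  let k := r * b * expR (- (c / 2 * (c * h))) / (c ^+ 2 / 4) in
  1 <= k -> r * ln k < Q * (c ^+ 2 / 4 - (1 - r)) ->
  let lambda := (c - Num.sqrt (c ^+ 2 - 4 * (1 - r))) / 2 in
  exists phi psi : R -> R, exists eps T C : R,
    [/\ 0 < eps, positive_monotone_wavefront n r b h c phi (fun t => 1 - psi t) &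
    forall t, t <= T ->
      `|phi t - expR (lambda * t)| <= C * expR ((lambda + eps) * t) /\
      `|psi t - b * expR (lambda * t) / (1 - r)| <= C * expR ((lambda + eps) * t)].
Proof.
move=> c0 b0 r0 r1 h0 Q0 QE k k1 kD lambda.
(* Since ln k >= 0, the strict inequality separates the two characteristic roots lambda and lambda +
   s. *)
have D0 : 0 < c ^+ 2 / 4 - (1 - r).
  by rewrite -(pmulr_rgt0 _ Q0); apply: le_lt_trans kD; rewrite mulr_ge0 ?ln_ge0 // ltW.
pose s := Num.sqrt (c ^+ 2 - 4 * (1 - r)).
have s2 : s ^+ 2 = c ^+ 2 - 4 * (1 - r) by rewrite sqr_sqrtr; lra.
have s0 : 0 < s by rewrite sqrtr_gt0; lra.
have sc : s < c by rewrite -(@ltr_pXn2r R 2) ?nnegrE ?ltW // s2; lra.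
have lE : lambda = (c - s) / 2 by [].
clearbody lambda.
have l0 : 0 < lambda by lra.
have chl : lambda ^+ 2 - c * lambda + (1 - r) = 0 by rewrite lE; move: s2; clear; lra.
(* lambda + eps <= 2 lambda absorbs the quadratic terms, lambda + eps <= c / 2 the base. *)
pose eps := Num.min lambda (c / 2 - lambda).
have [eps0 eps1 eps2] : [/\ 0 < eps, eps <= lambda & lambda + eps <= c / 2].
  by rewrite /eps; have [] := leP lambda (c / 2 - lambda) => ?; split; lra.
clearbody eps.
pose sg := lambda + eps.
(* Minus the characteristic polynomial at [sg], positive because [sg] lies strictly between its
   roots; this is the gain from the perturbation e^(sg t). *)
pose chi := - (sg ^+ 2 - c * sg + (1 - r)).
have chiE : chi = eps * (s - eps) by rewrite /chi /sg lE; move: s2; clear; lra.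
have chi0 : 0 < chi by rewrite chiE mulr_gt0 //; lra.
have sgE : sg ^+ 2 - c * sg = - chi - (1 - r) by rewrite /chi; ring.
have lamE : lambda ^+ 2 - c * lambda = - (1 - r) by move: chl; clear; lra.
have sg0 : 0 < sg by rewrite /sg; lra.
have sg2 : sg <= 2 * lambda by rewrite /sg; lra.
(* The ratio psi / phi on the mode e^(lambda t), from K (lambda^2 - c lambda) + b = 0. *)
pose K := b / (1 - r).
have K0 : 0 < K by rewrite divr_gt0 // subr_gt0.
have Kb : K * (1 - r) = b by rewrite /K divfK // gt_eqF // subr_gt0.
pose e1 t := expR (lambda * t); pose e2 t := expR (sg * t); pose e3 t := expR (eps * t).
have e10 t : 0 < e1 t by exact: expR_gt0.
have e20 t : 0 < e2 t by exact: expR_gt0.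
have e30 t : 0 < e3 t by exact: expR_gt0.
have e213 t : e2 t = e1 t * e3 t by rewrite /e2 /e1 /e3 -expRD /sg mulrDl.
have e12 t : t <= 0 -> e1 t ^+ 2 <= e2 t.
  by move=> t0; rewrite /e1 /e2 -expRM_natl ler_expR mulrA ler_wnM2r.
have ehomo kk (x y : R) : 0 < kk -> x <= y -> expR (kk * x) <= expR (kk * y).
  by move=> kk0 xy; rewrite ler_expR ler_pM2l.
clearbody chi.
have KE : K = b / (1 - r) by [].
clearbody K.
(* With Phi <= 2 e1 and Psi <= 2 K e1, the coupling term is at most 4 r K e2 = A chi e2. *)
pose A := 4 * r * K / chi.
have A0 : 0 < A by rewrite divr_gt0 // !mulr_gt0.
have Achi : A * chi = 4 * r * K by rewrite /A divfK // gt_eqF.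
clearbody A.
have r01 : 0 < r <= 1 by rewrite r0 ltW.
have WT := fun t0 f0 f1 f2 f3 f4 f5 f6 f7 f8 f9 fa fb => @wavefront_of_tails R n c b r h Q
  t0 f0 f1 f2 f3 f4 f5 f6 f7 f8 f9 fa fb c0 b0 r01 h0 Q0 QE k1 kD.
clear QE k1 kD chl chiE lE s0 sc s2 D0.
have AV : 0 < A^-1 by rewrite invr_gt0.
have [Ta HTa] := expR_lin_le eps0 AV.
(* The first bound on e1 keeps Phi and Psi below 1; the second lets chi control the delayed term of
   the subsolution. *)
have q0 : 0 < Num.min (2 + 2 * K)^-1 (chi / (2 * r * K)).
  by rewrite lt_min invr_gt0 divr_gt0 ?mulr_gt0 //; lra.
have [Tb HTb] := expR_lin_le l0 q0.
have [t0 [t00 t0a t0b]] : exists t0, [/\ t0 <= 0, t0 <= Ta & t0 <= Tb].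
  by exists (Num.min 0 (Num.min Ta Tb)); rewrite !ge_min !lexx !orbT.
have Ae3 t : t < t0 -> A * e3 t <= 1.
  by move=> tt0; rewrite -ler_pdivlMl // mulr1; apply: HTa; lra.
have e1s t : t < t0 -> e1 t * (2 + 2 * K) <= 1 /\ 2 * r * K * e1 t <= chi.
  move=> tt0; have := HTb t ltac:(lra); rewrite le_min => /andP[h1 h2]; split.
    by rewrite -ler_pdivlMr ?mul1r //; lra.
  by rewrite mulrC -ler_pdivlMr // !mulr_gt0.
(* In the phi-inequality half of A' chi pays for phi^2 and half for the negative part of the delayed
   psi; the second entry pays for b phi psi; the third makes the subsolution nonpositive at t0 -
   1. *)
pose A' := Num.max (2 / chi) (Num.max (b / chi) (expR (- eps * (t0 - 1)))).
have [A'1 A'2 A'3] : [/\ 2 <= A' * chi, b <= A' * chi & 1 <= A' * e3 (t0 - 1)].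
  split; first by rewrite -ler_pdivrMr // le_max lexx.
    by rewrite -ler_pdivrMr // !le_max lexx orbT.
  have E1 : expR (- eps * (t0 - 1)) * e3 (t0 - 1) = 1.
    by rewrite -expRD (_ : - eps * (t0 - 1) + eps * (t0 - 1) = 0) ?expR0 //; ring.
  by rewrite -[leLHS]E1 ler_pM2r // !le_max lexx !orbT.
have A'0 : 0 < A' by rewrite lt_max divr_gt0.
clearbody A'.
have H0 : 0 <= c * h by rewrite mulr_ge0 // ltW.
have lamlim : expR (lambda * t) @[t --> -oo] --> (0 : R) by exact: cvg_expR_ninfty.
have sglim : expR (sg * t) @[t --> -oo] --> (0 : R) by exact: cvg_expR_ninfty.
have lim0 (B D : R) : B * expR (lambda * t) + D * expR (sg * t) @[t --> -oo] --> (0 : R).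
  rewrite -[X in _ --> X](_ : B * 0 + D * 0 = 0); last by rewrite !mulr0 addr0.
  by apply: cvgD; (apply: cvgM; first exact: cvg_cst).
have sup : tail_supersolution c b r (c * h) t0
    (fun t => 1 * expR (lambda * t) + A * expR (sg * t))
    (fun t => 1 * (lambda * expR (lambda * t)) + A * (sg * expR (sg * t)))
    (fun t => 1 * (lambda * (lambda * expR (lambda * t))) + A * (sg * (sg * expR (sg * t))))
    (fun t => K * expR (lambda * t) + K * A * expR (sg * t))
    (fun t => K * (lambda * expR (lambda * t)) + K * A * (sg * expR (sg * t)))
    (fun t => K * (lambda * (lambda * expR (lambda * t))) + K * A * (sg * (sg * expR (sg * t)))).
  have bnd t : t < t0 -> [/\ 0 < e1 t, 0 < e2 t, A * e2 t <= e1 t, e1 t ^+ 2 <= e2 t &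
      e1 t * (2 + 2 * K) <= 1].
    move=> tt0; split=> //; last exact: (e1s _ tt0).1.
      by rewrite e213 mulrCA ger_pMr // Ae3.
    by apply: e12; lra.
  split; try exact: deriv_exp_pair.
  - move=> t /bnd; rewrite -/(e1 t) -/(e2 t) => -[h1 h2 h3 h4 h5].
    have : 0 < A * e2 t by rewrite mulr_gt0.
    have : 0 < e1 t * K by rewrite mulr_gt0.
    by move: h1 h3 h5; clear; move=> *; apply/andP; split; lra.
  - move=> t /bnd; rewrite -/(e1 t) -/(e2 t) => -[h1 h2 h3 h4 h5].
    have : 0 < K * A * e2 t by rewrite !mulr_gt0.
    have : 0 < K * e1 t by rewrite mulr_gt0.
    have : K * (A * e2 t) <= K * e1 t by rewrite ler_pM2l.
    by move: h1 h5; clear; move=> *; apply/andP; split; lra.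
  - by move=> t _; rewrite addr_ge0 // ?mul1r !mulr_ge0 ?expR_ge0 ?ltW.
  - by move=> t _; rewrite addr_ge0 // !mulr_ge0 ?expR_ge0 ?ltW.
  - move=> t tt0; have [h1 h2 h3 h4 h5] := bnd _ tt0; rewrite -/(e1 t) -/(e2 t).
    have hH : K * expR (lambda * (t - c * h)) + K * A * expR (sg * (t - c * h)) <= 2 * K * e1 t.
      have : expR (lambda * (t - c * h)) <= e1 t by apply: ehomo => //; lra.
      have : expR (sg * (t - c * h)) <= e2 t by apply: ehomo => //; lra.
      rewrite -(ler_pM2l A0) => i1 i2.
      have : K * (expR (lambda * (t - c * h)) + A * expR (sg * (t - c * h))) <= K * (2 * e1 t).
        by rewrite ler_pM2l //; lra.
      lra.
    set X := K * expR (lambda * (t - c * h)) + _ in hH *.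
    have P0 : 0 < 1 * e1 t + A * e2 t by rewrite mul1r addr_gt0 // mulr_gt0.
    have P2 : 1 * e1 t + A * e2 t <= 2 * e1 t by lra.
    have i1 : (1 * e1 t + A * e2 t) * (r * X) <= (2 * e1 t) * (r * (2 * K * e1 t)).
      apply: le_trans (_ : _ <= (1 * e1 t + A * e2 t) * (r * (2 * K * e1 t))) _.
        by rewrite ler_pM2l // ler_pM2l.
      by rewrite ler_wpM2r // !mulr_ge0 // ltW.
    have i2 : r * K * e1 t ^+ 2 <= r * K * e2 t by rewrite ler_pM2l // mulr_gt0.
    have i3 : 0 <= (1 * e1 t + A * e2 t) ^+ 2 by exact: sqr_ge0.
    have E : 1 * (lambda * (lambda * e1 t)) + A * (sg * (sg * e2 t)) -
       c * (1 * (lambda * e1 t) + A * (sg * e2 t)) =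
       (lambda ^+ 2 - c * lambda) * e1 t + A * (sg ^+ 2 - c * sg) * e2 t by ring.
    rewrite E lamE sgE.
    have E2 : A * (- chi - (1 - r)) * e2 t = - (4 * r * K) * e2 t - A * (1 - r) * e2 t.
      by rewrite -Achi; ring.
    rewrite E2; move: i1 i2 i3; clear; lra.
  - move=> t tt0; have [h1 h2 h3 h4 h5] := bnd _ tt0; rewrite -/(e1 t) -/(e2 t).
    have E : K * (lambda * (lambda * e1 t)) + K * A * (sg * (sg * e2 t)) -
       c * (K * (lambda * e1 t) + K * A * (sg * e2 t)) =
       K * (lambda ^+ 2 - c * lambda) * e1 t + K * A * (sg ^+ 2 - c * sg) * e2 t by ring.
    rewrite E lamE sgE -Kb.
    have i1 : 0 <= K * A * chi * e2 t by rewrite !mulr_ge0 // ltW.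
    have i2 : 0 <= K * (1 - r) * K * (1 * e1 t + A * e2 t) ^+ 2.
      apply: mulr_ge0; last exact: sqr_ge0.
      by rewrite Kb mulr_ge0 ?(ltW b0) ?(ltW K0).
    move: i1 i2; clear; lra.
  - exact: lim0.
  - exact: lim0.
have sub : tail_subsolution c b r (c * h) t0
    (fun t => 1 * expR (lambda * t) + - A' * expR (sg * t))
    (fun t => 1 * (lambda * expR (lambda * t)) + - A' * (sg * expR (sg * t)))
    (fun t => 1 * (lambda * (lambda * expR (lambda * t))) + - A' * (sg * (sg * expR (sg * t))))
    (fun t => K * expR (lambda * t) + - (K * A') * expR (sg * t))
    (fun t => K * (lambda * expR (lambda * t)) + - (K * A') * (sg * expR (sg * t)))
    (fun t => K * (lambda * (lambda * expR (lambda * t))) + - (K * A') * (sg * (sg * expR (sg * t)))).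
  split; try exact: deriv_exp_pair.
  - exists (t0 - 1); first by lra.
    have h1 : e1 (t0 - 1) <= A' * e2 (t0 - 1).
      by rewrite e213 mulrCA ler_peMr // ltW.
    rewrite -/(e1 (t0 - 1)) -/(e2 (t0 - 1)); split; first by lra.
    have : K * e1 (t0 - 1) <= K * (A' * e2 (t0 - 1)) by rewrite ler_pM2l.
    lra.
  - move=> t tt0; rewrite -/(e1 t) -/(e2 t) => F0.
    have [h1 h2] := e1s t tt0; have h3 := e12 t ltac:(lra).
    have Fe : 1 * e1 t + - A' * e2 t <= e1 t.
      by have : 0 < A' * e2 t by [rewrite mulr_gt0]; lra.
    set f := 1 * e1 t + - A' * e2 t in F0 Fe *.
    have hH : - (K * A' * e2 t) <= K * expR (lambda * (t - c * h)) + - (K * A') * expR (sg * (t - c * h)).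
      have : 0 <= K * expR (lambda * (t - c * h)) by rewrite mulr_ge0 ?expR_ge0 // ltW.
      have : expR (sg * (t - c * h)) <= e2 t by apply: ehomo => //; lra.
      have KA : 0 < K * A' by rewrite mulr_gt0.
      rewrite -(ler_pM2l KA); lra.
    set X := K * expR (lambda * (t - c * h)) + _ in hH *.
    have i1 : f * (r * - (K * A' * e2 t)) <= f * (r * X) by rewrite ler_wpM2l // ler_pM2l.
    have i2 : f * (2 * r * K * A' * e2 t) <= A' * chi * e2 t.
      have j1 : f * (2 * r * K * A' * e2 t) <= e1 t * (2 * r * K * A' * e2 t).
        by rewrite ler_wpM2r // !mulr_ge0 // ltW.
      have j2 : 2 * r * K * e1 t * (A' * e2 t) <= chi * (A' * e2 t).
        by rewrite ler_pM2r // mulr_gt0.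
      move: j1 j2; clear; lra.
    have i3 : f * f <= e2 t.
      by apply: le_trans h3; rewrite expr2 ler_pM.
    have i4 : 2 * e2 t <= A' * chi * e2 t by rewrite ler_pM2r.
    have E : 1 * (lambda * (lambda * e1 t)) + - A' * (sg * (sg * e2 t)) -
       c * (1 * (lambda * e1 t) + - A' * (sg * e2 t)) =
       (lambda ^+ 2 - c * lambda) * e1 t - A' * (sg ^+ 2 - c * sg) * e2 t by ring.
    rewrite E lamE sgE.
    have -> : - (1 - r) * e1 t - A' * (- chi - (1 - r)) * e2 t = - (1 - r) * f + A' * chi * e2 t.
      by rewrite /f; ring.
    move: i1 i2 i3 i4; clear; lra.
  - move=> t tt0; rewrite -/(e1 t) -/(e2 t) => G0.
    have h3 := e12 t ltac:(lra).
    have Fe : 1 * e1 t + - A' * e2 t <= e1 t.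
      by have : 0 < A' * e2 t by [rewrite mulr_gt0]; lra.
    have GE : K * e1 t + - (K * A') * e2 t = K * (1 * e1 t + - A' * e2 t) by ring.
    rewrite GE in G0 *; rewrite pmulr_rge0 // in G0.
    set f := 1 * e1 t + - A' * e2 t in GE G0 Fe *.
    have E : K * (lambda * (lambda * e1 t)) + - (K * A') * (sg * (sg * e2 t)) -
       c * (K * (lambda * e1 t) + - (K * A') * (sg * e2 t)) =
       K * ((lambda ^+ 2 - c * lambda) * e1 t - A' * (sg ^+ 2 - c * sg) * e2 t) by ring.
    rewrite E lamE sgE.
    have -> : - (1 - r) * e1 t - A' * (- chi - (1 - r)) * e2 t = - (1 - r) * f + A' * chi * e2 t.
      by rewrite /f; ring.
    have i3 : K * b * (f * f) <= K * b * e2 t.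
      by rewrite ler_pM2l ?mulr_gt0 //; apply: le_trans h3; rewrite expr2 ler_pM.
    have i4 : K * (b * e2 t) <= K * (A' * chi * e2 t) by rewrite ler_pM2l // ler_pM2r.
    have E5 : K * (- (1 - r) * f) = - b * f by rewrite -Kb; ring.
    move: i3 i4 E5; clear; lra.
  - move=> T.
    have AV' : 0 < (2 * A')^-1 by rewrite invr_gt0 mulr_gt0.
    have [S HS] := expR_lin_le eps0 AV'.
    exists (Num.min S (T - 1)); first by rewrite gt_min; apply/orP; right; lra.
    set t := Num.min S (T - 1).
    have tS : t <= S by rewrite ge_min lexx.
    rewrite -/(e1 t) -/(e2 t) mul1r mulNr subr_gt0 e213 mulrCA gtr_pMr //.
    have := HS t tS; rewrite -/(e3 t) -(@ler_pM2l _ A') // invfM mulrCA divff ?gt_eqF //; lra.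
have FP t : t < t0 -> 1 * expR (lambda * t) + - A' * expR (sg * t) <=
      1 * expR (lambda * t) + A * expR (sg * t) /\
    K * expR (lambda * t) + - (K * A') * expR (sg * t) <=
      K * expR (lambda * t) + K * A * expR (sg * t).
  have KA : 0 < K * A by rewrite mulr_gt0.
  have KA' : 0 < K * A' by rewrite mulr_gt0.
  by split; rewrite lerD2l ler_pM2r ?expR_gt0 //; move: KA KA' A0 A'0; clear; lra.
have [phi [psi [T [M [wf bd]]]]] := WT _ _ _ _ _ _ _ _ _ _ _ _ _ sup sub FP.
exists phi, psi, eps, (Num.min T 0), (A + A' + `|M| + K * A + K * A').
split=> // t; rewrite le_min => /andP[tT t00'].
have [/andP[p1 p2] /andP[p3 p4]] := bd t tT; rewrite -/sg -/(e2 t).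
have ec : `|M * expR (c / 2 * t)| <= `|M| * e2 t.
  rewrite normrM ler_wpM2l // ger0_norm ?expR_ge0 // ler_expR.
  by rewrite ler_wnM2r.
have KA : 0 < K * A * e2 t by rewrite !mulr_gt0.
have KA' : 0 < K * A' * e2 t by rewrite !mulr_gt0.
have Ae : 0 < A * e2 t by rewrite !mulr_gt0.
have Ae' : 0 < A' * e2 t by rewrite !mulr_gt0.
have Me : 0 <= `|M| * e2 t by rewrite mulr_ge0 // ltW.
have Kl : b * expR (lambda * t) / (1 - r) = K * expR (lambda * t).
  by rewrite -Kb; field; rewrite subr_eq0 gt_eqF.
rewrite Kl; move/ler_normlP: ec => [ec1 ec2].
rewrite -/(e2 t) in p1 p2 p3 p4.
rewrite !mulrDl; split; rewrite ler_norml; apply/andP; split;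
  move: p1 p2 p3 p4 ec1 ec2 KA KA' Ae Ae' Me; clear; lra.
Qed.

(** * The case r = 1 *)

Lemma deriv_atX (R : realType) (f : R -> R) (t a : R) (n : nat) :
  deriv_at f t a -> deriv_at (fun s => f s ^+ n.+1) t (n.+1%:R * f t ^+ n * a).
Proof.
move=> fa; elim: n => [|n IH].
  by apply: deriv_at_eq fa _; rewrite expr0 mulr1 mul1r.
apply: deriv_at_near; last first.
  by apply: deriv_at_eq (deriv_atM fa IH) _; rewrite -[in RHS]natr1 exprS; ring.
by near=> s; rewrite exprS.
Unshelve. all: by end_near. Qed.

Definition tail_log (R : realType) (t : R) : R := ln (- t).

Definition tail_rsqrt (R : realType) (t : R) : R := expR (- 2^-1 * tail_log t).

(** With s = (-t)^(-1/2) and l = ln (-t) one has s' = s^3 / 2 and l' = - s^2, so this family is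
    closed under differentiation, each derivative raising the power by two. *)
Definition log_mon (R : realType) (A B : R) (n : nat) (t : R) : R :=
  (A * tail_log t + B) * tail_rsqrt t ^+ n.

Lemma tail_rsqrt_gt0 (R : realType) (t : R) : 0 < tail_rsqrt t.
Proof. exact: expR_gt0. Qed.

Lemma tail_rsqrt2 (R : realType) (t : R) : t < 0 -> tail_rsqrt t ^+ 2 = (- t)^-1.
Proof.
move=> t0; rewrite /tail_rsqrt /tail_log expr2 -expRD.
have -> : - 2^-1 * ln (- t) + - 2^-1 * ln (- t) = - ln (- t) by field.
by rewrite expRN lnK // posrE oppr_gt0.
Qed.

Lemma deriv_tail_log (R : realType) (t : R) : t < 0 ->
  deriv_at (@tail_log R) t (- tail_rsqrt t ^+ 2).
Proof.
move=> t0.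
apply: deriv_at_eq (deriv_at_ln (f := fun s => - s) _ (deriv_atN (deriv_at_id t))) _.
  by rewrite oppr_gt0.
by rewrite tail_rsqrt2 // mulN1r.
Qed.

Lemma deriv_tail_rsqrt (R : realType) (t : R) : t < 0 ->
  deriv_at (@tail_rsqrt R) t (tail_rsqrt t ^+ 3 / 2).
Proof.
move=> t0; apply: deriv_at_eq (deriv_at_expR (deriv_atZ _ (deriv_tail_log t0))) _.
by rewrite -/(tail_rsqrt t); field.
Qed.

Lemma deriv_log_mon (R : realType) (A B : R) (n : nat) (t : R) : t < 0 ->
  deriv_at (log_mon A B n.+1) t
    (log_mon (n.+1%:R / 2 * A) (n.+1%:R / 2 * B - A) n.+3 t).
Proof.
move=> t0; apply: deriv_at_eq (deriv_atM
  (deriv_atD (deriv_atZ A (deriv_tail_log t0)) (deriv_at_cst B t))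
  (deriv_atX n (deriv_tail_rsqrt t0))) _.
by rewrite /log_mon !exprS; field.
Qed.

Lemma tail_log_ge (R : realType) (M : R) : \forall t \near -oo, M <= tail_log t :> R.
Proof.
exists (- expR M); split; first exact: num_real.
move=> t h; rewrite -[leLHS]expRK ler_ln ?posrE ?expR_gt0 //; [lra|].
by have := expR_gt0 M; lra.
Qed.

(** As s = e^(- l / 2), cubing e^(l / 6) >= l / 6 gives s l^3 <= 6^3, hence s l^2 <= 216 / l. *)
Lemma tail_rsqrt_log2_cvg (R : realType) :
  tail_rsqrt t * tail_log t * tail_log t @[t --> -oo] --> (0 : R).
Proof.
apply/cvgrPdist_le => e e0; near=> t.
have L1 : 1 <= tail_log t by near: t; exact: tail_log_ge.
have Le : 216 / e <= tail_log t by near: t; exact: tail_log_ge.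
set L := tail_log t in L1 Le *.
have L0 : 0 < L by lra.
rewrite sub0r normrN ger0_norm; last by rewrite !mulr_ge0 ?ltW // tail_rsqrt_gt0.
have S1 : tail_rsqrt t * expR (L / 2) = 1.
  by rewrite /tail_rsqrt -expRD -/L (_ : _ + _ = 0) ?expR0 //; field.
have E3 : expR (L / 2) = expR (L / 6) ^+ 3.
  by rewrite -expRM_natl; congr expR; field.
have E6 : (L / 6) ^+ 3 <= expR (L / 6) ^+ 3.
  rewrite lerXn2r // ?nnegrE ?expR_ge0 ?divr_ge0 ?ltW //.
  by have := @expR_ge1Dx R (L / 6); lra.
have h : tail_rsqrt t * (L / 6) ^+ 3 <= 1.
  by rewrite -[leRHS]S1 E3 ler_pM2l ?tail_rsqrt_gt0.
have h2 : tail_rsqrt t * L * L * L <= 216 by move: h; clear; lra.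
have eL : 216 <= e * L by move: Le; rewrite ler_pdivrMr // mulrC.
by rewrite -(ler_pM2r L0); lra.
Unshelve. all: by end_near. Qed.

Lemma tail_rsqrt_log_cvg (R : realType) :
  tail_rsqrt t * tail_log t @[t --> -oo] --> (0 : R).
Proof.
apply/cvgrPdist_le => e e0.
have := @tail_rsqrt_log2_cvg R => /cvgrPdist_le /(_ e e0) h; near=> t.
have L1 : 1 <= tail_log t by near: t; exact: tail_log_ge.
have : `|0 - tail_rsqrt t * tail_log t * tail_log t| <= e by near: t.
have S0 := ltW (tail_rsqrt_gt0 t).
have L0 : 0 <= tail_log t by lra.
rewrite !sub0r !normrN !ger0_norm ?mulr_ge0 //.
by apply: le_trans; rewrite ler_peMr // mulr_ge0.
Unshelve. all: by end_near. Qed.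

Lemma tail_rsqrt_cvg (R : realType) : tail_rsqrt t @[t --> -oo] --> (0 : R).
Proof.
apply/cvgrPdist_le => e e0.
have := @tail_rsqrt_log_cvg R => /cvgrPdist_le /(_ e e0) h; near=> t.
have L1 : 1 <= tail_log t by near: t; exact: tail_log_ge.
have : `|0 - tail_rsqrt t * tail_log t| <= e by near: t.
have S0 := ltW (tail_rsqrt_gt0 t).
have L0 : 0 <= tail_log t by lra.
rewrite !sub0r !normrN !ger0_norm ?mulr_ge0 //.
by apply: le_trans; rewrite ler_peMr.
Unshelve. all: by end_near. Qed.

Lemma tail_rsqrt_le (R : realType) (s t : R) : s <= t -> t < 0 -> tail_rsqrt s <= tail_rsqrt t.
Proof.
move=> st t0; rewrite ler_expR !mulNr lerN2 ler_pM2l ?invr_gt0 //.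
by rewrite ler_ln ?posrE; lra.
Qed.

(** Trades the delayed value for data at t, which makes the residuals polynomial in s and l; the
    crude remainder from two mean value steps is already of higher order. *)
Lemma delay_expansion (R : realType) (t0 t H M : R) (f f1 f2 : R -> R) :
  C2_before t0 f f1 f2 -> 0 <= H -> t < t0 -> (forall s, s <= t -> `|f2 s| <= M) ->
  `|f (t - H) - (f t - H * f1 t)| <= H ^+ 2 * M.
Proof.
move=> df H0 tt0 fM.
have d s : s <= t -> s < t0 by lra.
have [||x /andP[x1 x2] E] := @deriv_MVT R f f1 (t - H) t; first by lra.
  by move=> s /andP[_ /d /df[]].
have [||y /andP[y1 y2] E'] := @deriv_MVT R f1 f2 x t; first by lra.
  by move=> s /andP[_ /d /df[]].
have -> : f (t - H) - (f t - H * f1 t) = H * (f1 t - f1 x).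
  by move: E; rewrite subKr; lra.
rewrite E' normrM (ger0_norm H0) normrM expr2 -mulrA ler_wpM2l // mulrC.
apply: ler_pM => //; last exact: fM.
by rewrite ger0_norm; lra.
Qed.

Definition log_mon1 (R : realType) (A B : R) (n : nat) : R -> R :=
  log_mon (n%:R / 2 * A) (n%:R / 2 * B - A) n.+2.

Definition log_mon2 (R : realType) (A B : R) (n : nat) : R -> R :=
  log_mon1 (n%:R / 2 * A) (n%:R / 2 * B - A) n.+2.

Lemma log_mon_C2 (R : realType) (A B t0 : R) (n : nat) : t0 <= 0 ->
  C2_before t0 (log_mon A B n.+1) (log_mon1 A B n.+1) (log_mon2 A B n.+1).
Proof. by move=> t00 t tt0; split; apply: deriv_log_mon; lra. Qed.

Lemma C2_beforeD (R : realType) (t0 : R) (f f1 f2 g g1 g2 : R -> R) :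
  C2_before t0 f f1 f2 -> C2_before t0 g g1 g2 ->
  C2_before t0 (fun t => f t + g t) (fun t => f1 t + g1 t) (fun t => f2 t + g2 t).
Proof. by move=> df dg t tt0; split; apply: deriv_atD; [apply: (df t _).1|apply: (dg t _).1|apply: (df t _).2|apply: (dg t _).2]. Qed.

(* With s = (-t)^(-1/2), l = ln (-t), the tails are
     phi = al s^4 + (a l + a2) s^6 + P s^7,  psi = be s^2 + e l s^4 + rho P s^5,
   with P > 0 for the supersolution and P < 0 for the subsolution.  After division by s^9 and s^7,
   [crit_phi0], [crit_psi0] and [crit_phi1], [crit_psi1] are the coefficients of P^0 and P^1 in the
   residuals, apart from the leading terms - c / 2 and - b / 4 of the latter; they are written in
   s, u = s l and v = s l^2, which all tend to 0 at -oo. *)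
Definition crit_phi0 (R : realType) (al be e a a2 H s u v : R) : R :=
  12 * (a * u + a2 * s) - 7 * (a * s) - al * H * (2 * (e * u) - e * s)
  - al * (a * u + a2 * s) + e * (a * v + a2 * u) - (H * be + al) * (a * u + a2 * s)
  - s * (a * u + a2 * s) * (H * (2 * (e * u) - e * s) + (a * u + a2 * s)).

Definition crit_phi1 (R : realType) (al be e a a2 rho H s u : R) : R :=
  s * s * (63 / 4 - al * (5 / 2 * H * rho + 1) - H * be - al)
  + s * (rho * (a * u + a2 * s) + e * u)
  - s * s * s * ((5 / 2 * H * rho + 1) * (a * u + a2 * s) + H * (2 * (e * u) - e * s)
     + (a * u + a2 * s)).

Definition crit_psi0 (R : realType) (al be e a a2 b s u : R) : R :=
  6 * (e * u) - 5 * (e * s) - b * (al * (e * u)) - b * be * (a * u + a2 * s)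
  - b * e * (s * (a * u + a2 * s) * u).

Definition crit_psi1 (R : realType) (al be e a a2 rho b s u : R) : R :=
  s * s * (35 / 4 * rho - b * (al * rho + be))
  - b * (s * s * s) * (rho * (a * u + a2 * s) + e * u).

(** The s^6 term cancels because [be = 2 c], the terms s^8 l and s^8 by the first two hypotheses;
    [al * rho = c] turns the coefficient al rho + be - 7 c / 2 of P s^9 into - c / 2. *)
Lemma crit_phi_residual (R : realType) (c al e a a2 rho H P s l : R) :
  al * e = c * a -> 6 * al - c * a2 + c * a - 2 * c * al * H - al ^+ 2 = 0 -> al * rho = c ->
  let be := 2 * c in
  let phi := al * s ^+ 4 + ((a * l + a2) * s ^+ 6 + P * s ^+ 7) in
  let phi1 := 2 * al * s ^+ 6 + ((3 * (a * l + a2) - a) * s ^+ 8 + 7 / 2 * P * s ^+ 9) in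
  let phi2 := 6 * al * s ^+ 8 + ((12 * (a * l + a2) - 7 * a) * s ^+ 10 + 63 / 4 * P * s ^+ 11) in
  let psi := be * s ^+ 2 + (e * l * s ^+ 4 + rho * P * s ^+ 5) in
  let psi1 := be * s ^+ 4 + ((2 * e * l - e) * s ^+ 6 + 5 / 2 * rho * P * s ^+ 7) in
  phi2 - c * phi1 + phi * (psi - H * psi1 - phi) =
  s ^+ 9 * (P * (- (c / 2) + crit_phi1 al be e a a2 rho H s (s * l))
    + crit_phi0 al be e a a2 H s (s * l) (s * l * l)
    + P ^+ 2 * s ^+ 3 * (rho - (5 / 2 * H * rho + 1) * (s * s))).
Proof.
move=> R2 R3 R4 be phi phi1 phi2 psi psi1.
apply/eqP; rewrite -subr_eq0; apply/eqP.
(* The two sides differ by a combination of the hypotheses, written out so that what remains is a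
   plain identity. *)
transitivity (s ^+ 8 * l * (al * e - c * a)
  + s ^+ 8 * (6 * al - c * a2 + c * a - 2 * c * al * H - al ^+ 2)
  + s ^+ 9 * P * (al * rho - c)); last by rewrite R2 R3 R4; ring.
by rewrite /phi /phi1 /phi2 /psi /psi1 /crit_phi1 /crit_phi0 /be; field.
Qed.

(** The first three hypotheses, with [be = 2 c], cancel s^4, s^6 l and s^6; the last turns the
    coefficient b - 5 c rho / 2 of P s^7 into - b / 4. *)
Lemma crit_psi_residual (R : realType) (c b al e a a2 rho P s l : R) :
  b * al = 2 * c ^+ 2 -> b * a = 2 * c * e -> 4 * c + c * e + b * a2 - 4 * c ^+ 3 = 0 ->
  c * rho = b / 2 ->
  let be := 2 * c in
  let phi := al * s ^+ 4 + ((a * l + a2) * s ^+ 6 + P * s ^+ 7) in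
  let psi := be * s ^+ 2 + (e * l * s ^+ 4 + rho * P * s ^+ 5) in
  let psi1 := be * s ^+ 4 + ((2 * e * l - e) * s ^+ 6 + 5 / 2 * rho * P * s ^+ 7) in
  let psi2 := 2 * be * s ^+ 6 + ((6 * e * l - 5 * e) * s ^+ 8 + 35 / 4 * rho * P * s ^+ 9) in
  psi2 - c * psi1 + b * phi * (1 - psi) =
  s ^+ 7 * (P * (- (b / 4) + crit_psi1 al be e a a2 rho b s (s * l))
    + crit_psi0 al be e a a2 b s (s * l) - b * rho * P ^+ 2 * s ^+ 5).
Proof.
move=> R5 R6 R7 R8 be phi psi psi1 psi2.
apply/eqP; rewrite -subr_eq0; apply/eqP.
transitivity (s ^+ 4 * (b * al - 2 * c ^+ 2) + s ^+ 6 * l * (b * a - 2 * c * e)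
  + s ^+ 6 * (4 * c + c * e + b * a2 - 4 * c ^+ 3 - 2 * c * (b * al - 2 * c ^+ 2))
  - 5 / 2 * s ^+ 7 * P * (c * rho - b / 2)); last by rewrite R5 R6 R8 !subrr R7; ring.
by rewrite /phi /psi1 /psi2 /psi /crit_psi1 /crit_psi0 /be; field.
Qed.

Ltac cvg_poly s0 u0 v0 := repeat (first [exact: s0 | exact: u0 | exact: v0 | exact: cvg_cst
  | apply: cvg_norm | apply: cvgB | apply: cvgN | apply: cvgD | apply: cvgM]).

Lemma cvg0_near_le (R : realType) (F : set_system R) (FF : Filter F) (f : R -> R) (l k : R) :
  f t @[t --> F] --> l -> l = 0 -> 0 < k -> \forall t \near F, f t <= k.
Proof. by move=> fl l0 k0; apply: (cvgr_le l fl); rewrite l0. Qed.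

(** Apart from the positive bounds, everything here is a polynomial in (s, u, v), or its absolute
    value, vanishing at the origin. The first group decides the signs of the residuals, the second
    bounds the tails, the third serves monotonicity and the delay remainder. *)
Lemma critical_smallness (R : realType) (F : set_system R) (FF : Filter F)
    (s u v : R -> R) (c b al be e a a2 rho H : R) :
  s t @[t --> F] --> (0 : R) -> u t @[t --> F] --> (0 : R) -> v t @[t --> F] --> (0 : R) ->
  0 < c -> 0 < b -> 0 < al -> 0 < be -> 0 < rho ->
  \forall t \near F, let s := s t in let u := u t in let v := v t in
   [/\ [/\ `|crit_phi1 al be e a a2 rho H s u| + `|crit_phi0 al be e a a2 H s u v|
          + 2 * al * H * H * (2 * be + 11 * `|e|) * s + 18 * al * H * H * rho * (s * s * s * s)
          + rho * (s * s * s) <= c / 2,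
        (5 / 2 * H * rho + 1) * (s * s) <= rho &
        `|crit_psi0 al be e a a2 b s u| + `|crit_psi1 al be e a a2 rho b s u|
          + 2 * b * be * (s * s) <= b / 4],
      [/\ `|(a * u + a2 * s) * s| + s * s * s <= al, `|e * u * s| + rho * (s * s * s) <= be,
        2 * al * (s * s * s * s) <= 1 & 2 * be * (s * s) <= 1] &
      [/\ `|3 * ((a * u + a2 * s) * s) - a * (s * s)| <= 2 * al,
        `|2 * (e * u * s) - e * (s * s)| <= be & u <= 1]].
Proof.
move=> s0 u0 v0 c0 b0 al0 be0 rho0.
have z := (mulr0, mul0r, addr0, add0r, subr0, oppr0, normr0).
near=> t => /=; split; split; near: t; rewrite /crit_phi1 /crit_phi0 /crit_psi0 /crit_psi1;
  (apply: cvg0_near_le; [cvg_poly s0 u0 v0 | by rewrite ?z | lra]).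
Unshelve. all: by end_near. Qed.

Lemma critical_positivity (R : realType) (F : set_system R) (FF : Filter F)
    (s u : R -> R) (al a a2 N : R) :
  s t @[t --> F] --> (0 : R) -> u t @[t --> F] --> (0 : R) -> 0 < al ->
  \forall t \near F, `|(a * u t + a2 * s t) * s t| + N * (s t * s t * s t) <= al / 2.
Proof.
move=> s0 u0 al0.
have z := (mulr0, addr0, normr0).
by apply: cvg0_near_le; [cvg_poly s0 u0 s0|rewrite ?z|lra].
Qed.

Lemma cvgr0_monomial (R : realType) (F : set_system R) (FF : Filter F) (s : R -> R) (k : R)
    (n : nat) :
  s t @[t --> F] --> (0 : R) -> k * s t ^+ n.+1 @[t --> F] --> (0 : R).
Proof.
move=> s0; rewrite -[X in _ --> X](mulr0 k); apply: cvgM; first exact: cvg_cst.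
elim: n => [|n IH]; first exact: s0.
rewrite (_ : (fun t => s t ^+ n.+2) = (fun t => s t * s t ^+ n.+1)); last first.
  by apply/funext => t; rewrite exprS.
by have := cvgM s0 IH; rewrite mulr0; exact.
Qed.

(** Puts the exponential error of the base inside O(t^(-3)), as s^6 = (-t)^(-3). The constant 6^3
    comes from cubing e^x >= x at x = - c t / 6. *)
Lemma expR_le_cube (R : realType) (c t : R) : 0 < c -> t < 0 ->
  expR (c / 2 * t) <= 216 / c ^+ 3 * tail_rsqrt t ^+ 6.
Proof.
move=> c0 t0.
have -> : tail_rsqrt t ^+ 6 = (- t)^-1 ^+ 3 by rewrite -tail_rsqrt2 // -exprM.
have y0 : 0 < c * - t / 6 by rewrite divr_gt0 // mulr_gt0 // oppr_gt0.
have E3 : expR (c / 2 * - t) = expR (c * - t / 6) ^+ 3.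
  by rewrite -expRM_natl; congr expR; field.
have E6 : (c * - t / 6) ^+ 3 <= expR (c / 2 * - t).
  rewrite E3 lerXn2r // ?nnegrE ?expR_ge0 ?ltW //.
  by have := @expR_ge1Dx R (c * - t / 6); lra.
have -> : expR (c / 2 * t) = (expR (c / 2 * - t))^-1 by rewrite -expRN mulrN opprK.
have -> : 216 / c ^+ 3 * (- t)^-1 ^+ 3 = ((c * - t / 6) ^+ 3)^-1.
  by field; rewrite ?oppr_eq0 lt_eqF // gt_eqF.
by rewrite lef_pV2 // posrE ?expR_gt0 ?exprn_gt0.
Qed.

Lemma wavefront_critical (R : realType) (n : nat) (c b h Q : R) :
  0 < c -> 0 < b -> 0 <= h -> 0 < Q -> expR (Q - 2) = 2 * Q ->
  let k := 1 * b * expR (- (c / 2 * (c * h))) / (c ^+ 2 / 4) in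
  1 <= k -> 1 * ln k < Q * (c ^+ 2 / 4 - (1 - 1)) ->
  let E := c ^+ 2 * (1 + h + b^-1) - 4 in
  exists phi psi : R -> R, exists T C : R,
    positive_monotone_wavefront n 1 b h c phi (fun t => 1 - psi t) /\
    forall t, t <= T ->
      `|phi t - ((2 * c ^+ 2 / b) / t ^+ 2 - 8 * c / (3 * b) * E * (ln (- t) / t ^+ 3))|
        <= C * `|(t ^+ 3)^-1| /\
      `|(1 - psi t) - (1 + 2 * c / t - 4 / 3 * E * (ln (- t) / t ^+ 2))|
        <= C * `|(t ^+ 2)^-1|.
Proof.
move=> c0 b0 h0 Q0 QE k k1 kD E.
(* [al], [be], [a] cancel the residuals up to order s^8 l and s^6 l; the remaining coefficients of
   s^8 and s^6 are two affine equations in [a2] whose compatibility forces the value of [e].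
   Any [rho] strictly between 2 b / (5 c) and 3 b / (4 c) gives both leading terms the sign of - P. *)
pose H := c * h; pose al := 2 * c ^+ 2 / b; pose be := 2 * c; pose e := 4 / 3 * E.
pose a := 2 * c * e / b; pose a2 := - (4 * c + c * e - 4 * c ^+ 3) / b; pose rho := b / (2 * c).
have bn0 : b != 0 by rewrite gt_eqF.
have cn0 : c != 0 by rewrite gt_eqF.
have H0 : 0 <= H by rewrite mulr_ge0 // ltW.
have R2 : al * e = c * a by rewrite /al /a; field.
have R3 : 6 * al - c * a2 + c * a - 2 * c * al * H - al ^+ 2 = 0.
  by rewrite /al /a /a2 /e /E /H; field.
have R4 : al * rho = c by rewrite /al /rho; field; rewrite cn0.
have R5 : b * al = 2 * c ^+ 2 by rewrite /al; field.
have R6 : b * a = 2 * c * e by rewrite /a; field.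
have R7 : 4 * c + c * e + b * a2 - 4 * c ^+ 3 = 0 by rewrite /a2; field.
have R8 : c * rho = b / 2 by rewrite /rho; field.
have aE : 8 * c / (3 * b) * E = a by rewrite /a /e; field.
have al0 : 0 < al by rewrite divr_gt0 // mulr_gt0 // exprn_gt0.
have be0 : 0 < be by rewrite mulr_gt0.
have rho0 : 0 < rho by rewrite divr_gt0 // mulr_gt0.
have beE : be = 2 * c by [].
have alE : 2 * c ^+ 2 / b = al by [].
have eE : 4 / 3 * E = e by [].
rewrite alE eE aE.
clearbody a2 a e E al rho be.
pose S := @tail_rsqrt R; pose L := @tail_log R.
pose Phi P t := log_mon 0 al 4 t + (log_mon a a2 6 t + log_mon 0 P 7 t).
pose Phi1 P t := log_mon1 0 al 4 t + (log_mon1 a a2 6 t + log_mon1 0 P 7 t).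
pose Phi2 P t := log_mon2 0 al 4 t + (log_mon2 a a2 6 t + log_mon2 0 P 7 t).
pose Psi P t := log_mon 0 be 2 t + (log_mon e 0 4 t + log_mon 0 (rho * P) 5 t).
pose Psi1 P t := log_mon1 0 be 2 t + (log_mon1 e 0 4 t + log_mon1 0 (rho * P) 5 t).
pose Psi2 P t := log_mon2 0 be 2 t + (log_mon2 e 0 4 t + log_mon2 0 (rho * P) 5 t).
have PhiE P t : Phi P t = al * S t ^+ 4 + ((a * L t + a2) * S t ^+ 6 + P * S t ^+ 7).
  by rewrite /Phi /log_mon /S /L; ring.
have Phi1E P t : Phi1 P t = 2 * al * S t ^+ 6 + ((3 * (a * L t + a2) - a) * S t ^+ 8 + 7 / 2 * P * S t ^+ 9).
  by rewrite /Phi1 /log_mon1 /log_mon /S /L; field.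
have Phi2E P t : Phi2 P t = 6 * al * S t ^+ 8 + ((12 * (a * L t + a2) - 7 * a) * S t ^+ 10 + 63 / 4 * P * S t ^+ 11).
  by rewrite /Phi2 /log_mon2 /log_mon1 /log_mon /S /L; field.
have PsiE P t : Psi P t = be * S t ^+ 2 + (e * L t * S t ^+ 4 + rho * P * S t ^+ 5).
  by rewrite /Psi /log_mon /S /L; ring.
have Psi1E P t : Psi1 P t = be * S t ^+ 4 + ((2 * e * L t - e) * S t ^+ 6 + 5 / 2 * rho * P * S t ^+ 7).
  by rewrite /Psi1 /log_mon1 /log_mon /S /L; field.
have Psi2E P t : Psi2 P t = 2 * be * S t ^+ 6 + ((6 * e * L t - 5 * e) * S t ^+ 8 + 35 / 4 * rho * P * S t ^+ 9).
  by rewrite /Psi2 /log_mon2 /log_mon1 /log_mon /S /L; field.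
have dPhi P t0 : t0 <= 0 -> C2_before t0 (Phi P) (Phi1 P) (Phi2 P).
  by move=> t00; do ?apply: C2_beforeD; exact: log_mon_C2.
have dPsi P t0 : t0 <= 0 -> C2_before t0 (Psi P) (Psi1 P) (Psi2 P).
  by move=> t00; do ?apply: C2_beforeD; exact: log_mon_C2.
have limS : S t @[t --> -oo] --> (0 : R) by exact: tail_rsqrt_cvg.
have limU : S t * L t @[t --> -oo] --> (0 : R) by exact: tail_rsqrt_log_cvg.
have limV : S t * L t * L t @[t --> -oo] --> (0 : R) by exact: tail_rsqrt_log2_cvg.
have S0 t : 0 < S t by exact: tail_rsqrt_gt0.
have L0 t : t <= -1 -> 0 <= L t by move=> t1; rewrite ln_ge0; lra.
have S1 t : t <= -1 -> S t <= 1.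
  by move=> t1; rewrite -expR0 ler_expR mulNr oppr_le0 mulr_ge0 ?invr_ge0 //; exact: L0.
have Smono s t : s <= t -> t < 0 -> S s <= S t by exact: tail_rsqrt_le.
have S2 t : t < 0 -> S t ^+ 2 = (- t)^-1 by exact: tail_rsqrt2.
have LE t : L t = ln (- t) by [].
have Ecube t : t < 0 -> expR (c / 2 * t) <= 216 / c ^+ 3 * S t ^+ 6 by exact: expR_le_cube.
clearbody Phi Phi1 Phi2 Psi Psi1 Psi2 S L.
pose D P t := Psi P (t - H) - (Psi P t - H * Psi1 P t).
have resphi P t : Phi2 P t - c * Phi1 P t + Phi P t * (1 - 1 - Phi P t + 1 * Psi P (t - H)) =
    S t ^+ 9 * (P * (- (c / 2) + crit_phi1 al be e a a2 rho H (S t) (S t * L t))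
    + crit_phi0 al be e a a2 H (S t) (S t * L t) (S t * L t * L t)
    + P ^+ 2 * S t ^+ 3 * (rho - (5 / 2 * H * rho + 1) * (S t * S t))) + Phi P t * D P t.
  have := crit_phi_residual P (S t) (L t) R2 R3 R4; rewrite -beE /= -PhiE -Phi1E -Phi2E -PsiE -Psi1E => <-.
  by rewrite /D; ring.
have respsi P t : Psi2 P t - c * Psi1 P t + b * Phi P t * (1 - Psi P t) =
    S t ^+ 7 * (P * (- (b / 4) + crit_psi1 al be e a a2 rho b (S t) (S t * L t))
    + crit_psi0 al be e a a2 b (S t) (S t * L t) - b * rho * P ^+ 2 * S t ^+ 5).
  have := crit_psi_residual P (S t) (L t) R5 R6 R7 R8; rewrite -beE /= -PhiE -PsiE -Psi1E -Psi2E => <-.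
  by [].
have r01 : 0 < (1 : R) <= 1 by rewrite ltr01 lexx.
have WT := fun t0 f0 f1 f2 f3 f4 f5 f6 f7 f8 f9 fa fb => @wavefront_of_tails R n c b 1 h Q
  t0 f0 f1 f2 f3 f4 f5 f6 f7 f8 f9 fa fb c0 b0 r01 h0 Q0 QE k1 kD.
have HE : H = c * h by [].
rewrite -HE in WT.
clearbody H; clear HE.
clear R2 R3 R4 R5 R6 R7 R8 alE eE aE QE k1 kD bn0 cn0.
have [T0 [_ small]] := critical_smallness _ e a a2 H limS limU limV c0 b0 al0 be0 rho0.
have [t0 [t0m1 t0T0]] : exists t0, t0 <= -1 /\ t0 <= T0.
  by exists (Num.min (-1) T0); rewrite !ge_min !lexx orbT.
have small' t (tt0 : t < t0) := small t (lt_le_trans tt0 t0T0).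
move: small' => {small} /= small.
have {}L0 t : t < t0 -> 0 <= L t by move=> tt0; apply: L0; lra.
have {}S1 t : t < t0 -> S t <= 1 by move=> tt0; apply: S1; lra.
have t00 : t0 <= 0 by lra.
have PhiF P t : Phi P t = S t ^+ 4 * (al + ((a * (S t * L t) + a2 * S t) * S t + P * (S t * S t * S t))).
  by rewrite PhiE; ring.
have PsiF P t : Psi P t = S t ^+ 2 * (be + (e * (S t * L t) * S t + rho * P * (S t * S t * S t))).
  by rewrite PsiE; ring.
pose C := 2 * be + 11 * `|e|.
have C0 : 0 <= C by have := normr_ge0 e; rewrite /C; lra.
have DM P t : t < t0 -> `|D P t| <= H ^+ 2 * (S t ^+ 6 * C + 9 * rho * `|P| * S t ^+ 9).
  move=> tt0; apply: (delay_expansion (dPsi P t0 t00) H0 tt0) => s st.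
  have st0 : s < t0 by exact: le_lt_trans tt0.
  have Sst : S s <= S t by apply: Smono => //; exact: lt_le_trans t00.
  have [_ _ [_ _ u1]] := small s st0.
  have le6 : S s ^+ 6 <= S t ^+ 6 by rewrite lerXn2r // nnegrE ltW.
  have le9 : S s ^+ 9 <= S t ^+ 9 by rewrite lerXn2r // nnegrE ltW.
  have s60 : 0 <= S s ^+ 6 by rewrite exprn_ge0 // ltW.
  have s90 : 0 <= S s ^+ 9 by rewrite exprn_ge0 // ltW.
  have Ss0 := ltW (S0 s); have Ss1 := S1 s st0.
  have u0 : 0 <= S s * L s by rewrite mulr_ge0 // L0.
  apply: (@le_trans _ _ (S s ^+ 6 * C + 9 * rho * `|P| * S s ^+ 9)); last first.
    apply: lerD; first by rewrite ler_wpM2r.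
    by rewrite ler_wpM2l // !mulr_ge0 // ltW.
  rewrite Psi2E.
  have -> : 2 * be * S s ^+ 6 + ((6 * e * L s - 5 * e) * S s ^+ 8 + 35 / 4 * rho * P * S s ^+ 9) =
    S s ^+ 6 * (2 * be + 6 * (e * (S s * L s * S s)) - 5 * (e * (S s * S s))) + 35 / 4 * rho * S s ^+ 9 * P by ring.
  apply: le_trans (ler_normD _ _) _; apply: lerD.
    rewrite normrM (ger0_norm s60) ler_wpM2l //.
    have i1 : `|e * (S s * L s * S s)| <= `|e|.
      have p : 0 <= S s * L s * S s by rewrite mulr_ge0.
      by rewrite normrM (ger0_norm p) ler_piMr // mulr_ile1.
    have i2 : `|e * (S s * S s)| <= `|e|.
      have p : 0 <= S s * S s by rewrite mulr_ge0.
      by rewrite normrM (ger0_norm p) ler_piMr // mulr_ile1.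
    move/ler_normlP: i1 => [j1 j2]; move/ler_normlP: i2 => [j3 j4].
    rewrite /C ler_norml; apply/andP; split; move: be0 j1 j2 j3 j4; clear; lra.
  have p : 0 <= 35 / 4 * rho * S s ^+ 9 by rewrite !mulr_ge0 // ltW.
  rewrite normrM (ger0_norm p).
  have : 0 <= rho * `|P| * S s ^+ 9 by rewrite !mulr_ge0 ?(ltW rho0).
  clear; lra.
(* A factor O(s^4) times a delay remainder O(s^6): smaller by s than the leading term P s^9, and the
   part proportional to |P| by s^4. *)
have PhiD P t : t < t0 -> 0 <= Phi P t <= 2 * al * S t ^+ 4 ->
    `|Phi P t * D P t| <= S t ^+ 9 * (2 * al * H * H * C * S t + `|P| * (18 * al * H * H * rho * (S t * S t * S t * S t))).
  move=> tt0 /andP[p0 p1].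
  rewrite normrM (ger0_norm p0).
  apply: le_trans (ler_pM p0 (normr_ge0 _) p1 (DM P t tt0)) _.
  by rewrite le_eqVlt; apply/orP; left; apply/eqP; ring.
have n4 t : 0 < S t ^+ 4 by rewrite exprn_gt0.
have n2 t : 0 < S t ^+ 2 by rewrite exprn_gt0.
have kH0 : 0 <= 5 / 2 * H * rho + 1.
  by have := mulr_ge0 H0 (ltW rho0); clear; lra.
have n3 t : 0 < S t * S t * S t by rewrite !mulr_gt0.
have t0m : t0 - 1 < t0 by rewrite ltrBlDr ltrDl.
have sup : tail_supersolution c b 1 H t0 (Phi 1) (Phi1 1) (Phi2 1) (Psi 1) (Psi1 1) (Psi2 1).
  have b1 t : t < t0 -> 0 <= Phi 1 t <= 2 * al * S t ^+ 4.
    move=> tt0; have [_ [c7 _ _ _] _] := small t tt0.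
    rewrite PhiF mul1r; have := n3 t; set X := (a * _ + _) * _ in c7 *.
    have /ler_normlP[x1 x2] := lexx `|X|.
    move=> n3t; apply/andP; split.
      by rewrite pmulr_rge0 //; move: x1 x2 n3t c7; clear; lra.
    by rewrite [leRHS]mulrC ler_pM2l //; move: x1 x2 n3t c7; clear; lra.
  have b2 t : t < t0 -> 0 <= Psi 1 t <= 2 * be * S t ^+ 2.
    move=> tt0; have [_ [_ c8 _ _] _] := small t tt0.
    rewrite PsiF mulr1; have : 0 < rho * (S t * S t * S t) by rewrite mulr_gt0.
    have /ler_normlP[x1 x2] := lexx `|e * (S t * L t) * S t|.
    move=> n3t; apply/andP; split.
      by rewrite pmulr_rge0 //; move: x1 x2 n3t c8; clear; lra.
    by rewrite [leRHS]mulrC ler_pM2l //; move: x1 x2 n3t c8; clear; lra.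
  split; [exact: dPhi|exact: dPsi|..].
  - move=> t tt0; have [_ [_ _ c9 _] _] := small t tt0.
    have /andP[h1 h2] := b1 t tt0; rewrite h1 (le_trans h2) //.
    by apply: le_trans c9; rewrite le_eqVlt; apply/orP; left; apply/eqP; ring.
  - move=> t tt0; have [_ [_ _ _ c9] _] := small t tt0.
    have /andP[h1 h2] := b2 t tt0; rewrite h1 (le_trans h2) //.
  - move=> t tt0; have [_ _ [c10 _ _]] := small t tt0.
    rewrite Phi1E.
    have -> : 2 * al * S t ^+ 6 + ((3 * (a * L t + a2) - a) * S t ^+ 8 + 7 / 2 * 1 * S t ^+ 9) =
      S t ^+ 6 * (2 * al + (3 * ((a * (S t * L t) + a2 * S t) * S t) - a * (S t * S t)) + 7 / 2 * (S t * S t * S t)) by ring.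
    rewrite mulr_ge0 // ?exprn_ge0 ?(ltW (S0 t)) //.
    by have := n3 t; move/ler_normlP : c10 => [x1 x2]; move: x1 x2; clear; lra.
  - move=> t tt0; have [_ _ [_ c11 _]] := small t tt0.
    rewrite Psi1E.
    have -> : be * S t ^+ 4 + ((2 * e * L t - e) * S t ^+ 6 + 5 / 2 * rho * 1 * S t ^+ 7) =
      S t ^+ 4 * (be + (2 * (e * (S t * L t) * S t) - e * (S t * S t)) + 5 / 2 * (rho * (S t * S t * S t))) by ring.
    rewrite mulr_ge0 // ?exprn_ge0 ?(ltW (S0 t)) //.
    have : 0 < rho * (S t * S t * S t) by rewrite mulr_gt0.
    by move/ler_normlP : c11 => [x1 x2]; move: x1 x2; clear; lra.
  - move=> t tt0; have [[c4 c5 _] _ _] := small t tt0.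
    rewrite resphi.
    have /ler_normlP[_ h1] := PhiD 1 t tt0 (b1 t tt0).
    apply: le_trans (lerD (lexx _) h1) _; rewrite -mulrDr.
    rewrite mulr_ge0_le0 // ?exprn_ge0 ?(ltW (S0 t)) // normr1 !mul1r.
    move: c4; set G1 := crit_phi1 _ _ _ _ _ _ _ _ _; set G0 := crit_phi0 _ _ _ _ _ _ _ _ _.
    have /ler_normlP[_ g1] := lexx `|G1|; have /ler_normlP[_ g0] := lexx `|G0|.
    have h2 : 0 <= S t * S t * S t * ((5 / 2 * H * rho + 1) * (S t * S t)).
      apply: mulr_ge0; first exact: ltW.
      by apply: mulr_ge0 => //; apply: mulr_ge0; exact: ltW.
    rewrite -/C; move: g1 g0 h2; clear; lra.
  - move=> t tt0; have [[_ _ c6] _ _] := small t tt0.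
    rewrite respsi mulr_ge0_le0 // ?exprn_ge0 ?(ltW (S0 t)) // expr1n mulr1 mul1r.
    move: c6; set K1 := crit_psi1 _ _ _ _ _ _ _ _ _; set K0 := crit_psi0 _ _ _ _ _ _ _ _.
    have /ler_normlP[_ g1] := lexx `|K1|; have /ler_normlP[_ g0] := lexx `|K0|.
    have h1 : 0 <= b * rho * S t ^+ 5 by rewrite !mulr_ge0 ?exprn_ge0 ?(ltW (S0 t)) ?(ltW b0) ?(ltW rho0).
    have h2 : 0 <= 2 * b * be * (S t * S t) by rewrite !mulr_ge0 ?(ltW (S0 t)) ?(ltW b0) ?(ltW be0).
    move: g1 g0 h1 h2; clear; lra.
  - apply: (@squeeze_ninfty R _ (fun t => 2 * al * S t ^+ 4) (t0 - 1)); last exact: cvgr0_monomial.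
    by move=> t tt0; apply: b1; exact: le_lt_trans t0m.
  - apply: (@squeeze_ninfty R _ (fun t => 2 * be * S t ^+ 2) (t0 - 1)); last exact: cvgr0_monomial.
    by move=> t tt0; apply: b2; exact: le_lt_trans t0m.
pose t1 := t0 - 1.
have t1t0 : t1 < t0 by exact: t0m.
pose s3 := S t1 * S t1 * S t1.
have s30 : 0 < s3 by exact: n3.
(* The last two entries make both components nonpositive at [t1]; N >= 1 lets N times a small bound
   dominate the terms free of N. *)
pose N := Num.max 1 (Num.max (2 * al / s3) (2 * be / rho / s3)).
have [N1 N2 N3] : [/\ 1 <= N, 2 * al <= N * s3 & 2 * be <= rho * (N * s3)].
  split; first by rewrite le_max lexx.
    by rewrite -ler_pdivrMr // !le_max lexx orbT.
  by rewrite [leRHS]mulrC -ler_pdivrMr // -ler_pdivrMr // !le_max lexx !orbT.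
clearbody N.
have N0 : 0 < N by exact: lt_le_trans N1.
have NN : `|- N| = N by rewrite normrN gtr0_norm.
have sub : tail_subsolution c b 1 H t0 (Phi (- N)) (Phi1 (- N)) (Phi2 (- N))
    (Psi (- N)) (Psi1 (- N)) (Psi2 (- N)).
  split; [exact: dPhi|exact: dPsi|..].
  - exists t1 => //.
    have [_ [c7 c8 _ _] _] := small t1 t1t0; rewrite PhiF PsiF; split.
      rewrite mulr_ge0_le0 ?(ltW (n4 _)) // -/s3.
      move: c7; set X := (a * _ + _) * _; have /ler_normlP[_ x] := lexx `|X|.
      by rewrite -/s3; move: x N2 s30; clear; lra.
    rewrite mulr_ge0_le0 ?(ltW (n2 _)) // -/s3.
    have /ler_normlP[_ x] := lexx `|e * (S t1 * L t1) * S t1|.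
    have rs : 0 < rho * s3 by rewrite mulr_gt0.
    by move: c8; rewrite -/s3; move: x N3 rs; clear; lra.
  - move=> t tt0 F0; have [[c4 c5 _] [c7 _ _ _] _] := small t tt0.
    have F1 : Phi (- N) t <= 2 * al * S t ^+ 4.
      rewrite PhiF [leRHS]mulrC ler_pM2l //.
      have Ns : 0 < N * (S t * S t * S t) by rewrite mulr_gt0.
      move: c7; set X := (a * _ + _) * _; have /ler_normlP[_ x] := lexx `|X|.
      by have := n3 t; move: x Ns; clear; lra.
    rewrite resphi.
    have F01 : 0 <= Phi (- N) t <= 2 * al * S t ^+ 4 by rewrite F0.
    have /ler_normlP[h1 _] := PhiD (- N) t tt0 F01.
    rewrite -lerBlDr sub0r; apply: le_trans h1 _; rewrite ler_wpM2l ?exprn_ge0 ?(ltW (S0 t)) // NN sqrrN.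
    move: c4; set G1 := crit_phi1 _ _ _ _ _ _ _ _ _; set G0 := crit_phi0 _ _ _ _ _ _ _ _ _.
    rewrite -/C => c4.
    have g1 : N * G1 <= N * `|G1| by rewrite ler_pM2l // ler_norm.
    have g0 : - G0 <= N * `|G0|.
      apply: (@le_trans _ _ `|G0|); first by rewrite -normrN ler_norm.
      by rewrite ler_peMl.
    (* The half-line was fixed before N, so a term in N^2 cannot be made small; here it has the
       favourable sign. *)
    have h2 : 0 <= N ^+ 2 * S t ^+ 3 * (rho - (5 / 2 * H * rho + 1) * (S t * S t)).
      by rewrite mulr_ge0 ?subr_ge0 // mulr_ge0 ?exprn_ge0 ?(ltW (S0 t)) ?(ltW N0).
    have h3 : 2 * al * H * H * C * S t <= N * (2 * al * H * H * C * S t).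
      by rewrite ler_peMl // !mulr_ge0 ?(ltW (S0 t)) ?(ltW al0).
    have h4 : 0 <= N * (rho * (S t * S t * S t)) by exact: (mulr_ge0 (ltW N0) (mulr_ge0 (ltW rho0) (ltW (n3 t)))).
    have h5 := ler_wpM2l (ltW N0) c4.
    move: g1 g0 h2 h3 h4 h5; clear; lra.
  - move=> t tt0 G0'; have [[_ _ c6] [_ c8 _ _] _] := small t tt0.
    rewrite respsi mulr_ge0 ?exprn_ge0 ?(ltW (S0 t)) // sqrrN.
    move: G0'; rewrite PsiF pmulr_rge0 // => G0'.
    have /ler_normlP[_ x] := lexx `|e * (S t * L t) * S t|.
    have rs : 0 < rho * (S t * S t * S t) by rewrite mulr_gt0.
    (* In the psi-residual the N^2 term has the wrong sign, but where G >= 0 this bound reduces it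
       to a term linear in N, covered by [2 * b * be * (s * s)] in the smallness conditions. *)
    have j1 : rho * N * (S t * S t * S t) <= 2 * be.
      by move: G0' c8 x rs; clear; lra.
    have j2 : b * N * (S t * S t) * (rho * N * (S t * S t * S t)) <= b * N * (S t * S t) * (2 * be).
      by rewrite ler_wpM2l // !mulr_ge0 ?(ltW (S0 t)) ?(ltW b0) ?(ltW N0).
    move: c6; set K1 := crit_psi1 _ _ _ _ _ _ _ _ _; set K0 := crit_psi0 _ _ _ _ _ _ _ _ => c6.
    have g1 : N * K1 <= N * `|K1| by rewrite ler_pM2l // ler_norm.
    have g0 : - K0 <= N * `|K0|.
      apply: (@le_trans _ _ `|K0|); first by rewrite -normrN ler_norm.
      by rewrite ler_peMl.
    have h5 := ler_wpM2l (ltW N0) c6.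
    move: j2 g1 g0 h5; clear; lra.
  - move=> T.
    have [T2 [_ HT2]] := critical_positivity _ a a2 N limS limU al0.
    have [t [tT tT2]] : exists t, t < T /\ t < T2.
      by clear; have [] := leP T T2 => ?; [exists (T - 1)|exists (T2 - 1)]; split; lra.
    exists t => //.
    have := HT2 t tT2; rewrite PhiF pmulr_rgt0 //.
    set X := (a * _ + _) * _; have /ler_normlP[x _] := lexx `|X|.
    move: al0 x; clear; lra.
have FP t : t < t0 -> Phi (- N) t <= Phi 1 t /\ Psi (- N) t <= Psi 1 t.
  have NN1 : - N <= 1 by move: N0; clear; lra.
  move=> _; rewrite !PhiE !PsiE !lerD2l; split; rewrite ler_pM2r ?exprn_gt0 //.
  by rewrite ler_pM2l.
have [phi [psi [T [K [wf bd]]]]] := WT _ _ _ _ _ _ _ _ _ _ _ _ _ sup sub FP.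
pose Ke := `|K| * (216 / c ^+ 3).
have Ke0 : 0 <= Ke by exact: (mulr_ge0 (normr_ge0 _) (divr_ge0 (ler0n _ _) (exprn_ge0 _ (ltW c0)))).
exists phi, psi, (Num.min T (t0 - 1)), (`|a2| + 1 + N + rho * (1 + N) + Ke).
split=> // t; rewrite le_min => /andP[tT tt01].
have tt0 : t < t0 by exact: le_lt_trans t0m.
have tn0 : t < 0 by exact: lt_le_trans t00.
have [/andP[p1 p2] /andP[p3 p4]] := bd t tT.
have S2E : S t ^+ 2 = - t^-1 by rewrite S2 // invrN.
have S4E : S t ^+ 4 = (t ^+ 2)^-1.
  have -> : S t ^+ 4 = (S t ^+ 2) ^+ 2 by rewrite -exprM.
  by rewrite S2E sqrrN exprVn.
have S6E : S t ^+ 6 = - (t ^+ 3)^-1.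
  have -> : S t ^+ 6 = (S t ^+ 2) ^+ 3 by rewrite -exprM.
  by rewrite S2E exprNn exprVn -signr_odd expr1 mulN1r.
have s60 : 0 < S t ^+ 6 by rewrite exprn_gt0.
have s1 := S1 t tt0.
have s76 : S t ^+ 7 <= S t ^+ 6 by rewrite [leLHS]exprS ler_piMl // ltW.
have s54 : S t ^+ 5 <= S t ^+ 4 by rewrite [leLHS]exprS ler_piMl // ltW.
have s64 : S t ^+ 6 <= S t ^+ 4.
  have -> : S t ^+ 6 = S t ^+ 2 * S t ^+ 4 by rewrite -exprD.
  by rewrite ler_piMl ?(ltW (n4 t)) // exprn_ile1 // ltW.
have s70 : 0 < S t ^+ 7 by rewrite exprn_gt0.
have s50 : 0 < S t ^+ 5 by rewrite exprn_gt0.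
have ec : `|K * expR (c / 2 * t)| <= Ke * S t ^+ 6.
  rewrite normrM /Ke -[leRHS]mulrA ler_wpM2l // ger0_norm ?expR_ge0 //.
  exact: Ecube.
have ec4 : Ke * S t ^+ 6 <= Ke * S t ^+ 4 by rewrite ler_wpM2l.
move/ler_normlP: ec => [ec1 ec2].
have -> : `|(t ^+ 3)^-1| = S t ^+ 6 by rewrite -normrN -S6E gtr0_norm.
have -> : `|(t ^+ 2)^-1| = S t ^+ 4 by rewrite -S4E gtr0_norm.
have -> : al / t ^+ 2 - a * (ln (- t) / t ^+ 3) = al * S t ^+ 4 + a * L t * S t ^+ 6.
  by rewrite S4E S6E LE; ring.
have -> : 1 - psi t - (1 + 2 * c / t - e * (ln (- t) / t ^+ 2)) =
    - (psi t - (be * S t ^+ 2 + e * L t * S t ^+ 4)).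
  by rewrite S4E S2E beE LE; ring.
rewrite normrN.
move: p1 p2 p3 p4; rewrite !PhiE !PsiE => p1 p2 p3 p4.
have A1 : `|a2 * S t ^+ 6| <= `|a2| * S t ^+ 6 by rewrite normrM (gtr0_norm s60).
move/ler_normlP: A1 => [A1 A2].
have N7 : N * S t ^+ 7 <= N * S t ^+ 6 by rewrite ler_pM2l.
have Nr5 : rho * N * S t ^+ 5 <= rho * N * S t ^+ 4 by rewrite ler_pM2l // mulr_gt0.
have r5 : rho * S t ^+ 5 <= rho * S t ^+ 4 by rewrite ler_pM2l.
have q1 : 0 < N * S t ^+ 6 by rewrite mulr_gt0.
have q2 : 0 < rho * N * S t ^+ 6 by rewrite !mulr_gt0.
have q3 : 0 < rho * S t ^+ 6 by rewrite !mulr_gt0.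
have q4 : 0 < N * S t ^+ 4 by rewrite mulr_gt0.
have q5 : 0 < rho * N * S t ^+ 4 by rewrite !mulr_gt0.
have q6 : 0 < rho * S t ^+ 4 by rewrite !mulr_gt0.
have q7 : 0 <= `|a2| * S t ^+ 4 by rewrite mulr_ge0 // ltW.
have q8 : 0 <= `|a2| * S t ^+ 6 by rewrite mulr_ge0 // ltW.
have q12 : 0 < S t ^+ 4 by [].
have qK4 : 0 <= Ke * S t ^+ 4 by rewrite mulr_ge0 // ltW.
have qK6 : 0 <= Ke * S t ^+ 6 by rewrite mulr_ge0 // ltW.
split; rewrite ler_norml; apply/andP; split.
- by move: p1 A1 A2 N7 q1 q2 q3 s60 q8 qK6; clear; lra.
- by move: p2 A1 A2 ec2 s76 q1 q2 q3 s60 q8; clear; lra.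
- by move: p3 Nr5 q4 q5 q6 q7 q12 qK4; clear; lra.
- by move: p4 ec2 ec4 r5 q4 q5 q6 q7 q12; clear; lra.
Qed.

(** Since lambda^2 - c lambda = - (1 - r), the linearised equation gives 1 - theta(t) ~ b e^(lambda
    t) / (1 - r). The exponent [t - c * h] therefore goes with the delayed value
    [theta (t - c * h)], the one that enters the phi-equation. *)
Theorem theorem8 (R : realType) (n : nat) (r b h c : R)
  (hb : 0 < b) (hh : 0 <= h) (hr0 : 0 < r) (hr1 : r <= 1)
  (hc : 2 * Num.sqrt (1 - r) <= c) (hcs : c < c_sharp r b h)
  (hf : 0 < fcrit (c ^+ 2) r b h) :
  exists phi theta : R -> R,
    [/\ positive_monotone_wavefront n r b h c phi theta,
        r < 1 -> 2 * Num.sqrt (1 - r) < c ->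
          let lambda := (c - Num.sqrt (c ^+ 2 - 4 * (1 - r))) / 2 in
          exists2 eps : R, 0 < eps &
            phi = (fun t : R => expR (lambda * t))
              +O_ (at_ninfty R) (fun t : R => expR ((lambda + eps) * t)) /\
            (fun t : R => theta (t - c * h)) =
              (fun t : R => 1 - b * expR (lambda * (t - c * h)) / (1 - r))
              +O_ (at_ninfty R) (fun t : R => expR ((lambda + eps) * t))
      & r = 1 ->
          let E := c ^+ 2 * (1 + h + b^-1) - 4 in
          phi = (fun t : R => (2 * c ^+ 2 / b) / t ^+ 2
                  - 8 * c / (3 * b) * E * (ln (- t) / t ^+ 3))
              +O_ (at_ninfty R) (fun t : R => (t ^+ 3)^-1) /\
          theta = (fun t : R => 1 + 2 * c / t
                  - 4 / 3 * E * (ln (- t) / t ^+ 2))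
              +O_ (at_ninfty R) (fun t : R => (t ^+ 2)^-1)].
Proof.
have [c0 Q0 QE k1 kD] := speed_conditions hb hh hr0 hr1 hc hcs hf.
have [r1|r1] := ltP r 1; last first.
  have {}r1 : r = 1 by apply/eqP; rewrite eq_le hr1.
  rewrite {}r1 in k1 kD *.
  have [phi [psi [T [C [wf bd]]]]] := wavefront_critical n c0 hb hh Q0 QE k1 kD.
  exists phi, (fun t => 1 - psi t); split=> //.
  by move=> _; split; apply: (@eqaddO_ninfty R _ _ _ C T) => t /bd[].
have [phi [psi [eps [T [C [eps0 wf bd]]]]]] :=
  wavefront_noncritical n c0 hb hr0 r1 hh Q0 QE k1 kD.
exists phi, (fun t => 1 - psi t); split=> //; last by move=> r1'; move: r1; rewrite r1' ltxx.
move=> _ _ lambda; exists eps => //.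
have H0 : 0 <= c * h by rewrite mulr_ge0 // ltW.
have s0 : 0 <= lambda + eps.
  rewrite addr_ge0 ?(ltW eps0) // divr_ge0 // subr_ge0 -[leRHS]ger0_norm ?(ltW c0) //.
  by rewrite -sqrtr_sqr ler_wsqrtr // gerBl mulr_ge0 // subr_ge0.
split.
  apply: (@eqaddO_ninfty R _ _ _ C T) => t /bd[h1 _].
  by rewrite (ger0_norm (expR_ge0 _)).
(* Evaluating the error at t - c h only decreases it, as lambda + eps >= 0; the absolute value is
   taken because the sign of [C] is not known. *)
apply: (@eqaddO_ninfty R _ _ _ `|C| T) => t tT.
have [|_ h2] := bd (t - c * h); first by lra.
rewrite (ger0_norm (expR_ge0 _)) [X in `|X|](_ : _ =
  - (psi (t - c * h) - b * expR (lambda * (t - c * h)) / (1 - r))); last by ring.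
rewrite normrN; apply: le_trans h2 _.
apply: (@le_trans _ _ (`|C| * expR ((lambda + eps) * (t - c * h)))).
  by rewrite ler_wpM2r ?expR_ge0 // ler_norm.
by rewrite ler_wpM2l // ler_expR ler_wpM2l //; lra.
Qed.
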